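(* Let $X$ be a complex manifold of dimension $n$, let $s$ be a holomorphic section of a Hermitian holomorphic line bundle over $X$ such that $D=\mathrm{div}(s)$ is a normal crossings divisor with finitely many irreducible components, all of which are smooth, and let $\omega^{\mathrm{tame}}$ be a quasi-meromorphic top form with tame singularities along $D$. Then there are holomorphic sections $s_j$ of Hermitian holomorphic line bundles $(L_j,|\cdot|_j)$ over $X$, for $j=1,\dots,q$, such that $s_{j_1},\dots,s_{j_k}$ is a locally complete intersection for each $1\le j_1<\cdots<j_k\le q$ with $k\le\min\{n,q\}$, and $$\omega^{\mathrm{tame}}=\sum_{\substack{J\subseteq\{1,\dots,q\}\\0\le|J|\le\min\{n,q\}}}\widetilde\omega_J\wedge\bigwedge_{j\in J}\partial\log|s_j|_j^2\wedge\bar\partial\log|s_j|_j^2,$$ where $\widetilde\omega_J$ is a smooth $(n-|J|,n-|J|)$-form on $X$.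
   Context: A quasi-meromorphic form (with singularities defined by $(s)$, with $V=\{s=0\}$ and a smooth Hermitian metric $\|\cdot\|$) is a smooth form $\omega$ on $X\setminus V$ such that for every compact $K\subseteq X$ there is $N$ such that $\|s\|^{2N}\omega$ extends to a smooth form across $V\cap K$. The identity is one of forms off the singular sets. A normal crossings divisor may have multiplicities: locally its support is $\{z_1\cdots z_\kappa=0\}$ in suitable holomorphic coordinates. A quasi-meromorphic top form has tame singularities along $D$ if locally there are holomorphic coordinates $z=(z_1,\dots,z_n)$ in which $D$ has support $\{z_1\cdots z_\kappa=0\}$, $0\le\kappa\le n$, and the form equals $\widetilde\omega/|z_1\cdots z_\kappa|^2$ with $\widetilde\omega$ a smooth top form. Sections $s_{j_1},\dots,s_{j_k}$ form a locally complete intersection if their common zero set is empty or has pure codimension $k$. All Hermitian metrics are smooth. *)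

(* Defs.v *)
From HB Require Import structures.
From mathcomp Require Import all_boot all_order all_algebra.
From mathcomp Require Import all_classical all_reals all_analysis.
From mathcomp Require Import complex.

Set Implicit Arguments.
Unset Strict Implicit.
Unset Printing Implicit Defensive.

Import Order.TTheory GRing.Theory Num.Theory.
Import numFieldNormedType.Exports.

Local Open Scope classical_set_scope.
Local Open Scope ring_scope.
Local Open Scope complex_scope.

(** The metric topology of C, as inherited from its regular module. *)
#[warnings="-redundant-canonical-projection"]
HB.instance Definition _ (R : realType) := NormedModule.copy R[i] R[i]^o.

(** * Smooth and holomorphic functions on open subsets of C^n *)

Section Calculus.
Context {R : realType} {n : nat}.
Local Notation C := R[i].
Local Notation V := 'rV[R[i]]_n.
Implicit Types (v x : V) (f : V -> C) (U : set V).

Definition line_re v f x : R -> R := fun t => complex.Re (f (x + t%:C *: v)).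
Definition line_im v f x : R -> R := fun t => complex.Im (f (x + t%:C *: v)).

(** The derivative of [f] at [x] in the direction [v], for a real parameter. *)
Definition rderivable v f x : Prop :=
  derivable (line_re v f x) 0 1 /\ derivable (line_im v f x) 0 1.
Definition rderive v f x : C := derive1 (line_re v f x) 0 +i* derive1 (line_im v f x) 0.

(** With z_j = x_j + i y_j, these are the directions of x_j and of y_j. *)
Definition dir_x (j : 'I_n) : V := delta_mx 0 j.
Definition dir_y (j : 'I_n) : V := 'i%C *: delta_mx 0 j.

(** All iterated partial derivatives of order at most [k] with respect to the
    2n real coordinates exist and are continuous on the open set [U]. *)
Fixpoint Ck (k : nat) U f : Prop :=
  (forall x, U x -> {for x, continuous f}) /\
  if k is k'.+1 then
    forall j v, v = dir_x j \/ v = dir_y j ->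
      (forall x, U x -> rderivable v f x) /\ Ck k' U (rderive v f)
  else True.

Definition smooth_on U f : Prop := forall k, Ck k U f.

(** Wirtinger derivatives *)
Definition d_z (j : 'I_n) f x : C :=
  2^-1 * (rderive (dir_x j) f x - 'i%C * rderive (dir_y j) f x).
Definition d_zbar (j : 'I_n) f x : C :=
  2^-1 * (rderive (dir_x j) f x + 'i%C * rderive (dir_y j) f x).

Definition holomorphic_on U f : Prop :=
  smooth_on U f /\ forall x j, U x -> d_zbar j f x = 0.

End Calculus.

(** * Complexified exterior algebra of the cotangent space of C^n *)

Section Exterior.
Context {R : realType} {n : nat}.
Local Notation C := R[i].

(** The generators are indexed by ['I_(n + n)]: [lshift n k] stands for dz_k
    and [rshift n k] for its conjugate.  An element is given by its
    coefficients on the products of generators, taken in increasing order. *)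
Definition ext := {ffun {set 'I_(n + n)} -> C}.

Definition ext_one : ext := [ffun S => (S == finset.set0)%:R].
Definition ext_gen (i : 'I_(n + n)) : ext :=
  [ffun S => (S == finset.set1 i)%:R].
Definition ext_dz (k : 'I_n) : ext := ext_gen (lshift n k).
Definition ext_dzbar (k : 'I_n) : ext := ext_gen (rshift n k).
Definition ext_scale (a : C) (e : ext) : ext := [ffun S => a * e S].

(** The sign of the permutation that sorts [A] followed by [B]. *)
Definition shuffle_sign (A B : {set 'I_(n + n)}) : C :=
  (-1) ^+ #|[pred ab : 'I_(n + n) * 'I_(n + n) |
              [&& ab.1 \in A, ab.2 \in B & (ab.2 < ab.1)%N]]|.

Definition ext_wedge (a b : ext) : ext :=
  [ffun S : {set 'I_(n + n)} =>
     \sum_(A : {set 'I_(n + n)} | A \subset S)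
        shuffle_sign A (S :\: A)%SET * a A * b (S :\: A)%SET].

Definition bidegree (p q : nat) (e : ext) : Prop :=
  forall S, e S != 0 ->
    #|[pred k : 'I_n | lshift n k \in S]| = p /\
    #|[pred k : 'I_n | rshift n k \in S]| = q.

(** The pullback by a holomorphic map w(z) with [A k l] = dw_l/dz_k: the
    algebra morphism with dw_l |-> sum_k A k l dz_k, and similarly for the
    conjugates. *)
Definition ext_pull_gen (A : 'M[C]_n) (i : 'I_(n + n)) : ext :=
  match fintype.split i with
  | inl l => \sum_k ext_scale (A k l) (ext_dz k)
  | inr l => \sum_k ext_scale ((A k l)^*%C) (ext_dzbar k)
  end.

Definition ext_pull (A : 'M[C]_n) (e : ext) : ext :=
  \sum_(S : {set 'I_(n + n)})
     ext_scale (e S) (\big[ext_wedge/ext_one]_(i in S) ext_pull_gen A i).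

End Exterior.
Arguments ext R n : clear implicits.

(** * Complex manifolds *)

(** [cinv] is the inverse of the coordinate map; only its values on the image
    of [cdom] matter. *)
Record chart (R : realType) (n : nat) (T : topologicalType) := Chart {
  cdom : set T;
  cmap : T -> 'rV[R[i]]_n;
  cinv : 'rV[R[i]]_n -> T;
  cdom_open : open cdom;
  cimg_open : open (cmap @` cdom);
  cmapK : forall x, cdom x -> cinv (cmap x) = x;
  cmap_continuous : forall x, cdom x -> {for x, continuous cmap};
  cinv_continuous : forall x, cdom x -> {for cmap x, continuous cinv}
}.

Section Charts.
Context {R : realType} {n : nat} {T : topologicalType}.
Implicit Types c d : chart R n T.

Definition coord c (k : 'I_n) (x : T) : R[i] := cmap c x 0 k.

(** The image in [c] of the part of [W] that lies in the domain of [c]. *)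
Definition cimg c (W : set T) : set 'rV[R[i]]_n := cmap c @` (cdom c `&` W).

Definition in_chart {A : Type} c (f : T -> A) : 'rV[R[i]]_n -> A :=
  fun z => f (cinv c z).

Definition holo_transition c d : Prop :=
  forall k, holomorphic_on (cimg c (cdom d)) (in_chart c (coord d k)).

Definition transition_jacobian c d (x : T) : 'M[R[i]]_n :=
  \matrix_(k, l) d_z k (in_chart c (coord d l)) (cmap c x).

End Charts.

(** The atlas is maximal, so its charts are all the local holomorphic
    coordinate systems. *)
Record complex_manifold (R : realType) (n : nat) := ComplexManifold {
  carrier :> topologicalType;
  atlas : set (chart R n carrier);
  manifold_hausdorff : hausdorff_space carrier;
  manifold_second_countable : @second_countable carrier;
  atlas_cover : forall x, exists2 c, atlas c & cdom c x;
  atlas_compatible : forall c d, atlas c -> atlas d -> holo_transition c d;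
  atlas_maximal : forall c,
    (forall d, atlas d -> holo_transition c d /\ holo_transition d c) -> atlas c
}.

Section Functions.
Context {R : realType} {n : nat} (X : complex_manifold R n).
Implicit Types (W : set X) (f : X -> R[i]).

Definition smooth_fun W f : Prop :=
  forall c, atlas c -> smooth_on (cimg c W) (in_chart c f).
Definition holo_fun W f : Prop :=
  forall c, atlas c -> holomorphic_on (cimg c W) (in_chart c f).

End Functions.

(** * Analytic subsets *)

Section Analytic.
Context {R : realType} {n : nat} (X : complex_manifold R n).
Implicit Types (A Z : set X) (p : X).

Definition analytic A : Prop :=
  forall p, exists W : set X, [/\ open W, W p &
    exists m (f : 'I_m -> X -> R[i]), (forall i, holo_fun W (f i)) /\
      forall x, W x -> (A x <-> forall i, f i x = 0)].

Definition irreducible_analytic A : Prop :=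
  [/\ analytic A, A !=set0 &
      forall B C, analytic B -> analytic C -> A = B `|` C -> B = A \/ C = A].

Definition irreducible_component A Z : Prop :=
  [/\ irreducible_analytic Z, Z `<=` A &
      forall Y, irreducible_analytic Y -> Y `<=` A -> Z `<=` Y -> Y = Z].

(** Near [p], the set [A] is a submanifold of codimension [k]. *)
Definition regular_point A (k : nat) p : Prop :=
  [/\ A p, (k <= n)%N &
      exists c, [/\ atlas c, cdom c p &
        forall x, cdom c x ->
          (A x <-> forall i : 'I_n, (i < k)%N -> coord c i x = 0)]].

Definition smooth_analytic A : Prop :=
  analytic A /\ forall p, A p -> exists k, regular_point A k p.

(** The dimension of an analytic set [A] at [p] is the upper limit, as x tends
    to [p] in the regular locus, of the dimension of [A] at x; so its
    codimension is a lower limit. *)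
Definition codim_at A p (k : nat) : Prop :=
  (forall W : set X, open W -> W p -> exists2 x, W x & regular_point A k x) /\
  (exists W : set X, [/\ open W, W p &
     forall x j, W x -> regular_point A j x -> (k <= j)%N]).

Definition pure_codim A (k : nat) : Prop :=
  analytic A /\ forall p, A p -> codim_at A p k.

(** In the chart [c], the set [A] is {z_1 ... z_kappa = 0}. *)
Definition nc_chart A (c : chart R n X) (kappa : nat) : Prop :=
  [/\ atlas c, (kappa <= n)%N &
      forall x, cdom c x ->
        (A x <-> \prod_(k < n | (k < kappa)%N) coord c k x = 0)].

Definition normal_crossings A : Prop :=
  forall p, exists c kappa, cdom c p /\ nc_chart A c kappa.

End Analytic.

(** * Hermitian holomorphic line bundles *)

(** A line bundle is given by a trivializing cover and its cocycle. *)
Record line_bundle (R : realType) (n : nat) (X : complex_manifold R n) :=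
LineBundle {
  lb_index : Type;
  lb_dom : lb_index -> set X;
  lb_trans : lb_index -> lb_index -> X -> R[i];
  lb_open : forall a, open (lb_dom a);
  lb_cover : forall x, exists a, lb_dom a x;
  lb_holo : forall a b, holo_fun (lb_dom a `&` lb_dom b) (lb_trans a b);
  lb_neq0 : forall a b x, lb_dom a x -> lb_dom b x -> lb_trans a b x != 0;
  lb_cocycle : forall a b c x, lb_dom a x -> lb_dom b x -> lb_dom c x ->
    lb_trans a b x * lb_trans b c x = lb_trans a c x
}.

Record holo_section (R : realType) (n : nat) (X : complex_manifold R n)
    (L : line_bundle X) := HoloSection {
  sec : lb_index L -> X -> R[i];
  sec_holo : forall a, holo_fun (lb_dom a) (sec a);
  sec_trans : forall a b x, lb_dom a x -> lb_dom b x ->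
    sec a x = lb_trans a b x * sec b x
}.

Definition sqnorm (R : realType) (z : R[i]) : R :=
  complex.Re z ^+ 2 + complex.Im z ^+ 2.

(** [met a] is the squared norm of the frame over [lb_dom a]. *)
Record hermitian_metric (R : realType) (n : nat) (X : complex_manifold R n)
    (L : line_bundle X) := HermitianMetric {
  met : lb_index L -> X -> R;
  met_smooth : forall a, smooth_fun (lb_dom a) (fun x => (met a x)%:C);
  met_gt0 : forall a x, lb_dom a x -> 0 < met a x;
  met_trans : forall a b x, lb_dom a x -> lb_dom b x ->
    met b x = met a x * sqnorm (lb_trans a b x)
}.

Section Sections.
Context {R : realType} {n : nat} {X : complex_manifold R n}.
Context {L : line_bundle X}.
Implicit Types (h : hermitian_metric L) (s : holo_section L).

Definition zero_set s : set X := [set x | exists2 a, lb_dom a x & sec s a x = 0].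

(** The squared norm of [s] at [x], computed in any trivialization at [x]. *)
Definition norm2 h s (x : X) : R :=
  xget 0 [set r | exists2 a, lb_dom a x & r = met h a x * sqnorm (sec s a x)].

Definition log_norm2 h s (x : X) : R[i] := (ln (norm2 h s x))%:C.

End Sections.

(** * Differential forms *)

Section Forms.
Context {R : realType} {n : nat} (X : complex_manifold R n).

(** [w c x] is the value at [x], expressed in the coordinates of [c]; it is
    meaningful only for [c] in the atlas and [x] in its domain. *)
Definition dform := chart R n X -> X -> ext R n.

Definition smooth_form (W : set X) (p q : nat) (w : dform) : Prop :=
  [/\ (forall c d x, atlas c -> atlas d -> W x -> cdom c x -> cdom d x ->
         w c x = ext_pull (transition_jacobian c d x) (w d x)),
      (forall c x, atlas c -> W x -> cdom c x -> bidegree p q (w c x)) &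
      (forall c S, atlas c ->
         smooth_on (cimg c W) (in_chart c (fun x => w c x S)))].

Definition wedge (w1 w2 : dform) : dform :=
  fun c x => ext_wedge (w1 c x) (w2 c x).
Definition dform_one : dform := fun _ _ => ext_one.

Definition del (f : X -> R[i]) : dform := fun c x =>
  \sum_k ext_scale (d_z k (in_chart c f) (cmap c x)) (ext_dz k).
Definition delbar (f : X -> R[i]) : dform := fun c x =>
  \sum_k ext_scale (d_zbar k (in_chart c f) (cmap c x)) (ext_dzbar k).

Definition quasi_meromorphic (L : line_bundle X) (h : hermitian_metric L)
    (s : holo_section L) (p q : nat) (w : dform) : Prop :=
  smooth_form (~` zero_set s) p q w /\
  forall K : set X, compact K -> exists (N : nat) (W : set X) (e : dform),
    [/\ open W, zero_set s `&` K `<=` W, smooth_form W p q e &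
        forall c x, atlas c -> cdom c x -> W x -> ~ zero_set s x ->
          e c x = ext_scale ((norm2 h s x ^+ N)%:C) (w c x)].

(** Top forms are forms of bidegree (n, n); [A] is the support of the
    divisor. *)
Definition tame (A : set X) (w : dform) : Prop :=
  forall p, exists c kappa (e : dform),
    [/\ cdom c p, nc_chart A c kappa, smooth_form (cdom c) n n e &
        forall x, cdom c x -> ~ A x ->
          w c x = ext_scale
            ((sqnorm (\prod_(k < n | (k < kappa)%N) coord c k x))^-1%:C)
            (e c x)].

End Forms.

(* Main.v *)
(** Let D be the zero set of [s0], and call a point of D regular when D is a coordinate
    hyperplane {z_i = 0} near it.  By the identity theorem the closures of the connected
    components of the regular locus are irreducible, and they are the irreducible
    components D_1, ..., D_q of D.  Since these are smooth, the local branches {z_i = 0},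
    i in I, of D at a point p belong to distinct D_j, which are thus coordinate
    hyperplanes near p.  Dividing holomorphic functions by local equations of D_j gives
    the cocycle of the line bundle O(D_j), with a canonical section s_j and a metric
    obtained from a partition of unity.

    Near p, for j = j(i), the form z_i del log |s_j|^2 is smooth and equals dz_i at p.
    Its products with its conjugate, over i in I, together with the dz_k /\ dzbar_k for k
    not in I, hence make up a smooth top form that does not vanish at p, and the smooth
    numerator of omega is a multiple of it.  This yields local forms w_J, which are glued
    by a partition of unity. *)

Require Import Defs.
From HB Require Import structures.
From mathcomp Require Import all_boot all_order all_algebra.
From mathcomp Require Import fingroup perm.
From mathcomp Require Import all_classical all_reals all_analysis.
From mathcomp Require Import complex.
From mathcomp Require Import ring lra zify.
(* Again, since [coord] now denotes that of mathcomp's vector spaces. *)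
Require Import Defs.

Set Implicit Arguments.
Unset Strict Implicit.
Unset Printing Implicit Defensive.

Import Order.TTheory GRing.Theory Num.Theory.
Import numFieldNormedType.Exports.

Local Open Scope classical_set_scope.
Local Open Scope ring_scope.
Local Open Scope complex_scope.

(** * Calculus in several complex variables *)

(** The analytic input comes from real calculus. The identity theorem rests on the strict positivity
    of the Laplacian of |g|^2 + eps |z_j|^2, which excludes interior maxima. Division by z_i rests
    on the integral of [d_z i f] along the path that shrinks z_i to 0: the quotient is smooth before
    it is known to be holomorphic. The geometric obstacle is that a connected component of the
    regular locus might return to a point of D along two different branches, so that no single
    coordinate could be its local equation there. Smoothness of the closure forbids this, because a
    function that vanishes on two crossing coordinate hyperplanes has zero differential at the
    crossing. The decomposition reduces to scalars because a form of bidegree (n, n) has one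
    coefficient only. Near p just one set J is used, that of the j whose D_j passes through p, and
    the factors of |z_1 ... z_kappa|^2 that do not vanish at p are absorbed in the smooth
    coefficient. As J changes with p, each w_J is the sum of the localized terms that carry the set
    J. *)

Section ComplexTopology.
Context {R : realType}.
Local Notation C := R[i].
Implicit Types (z w : C) (T : Type).

Lemma Re_le_norm z : `|complex.Re z|%:C <= `|z|.
Proof. exact: normc_ge_Re. Qed.

Lemma Im_le_norm z : `|complex.Im z|%:C <= `|z|.
Proof.
have := Re_le_norm ('i%C * z).
by rewrite mulrC ReiNIm normrN normrM [`|'i%C|]normc_def /= expr0n expr1n /= add0r sqrtr1 mulr1.
Qed.

Lemma norm_le_ReIm z : `|z| <= (`|complex.Re z| + `|complex.Im z|)%:C.
Proof.
rewrite {1}(complexE z) rmorphD (le_trans (ler_normD _ _)) // lerD //.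
  by rewrite normc_def /= expr0n addr0 sqrtr_sqr.
by rewrite normrM !normc_def /= !expr0n expr1n /= add0r sqrtr1 mul1r addr0 sqrtr_sqr.
Qed.

Lemma norm_real_complex (r : R) : `|r%:C| = `|r|%:C.
Proof. by rewrite normc_def /= expr0n addr0 sqrtr_sqr. Qed.

Lemma gt0_complexP (e : C) : 0 < e -> exists2 r : R, 0 < r & e = r%:C.
Proof.
case: e => a b; rewrite ltcE /= => /andP[/eqP -> a0].
by exists a.
Qed.

Lemma cvg_complexP T (F : set_system T) {FF : Filter F} (f : T -> C) z :
  f @ F --> z <-> (fun t => complex.Re (f t)) @ F --> complex.Re z /\
                  (fun t => complex.Im (f t)) @ F --> complex.Im z.
Proof.
split => [fz|[fr fi]].
  split; apply/cvgrPdist_lt => e e0.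
    move/cvgrPdist_lt : fz => /(_ e%:C); rewrite ltcR => /(_ e0).
    apply: filterS => t; rewrite -ltcR; apply: le_lt_trans.
    by rewrite -(raddfB (@complex.Re R)) Re_le_norm.
  move/cvgrPdist_lt : fz => /(_ e%:C); rewrite ltcR => /(_ e0).
  apply: filterS => t; rewrite -ltcR; apply: le_lt_trans.
  by rewrite -(raddfB (@complex.Im R)) Im_le_norm.
apply/cvgrPdist_lt => _ /gt0_complexP[e e0 ->].
have e20 : 0 < e / 2 by rewrite divr_gt0.
move/cvgrPdist_lt : fr => /(_ _ e20) fr; move/cvgrPdist_lt : fi => /(_ _ e20) fi.
near=> t; apply: le_lt_trans (norm_le_ReIm _) _.
rewrite ltcR [ltRHS](splitr e) ltrD //.
  by rewrite (raddfB (@complex.Re R)); near: t; exact: fr.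
by rewrite (raddfB (@complex.Im R)); near: t; exact: fi.
Unshelve. all: by end_near. Qed.

Lemma Re_continuous : continuous (@complex.Re R : C -> R).
Proof. by move=> z; have /cvg_complexP[] := @cvg_id _ (nbhs z). Qed.

Lemma Im_continuous : continuous (@complex.Im R : C -> R).
Proof. by move=> z; have /cvg_complexP[] := @cvg_id _ (nbhs z). Qed.

Lemma cvg_real_complex T (F : set_system T) {FF : Filter F} (f : T -> R) (r : R) :
  f @ F --> r -> (fun t => (f t)%:C) @ F --> r%:C.
Proof. by move=> fr; apply/cvg_complexP; split => //=; exact: cvg_cst. Qed.

Lemma cvg_conjc T (F : set_system T) {FF : Filter F} (f : T -> C) z :
  f @ F --> z -> (fun t => (f t)^*%C) @ F --> z^*%C.
Proof.
move=> /cvg_complexP[fr fi]; apply/cvg_complexP; split.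
  rewrite (_ : (fun t => _) = (fun t => complex.Re (f t))); last first.
    by apply/funext => t; case: (f t).
  by case: z fr fi.
rewrite (_ : (fun t => _) = (fun t => - complex.Im (f t))); last first.
  by apply/funext => t; case: (f t).
by case: z fr fi => a b /= _ fi; exact: cvgN.
Qed.

Lemma cvg_rVP T n (F : set_system T) {FF : Filter F} (f : T -> 'rV[C]_n) (z : 'rV[C]_n) :
  f @ F --> z <-> forall j, (fun t => f t 0 j) @ F --> z 0 j.
Proof.
split => [fz j|fz].
  apply: (@cvg_comp _ _ _ f (fun y : 'rV[C]_n => y 0 j) F (nbhs z)) => //.
  exact: coord_continuous.
move=> A [P zP PA]; apply: (filterS PA).
have : \forall t \near F, forall j, P 0 j (f t 0 j).
  apply: filter_forall => j.
  by apply: (fz j); exact: (zP 0 j).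
by apply: filterS => t Pt i j; rewrite ord1.
Qed.

Lemma nbhs_rVP n (z : 'rV[C]_n) (A : set 'rV[C]_n) :
  nbhs z A <-> exists2 r : R, 0 < r &
    forall y : 'rV[C]_n, (forall j, `|y 0 j - z 0 j| < r%:C) -> A y.
Proof.
split.
  move/nbhs_ballP => [_ /gt0_complexP[r r0 ->] rA]; exists r => // y zy.
  by apply: rA; split; [rewrite ltcR|move=> i j; rewrite ord1 /ball /= distrC zy].
move=> [r r0 rA]; apply/nbhs_ballP; exists r%:C; first by rewrite /= ltcR.
by move=> y [_ zy]; apply: rA => j; rewrite distrC; exact: zy.
Qed.

Lemma continuous_coord n j : continuous (fun z : 'rV[C]_n => z 0 j).
Proof. exact: coord_continuous. Qed.

End ComplexTopology.

(** * Derivatives of complex-valued functions of a real parameter *)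

Section ComplexDerivatives.
Context {R : realType}.
Local Notation C := R[i].
Implicit Types (g : R -> C) (d e : C) (t : R).

(** [R[i]] is a normed module over itself, so a derivative with respect to a real parameter is taken
    on the real and imaginary parts separately, as in [rderivable]. *)
Definition cderiv g t d : Prop :=
  is_derive t 1 (fun s => complex.Re (g s)) (complex.Re d) /\
  is_derive t 1 (fun s => complex.Im (g s)) (complex.Im d).

Lemma is_derive_cvgP (f : R -> R) t (l : R) :
  is_derive t 1 f l <-> h^-1 * (f (h + t) - f t) @[h --> 0^'] --> l.
Proof.
split => [[df <-]|fl].
  rewrite /derive; move: df; rewrite /derivable.
  rewrite (_ : (fun h : R => _) = (fun h => h^-1 * (f (h + t) - f t))) //.
  by apply/funext => h /=; rewrite [h *: 1]mulr1.
have E : (fun h : R => h^-1 *: ((f \o shift t) (h *: 1) - f t)) =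
         (fun h => h^-1 * (f (h + t) - f t)).
  by apply/funext => h /=; rewrite [h *: 1]mulr1.
split; first by rewrite /derivable E; apply/cvg_ex; exists l.
by rewrite /derive E; apply/cvg_lim.
Qed.

Lemma ReMr (a : R) (z : C) : complex.Re (a%:C * z) = a * complex.Re z.
Proof. by case: z => x y /=; rewrite mul0r subr0. Qed.

Lemma ImMr (a : R) (z : C) : complex.Im (a%:C * z) = a * complex.Im z.
Proof. by case: z => x y /=; rewrite mul0r addr0. Qed.

(** The two real limits combine into one limit in [R[i]], where inverses and telescoping sums can be
    handled without splitting into parts. *)
Lemma cderiv_cvgP g t d :
  cderiv g t d <-> (h^-1)%:C * (g (h + t) - g t) @[h --> 0^'] --> d.
Proof.
rewrite /cderiv !is_derive_cvgP cvg_complexP.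
rewrite (_ : (fun x : R => complex.Re _) =
   (fun h => h^-1 * (complex.Re (g (h + t)) - complex.Re (g t)))); last first.
  by apply/funext => h; rewrite ReMr raddfB.
rewrite (_ : (fun x : R => complex.Im _) =
   (fun h => h^-1 * (complex.Im (g (h + t)) - complex.Im (g t)))) //.
by apply/funext => h; rewrite ImMr raddfB.
Qed.

Lemma cderiv_unique g t d e : cderiv g t d -> cderiv g t e -> d = e.
Proof.
case: d e => [a b] [a' b'] [[_ /= ar] [_ /= ai]] [[_ /= br] [_ /= bi]].
by rewrite -ar -ai br bi.
Qed.

Lemma cderiv_eq g (h : R -> C) t d : (\near t, g t = h t) -> cderiv g t d -> cderiv h t d.
Proof.
move=> gh [gr gi]; split.
  by apply: near_eq_is_derive gr; apply: filterS gh => s ->.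
by apply: near_eq_is_derive gi; apply: filterS gh => s ->.
Qed.

Lemma cderiv_cst (c : C) t : cderiv (fun=> c) t 0.
Proof. by split => /=; exact: is_derive_cst. Qed.

Lemma cderiv_id t : cderiv (fun s => s%:C) t 1.
Proof. by split => /=; [exact: is_derive_id|exact: is_derive_cst]. Qed.

Lemma cderivD g (h : R -> C) t d e :
  cderiv g t d -> cderiv h t e -> cderiv (fun s => g s + h s) t (d + e).
Proof.
move=> [gr gi] [hr hi]; split; rewrite raddfD.
  rewrite (_ : (fun s : R => _) = (fun s => complex.Re (g s)) +
      (fun s => complex.Re (h s))); first exact: is_deriveD.
  by apply/funext => s; rewrite raddfD.
rewrite (_ : (fun s : R => _) = (fun s => complex.Im (g s)) +
    (fun s => complex.Im (h s))); first exact: is_deriveD.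
by apply/funext => s; rewrite raddfD.
Qed.

Lemma ReM (z w : C) : complex.Re (z * w) =
  complex.Re z * complex.Re w - complex.Im z * complex.Im w.
Proof. by case: z w => [a b] [c d]. Qed.

Lemma ImM (z w : C) : complex.Im (z * w) =
  complex.Re z * complex.Im w + complex.Im z * complex.Re w.
Proof. by case: z w => [a b] [c d]. Qed.

Lemma cderivM g (h : R -> C) t d e :
  cderiv g t d -> cderiv h t e ->
  cderiv (fun s => g s * h s) t (d * h t + g t * e).
Proof.
move=> [gr gi] [hr hi]; split; rewrite raddfD /= !(ReM, ImM).
  rewrite (_ : (fun s : R => _) = (fun s => complex.Re (g s)) * (fun s => complex.Re (h s))
    - (fun s => complex.Im (g s)) * (fun s => complex.Im (h s))); last first.
    by apply/funext => s; rewrite ReM.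
  apply: (is_derive_eq (is_deriveB (is_deriveM gr hr) (is_deriveM gi hi))).
  by rewrite /GRing.scale /=; ring.
rewrite (_ : (fun s : R => _) = (fun s => complex.Re (g s)) * (fun s => complex.Im (h s))
  + (fun s => complex.Im (g s)) * (fun s => complex.Re (h s))); last first.
  by apply/funext => s; rewrite ImM.
apply: (is_derive_eq (is_deriveD (is_deriveM gr hi) (is_deriveM gi hr))).
by rewrite /GRing.scale /=; ring.
Qed.

Lemma cderiv_conj g t d : cderiv g t d -> cderiv (fun s => (g s)^*%C) t d^*%C.
Proof.
move=> [gr gi]; split.
  have -> : complex.Re d^*%C = complex.Re d by case: (d).
  rewrite (_ : (fun s : R => _) = (fun s => complex.Re (g s))) //.
  by apply/funext => s; case: (g s).
have -> : complex.Im d^*%C = - complex.Im d by case: (d).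
rewrite (_ : (fun s : R => _) = - (fun s => complex.Im (g s))); first exact: is_deriveN.
by apply/funext => s; rewrite fctE; case: (g s).
Qed.

Lemma cderiv_real_comp (phi : R -> R) (g : R -> R) t (a b : R) :
  is_derive (g t) 1 phi a -> cderiv (fun s => (g s)%:C) t b%:C ->
  cderiv (fun s => (phi (g s))%:C) t (a * b)%:C.
Proof.
move=> dphi [dg _]; split => /=; last exact: is_derive_cst.
exact: is_derive1_comp.
Qed.

Lemma cderiv_shift g t (s : R) d : cderiv g (s + t) d <-> cderiv (fun r => g (r + t)) s d.
Proof.
rewrite !cderiv_cvgP.
by under [in X in _ <-> X]eq_fun do rewrite -addrA.
Qed.

Lemma cderiv_scale g (c t : R) d :
  cderiv g (c * t) d -> cderiv (fun s => g (c * s)) t (c%:C * d).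
Proof.
move=> [gr gi]; have dc : is_derive t 1 ( *%R c) c.
  by have := is_deriveZ c (is_derive_id t 1); rewrite [c *: 1]mulr1.
split.
  rewrite ReMr mulrC.
  exact: (@is_derive1_comp R (fun s => complex.Re (g s)) _ _ _ _ gr dc).
rewrite ImMr mulrC.
exact: (@is_derive1_comp R (fun s => complex.Im (g s)) _ _ _ _ gi dc).
Qed.

Lemma cderiv_cvg g t d : cderiv g t d -> g s @[s --> t] --> g t.
Proof.
move=> [[gr _] [gi _]]; apply/cvg_complexP; split.
  by move/derivable1_diffP/differentiable_continuous : gr.
by move/derivable1_diffP/differentiable_continuous : gi.
Qed.

Lemma cderivV g t d : g t != 0 -> cderiv g t d ->
  cderiv (fun s => (g s)^-1) t (- (d / g t ^+ 2)).
Proof.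
move=> gt0 gd.
apply/cderiv_cvgP.
have gc := cderiv_cvg gd.
have gc0 : g (h + t) @[h --> 0^'] --> g t.
  have ht : h + t @[h --> 0^'] --> 0 + t.
    apply: cvg_within_filter.
    by apply: cvgD; [exact: cvg_id|exact: cvg_cst].
  rewrite add0r in ht.
  exact: cvg_comp ht gc.
have : - ((h^-1)%:C * (g (h + t) - g t)) * ((g (h + t))^-1 * (g t)^-1) @[h --> 0^']
   --> - d * ((g t)^-1 * (g t)^-1).
  apply: cvgM; first by apply: cvgN; apply/cderiv_cvgP.
  by apply: cvgM; [exact: cvgV|exact: cvg_cst].
rewrite expr2 invfM mulNr; apply: cvg_trans; apply: near_eq_cvg.
have : \forall h \near 0^', g (h + t) != 0.
  exact: cvgr_neq0 gc0 gt0.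
apply: filterS => h gh0 /=.
rewrite mulNr -mulrA -mulrN; congr (_ * _).
by field; rewrite gt0 gh0.
Qed.

End ComplexDerivatives.

(** * Directional derivatives and the classes [Ck] *)

Section DirectionalDerivatives.
Context {R : realType} {n : nat}.
Local Notation C := R[i].
Local Notation V := 'rV[R[i]]_n.
Implicit Types (v x : V) (f g : V -> C) (U : set V).

Definition rd v f x (d : C) : Prop := cderiv (fun t => f (x + t%:C *: v)) 0 d.

Definition cont_at f x : Prop := f @ x --> f x.

Lemma cont_atP f x : cont_at f x <-> f @ x --> f x.
Proof. by []. Qed.

Lemma cont_cst (c : C) x : cont_at (fun=> c) x.
Proof. exact: (@cvg_cst _ c _ (nbhs x)). Qed.

Lemma cont_coord j x : cont_at (fun x => x 0 j) x.
Proof. exact: continuous_coord. Qed.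

Lemma cont_add f g x : cont_at f x -> cont_at g x -> cont_at (fun y => f y + g y) x.
Proof. exact: (@cvgD _ _ _ (nbhs x) _ f g (f x) (g x)). Qed.

Lemma cont_mul f g x : cont_at f x -> cont_at g x -> cont_at (fun y => f y * g y) x.
Proof. exact: (@cvgM _ _ (nbhs x) _ f g (f x) (g x)). Qed.

Lemma cont_conj f x : cont_at f x -> cont_at (fun y => (f y)^*%C) x.
Proof. exact: (@cvg_conjc _ _ (nbhs x) _ f (f x)). Qed.

Lemma cont_inv f x : f x != 0 -> cont_at f x -> cont_at (fun y => (f y)^-1) x.
Proof. exact: (@cvgV _ _ (nbhs x) _ f (f x)). Qed.

Lemma cont_real_comp (phi f : V -> R) (psi : R -> R) x :
  (forall y, phi y = psi (f y)) -> derivable psi (f x) 1 ->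
  cont_at (fun y => (f y)%:C) x -> cont_at (fun y => (phi y)%:C) x.
Proof.
move=> E dpsi /cont_atP/cvg_complexP[fc _]; apply/cont_atP.
apply: (@cvg_real_complex _ _ (nbhs x) _ phi (phi x)).
have -> : phi = psi \o f by apply/funext => y; rewrite E.
apply: (@cvg_comp _ _ _ f psi (nbhs x) (nbhs (f x))); first exact: fc.
by move/derivable1_diffP/differentiable_continuous : dpsi.
Qed.

Lemma rd_of_rderivable v f x : rderivable v f x -> rd v f x (rderive v f x).
Proof.
case=> dr di; split; (split; first by []); rewrite /rderive /= derive1E; reflexivity.
Qed.

Lemma rderivable_of_rd v f x d : rd v f x d -> rderivable v f x.
Proof. by case=> -[fr _] [fi _]; exact: conj fr fi. Qed.

Lemma rd_rderive v f x d : rd v f x d -> rderivable v f x /\ rderive v f x = d.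
Proof.
move=> fd; have rf := rderivable_of_rd fd; split; first exact: rf.
exact: cderiv_unique (rd_of_rderivable rf) fd.
Qed.

Lemma rdP v f x d : rd v f x d <-> cderiv (fun t => f (x + t%:C *: v)) 0 d.
Proof. by []. Qed.

Lemma Ck_cont k U f x : Ck k U f -> U x -> cont_at f x.
Proof. by case: k => [[] fc _|k [] fc _] => /fc. Qed.

Lemma Ck0P U f : Ck 0 U f <-> forall x, U x -> cont_at f x.
Proof. by split; [case|]. Qed.

Lemma CkSP k U f : Ck k.+1 U f <->
  (forall x, U x -> cont_at f x) /\
  forall j v, v = dir_x j \/ v = dir_y j ->
    (forall x, U x -> rd v f x (rderive v f x)) /\ Ck k U (rderive v f).
Proof.
split; intros [fc fd]; (split; [exact: fc|move=> j v vj]); have [fd1 fd2] := fd j v vj.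
  by split; [move=> x Ux; exact: (rd_of_rderivable (fd1 x Ux))|exact: fd2].
by split; [move=> x Ux; exact: (rderivable_of_rd (fd1 x Ux))|exact: fd2].
Qed.

Opaque rderivable rderive rd cont_at.

Lemma line_continuous x v : continuous (fun t : R => x + t%:C *: v).
Proof.
move=> t; apply/cvg_rVP => j.
under eq_fun do rewrite !mxE.
rewrite !mxE; apply: cvgD; first exact: cvg_cst.
by apply: cvgM; [apply: cvg_real_complex; exact: cvg_id|exact: cvg_cst].
Qed.

Lemma line_near x v (A : set V) : nbhs x A -> \forall t \near 0 : R, A (x + t%:C *: v).
Proof.
move=> xA; have := @line_continuous x v 0; rewrite /continuous_at scale0r addr0.
by move/(_ A xA).
Qed.

Lemma rd_eq v f g x d : (\near x, f x = g x) -> rd v f x d -> rd v g x d.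
Proof. by move=> fg /rdP fd; apply/rdP; apply: cderiv_eq fd; exact: (line_near v fg). Qed.

Lemma rd_line v f x (t : R) d :
  cderiv (fun s => f (x + s%:C *: v)) t d <-> rd v f (x + t%:C *: v) d.
Proof.
rewrite rdP -[t in cderiv _ t]add0r cderiv_shift.
by under eq_fun do rewrite rmorphD /= scalerDl (addrC (_ *: v)) addrA.
Qed.

Lemma cont_at_eq f g x : (\near x, f x = g x) -> cont_at f x -> cont_at g x.
Proof.
move=> fg /cont_atP fc; apply/cont_atP; rewrite -(nbhs_singleton fg).
exact: cvg_trans (near_eq_cvg fg) fc.
Qed.

(** [Ck] is a condition on each point separately, on functions defined on the whole space; hence any
    set [W] through the point serves. *)
Lemma Ck_loc k U f : (forall x, U x -> exists2 W, W x & Ck k W f) -> Ck k U f.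
Proof.
elim: k f => [|k IH] f Uf.
  by apply/Ck0P => x /Uf[W Wx]; move/Ck0P => fc; exact: fc.
apply/CkSP; split => [x /Uf[W Wx]|j v vj]; first by move/Ck_cont => fc; exact: fc.
split => [x /Uf[W Wx /CkSP[_ /(_ j v vj)[fd _]]]|]; first exact: fd.
by apply: IH => x /Uf[W Wx /CkSP[_ /(_ j v vj)[_ Cf]]]; exists W.
Qed.

Lemma Ck_sub k U W f : U `<=` W -> Ck k W f -> Ck k U f.
Proof. by move=> UW Wf; apply: Ck_loc => x Ux; exists W => //; exact: UW. Qed.

Lemma Ck_eq k U f g : open U -> (forall x, U x -> f x = g x) -> Ck k U f -> Ck k U g.
Proof.
move=> oU; elim: k f g => [|k IH] f g fg.
  move=> /Ck0P fc; apply/Ck0P => x Ux; apply: cont_at_eq (fc x Ux).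
  by move: (open_nbhs_nbhs (conj oU Ux)); apply: filterS => y /fg.
have nfg x : U x -> \near x, f x = g x.
  by move=> Ux; move: (open_nbhs_nbhs (conj oU Ux)); apply: filterS => y /fg.
move=> /CkSP[fc fd]; apply/CkSP; split => [x Ux|j v vj].
  exact: cont_at_eq (nfg x Ux) (fc x Ux).
have [fd1 fd2] := fd j v vj.
have gd x : U x -> rd v g x (rderive v f x).
  by move=> Ux; apply: rd_eq (nfg x Ux) _; exact: fd1.
have E x : U x -> rderive v f x = rderive v g x by move=> /gd/rd_rderive[_ <-].
by split => [x Ux|]; [rewrite -E //; exact: gd|exact: IH fd2].
Qed.

(** Off [U] the total function [rderive v f] is uncontrolled. A formula [D] that is correct on the
    open set [U] may replace it, and the inductions on [k] below all pass through this. *)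
Lemma CkS k U f (D : V -> V -> C) : open U ->
  (forall x, U x -> cont_at f x) ->
  (forall j v, v = dir_x j \/ v = dir_y j ->
     (forall x, U x -> rd v f x (D v x)) /\ Ck k U (D v)) ->
  Ck k.+1 U f.
Proof.
move=> oU fc fD; apply/CkSP; split; [exact: fc|move=> j v vj]; have [fd CD] := fD j v vj.
have E x : U x -> D v x = rderive v f x by move=> /fd/rd_rderive[_ <-].
by split => [x Ux|]; [rewrite -E //; exact: fd|exact: Ck_eq CD].
Qed.

Lemma Ck_pred k U f : Ck k.+1 U f -> Ck k U f.
Proof.
elim: k f => [|k IH] f /CkSP[fc fd]; first exact/Ck0P.
by apply/CkSP; split; [exact: fc|move=> j v vj]; have [fd1 fd2] := fd j v vj; split; [exact: fd1|exact: IH].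
Qed.

Lemma Ck_cst k U (c : C) : Ck k U (fun=> c).
Proof.
apply: (@Ck_sub _ _ setT) => //.
elim: k c => [|k IH] c; first by apply/Ck0P => x _; exact: cont_cst.
apply: (@CkS _ _ _ (fun _ _ => 0) openT) => [x _|j v vj]; first exact: cont_cst.
split => [x _|]; [exact/rdP/cderiv_cst|exact: IH].
Qed.

Lemma Ck_add k U f g : open U -> Ck k U f -> Ck k U g -> Ck k U (fun x => f x + g x).
Proof.
move=> oU; elim: k f g => [|k IH] f g Cf Cg.
  by apply/Ck0P => x Ux; apply: cont_add; [exact: Ck_cont Cf Ux|exact: Ck_cont Cg Ux].
apply: (@CkS _ _ _ (fun v x => rderive v f x + rderive v g x)) => //.
  by move=> x Ux; apply: cont_add; [exact: Ck_cont Cf Ux|exact: Ck_cont Cg Ux].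
move=> j v vj; case/CkSP: Cf => _ /(_ j v vj)[fd Cf]; case/CkSP: Cg => _ /(_ j v vj)[gd Cg].
split => [x Ux|]; last exact: IH.
by apply/rdP; apply: cderivD; apply/rdP; [exact: fd|exact: gd].
Qed.

Lemma Ck_mul k U f g : open U -> Ck k U f -> Ck k U g -> Ck k U (fun x => f x * g x).
Proof.
move=> oU; elim: k f g => [|k IH] f g Cf Cg.
  by apply/Ck0P => x Ux; apply: cont_mul; [exact: Ck_cont Cf Ux|exact: Ck_cont Cg Ux].
have [Cf' Cg'] := (Ck_pred Cf, Ck_pred Cg).
apply: (@CkS _ _ _ (fun v x => rderive v f x * g x + f x * rderive v g x)) => //.
  by move=> x Ux; apply: cont_mul; [exact: Ck_cont Cf Ux|exact: Ck_cont Cg Ux].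
move=> j v vj; case/CkSP: Cf => _ /(_ j v vj)[fd Cf]; case/CkSP: Cg => _ /(_ j v vj)[gd Cg].
split => [x Ux|]; last by apply: Ck_add => //; exact: IH.
move/(_ x Ux)/rdP: fd => fd; move/(_ x Ux)/rdP: gd => gd.
by apply/rdP; have := cderivM fd gd; rewrite scale0r addr0.
Qed.

Lemma Ck_conj k U f : open U -> Ck k U f -> Ck k U (fun x => (f x)^*%C).
Proof.
move=> oU; elim: k f => [|k IH] f Cf.
  by apply/Ck0P => x Ux; apply: cont_conj; exact: Ck_cont Cf Ux.
apply: (@CkS _ _ _ (fun v x => (rderive v f x)^*%C)) => //.
  by move=> x Ux; apply: cont_conj; exact: Ck_cont Cf Ux.
move=> j v vj; case/CkSP: Cf => _ /(_ j v vj)[fd Cf].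
split => [x Ux|]; last exact: IH.
by apply/rdP; apply: cderiv_conj; apply/rdP; exact: fd.
Qed.

Lemma Ck_inv k U f : open U -> (forall x, U x -> f x != 0) -> Ck k U f ->
  Ck k U (fun x => (f x)^-1).
Proof.
move=> oU f0; elim: k => [|k IH] Cf.
  by apply/Ck0P => x Ux; apply: cont_inv; [exact: f0|exact: Ck_cont Cf Ux].
have Ci := IH (Ck_pred Cf).
apply: (@CkS _ _ _ (fun v x => - (1) * rderive v f x * ((f x)^-1 * (f x)^-1))) => //.
  by move=> x Ux; apply: cont_inv; [exact: f0|exact: Ck_cont Cf Ux].
move=> j v vj; case/CkSP: Cf => _ /(_ j v vj)[fd Cf]; split => [x Ux|].
  move/(_ x Ux)/rdP: fd => fd; apply/rdP.
  have := cderivV _ fd; rewrite scale0r addr0 => /(_ (f0 x Ux)).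
  by rewrite mulN1r mulNr expr2 invfM.
by apply: Ck_mul => //; apply: Ck_mul => //; exact: Ck_cst.
Qed.

(** The whole sequence of derivatives is carried along: differentiating [Phi i] composed with [f]
    produces [Phi i.+1], so the induction on [k] needs all indices at once. *)
Lemma Ck_real_comp k U (O : set R) (Phi : nat -> R -> R) (f : V -> R) : open U ->
  (forall i t, O t -> is_derive t 1 (Phi i) (Phi i.+1 t)) ->
  (forall x, U x -> O (f x)) -> Ck k U (fun x => (f x)%:C) ->
  forall i, Ck k U (fun x => (Phi i (f x))%:C).
Proof.
move=> oU dPhi UO; elim: k => [|k IH] Cf i.
  apply/Ck0P => x Ux; have [dP _] := dPhi i _ (UO x Ux).
  exact: (cont_real_comp (f := f) (psi := Phi i) (fun=> erefl)) dP (Ck_cont Cf Ux).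
apply: (@CkS _ _ _ (fun v x => (Phi i.+1 (f x))%:C * rderive v (fun x => (f x)%:C) x)) => //.
  move=> x Ux; have [dP _] := dPhi i _ (UO x Ux).
  exact: (cont_real_comp (f := f) (psi := Phi i) (fun=> erefl)) dP (Ck_cont Cf Ux).
move=> j v vj; have Cf' := Ck_pred Cf; case/CkSP: Cf => _ /(_ j v vj)[fd Cf]; split.
  move=> x Ux; move/(_ x Ux)/rdP: fd => fd; apply/rdP; move: (fd).
  (* A real-valued function has a real derivative along a real parameter; this gives the form [b%:C]
     that [cderiv_real_comp] expects. *)
  have -> : rderive v (fun x => (f x)%:C) x = (complex.Re (rderive v (fun x => (f x)%:C) x))%:C.
    have [_ [_ di]] := fd; have [_ di0] := is_derive_cst (0 : R) (0 : R) (1 : R).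
    have E : complex.Im (rderive v (fun x => (f x)%:C) x) = 0 by rewrite -di; exact: di0.
    by rewrite [LHS]complexE E mulr0 addr0.
  rewrite -rmorphM => ff.
  apply: (cderiv_real_comp (phi := Phi i)); last exact: ff.
  by rewrite /= scale0r addr0; apply: dPhi; exact: UO.
by apply: Ck_mul => //; exact: IH.
Qed.

Lemma dir_coord (v : V) j k : v = dir_x j \/ v = dir_y j ->
  v 0 k = if k == j then (if v == dir_x j then 1 else 'i%C) else 0.
Proof.
case=> ->.
  by rewrite eqxx /dir_x mxE eqxx /=; case: (k == j).
rewrite /dir_y !mxE eqxx /=; case: eqP => _; last by rewrite mulr0.
rewrite mulr1; case: eqP => // /rowP/(_ j); rewrite !mxE !eqxx /= mulr1 => /eqP.
by rewrite eq_complex /= oner_eq0 andbF.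
Qed.

Lemma Ck_coord k U j : open U -> Ck k U (fun x => x 0 j).
Proof.
move=> oU; case: k => [|k]; first by apply/Ck0P => x _; exact: cont_coord.
apply: (@CkS _ _ _ (fun v _ => v 0 j)) => //; first by move=> x _; exact: cont_coord.
move=> l v vl; split => [x Ux|]; last exact: Ck_cst.
apply/rdP; under eq_fun do rewrite !mxE.
have := cderivD (cderiv_cst (x 0 j) 0) (cderivM (cderiv_id 0) (cderiv_cst (v 0 j) 0)).
by rewrite add0r mulr0 addr0 mul1r.
Qed.

End DirectionalDerivatives.

(** * Chain rule *)

Section ChainRule.
Context {R : realType}.
Local Notation C := R[i].

Lemma cvg_csum T (F : set_system T) {FF : Filter F} (I : Type) (r : seq I) (P : pred I)
    (f : I -> T -> C) (l : I -> C) : (forall i, P i -> f i t @[t --> F] --> l i) ->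
  \sum_(i <- r | P i) f i t @[t --> F] --> \sum_(i <- r | P i) l i.
Proof.
move=> fl; elim: r => [|i r IH].
  by rewrite big_nil; under eq_fun do rewrite big_nil; exact: cvg_cst.
rewrite big_cons; under eq_fun do rewrite big_cons.
by case Pi : (P i); [apply: cvgD; [exact: fl|exact: IH]|exact: IH].
Qed.

(** Absolute values appear because the increments to which this is applied have unknown sign and may
    be 0. *)
Lemma real_MVT (f df : R -> R) (a : R) :
  (forall s : R, `|s| <= `|a| -> is_derive s (1 : R) f (df s)) ->
  exists2 s : R, `|s| <= `|a| & f a - f 0 = df s * a.
Proof.
move=> dfs.
have cf s : `|s| <= `|a| -> {for s, continuous f}.
  move=> /dfs[ds _]; exact/differentiable_continuous/derivable1_diffP.
have [a0|a0|->] := ltgtP a 0.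
- have [|| s /itvP sa E] := @MVT _ f df a 0 a0.
  + by move=> s /itvP sa; apply: dfs; rewrite !ler0_norm ?lerN2 ?sa // ltW.
  + apply: continuous_in_subspaceT => s; rewrite inE => /itvP sa; apply: cf.
    by rewrite !ler0_norm ?lerN2 ?sa // ltW.
  exists s; first by rewrite !ler0_norm ?lerN2 ?sa // ltW.
  by rewrite -opprB E sub0r mulrN opprK.
- have [|| s /itvP sa E] := @MVT _ f df 0 a a0.
  + by move=> s /itvP sa; apply: dfs; rewrite !ger0_norm ?sa // ltW.
  + apply: continuous_in_subspaceT => s; rewrite inE => /itvP sa; apply: cf.
    by rewrite !ger0_norm ?sa // ltW.
  exists s; first by rewrite !ger0_norm ?sa // ltW.
  by rewrite E subr0.
- by exists 0; rewrite // subrr mulr0.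
Qed.

(** Base point [q h] and increment [a h] both move with [h]. The mean value theorem turns the
    quotient into a value of [dg] at an intermediate point, which tends to [y0], where [dg] is
    continuous. *)
Lemma slope_real n (g dg : 'rV[C]_n -> R) (e y0 : 'rV[C]_n) (q : R -> 'rV[C]_n)
    (a : R -> R) (d : R) :
  (\forall y \near y0, is_derive (0 : R) (1 : R) (fun s => g (y + s%:C *: e)) (dg y)) ->
  dg @ y0 --> dg y0 -> q h @[h --> 0^'] --> y0 -> a h @[h --> 0^'] --> 0 ->
  h^-1 * a h @[h --> 0^'] --> d ->
  h^-1 * (g (q h + (a h)%:C *: e) - g (q h)) @[h --> 0^'] --> dg y0 * d.
Proof.
move=> dg0 cdg qy a0 ad.
pose good h s := `|s| <= `|a h| /\
  g (q h + (a h)%:C *: e) - g (q h) = dg (q h + s%:C *: e) * a h.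
(* The default 0 makes |th h| <= |a h| true for every [h], so that [th] tends to 0
   unconditionally. *)
pose th h := xget 0 (good h).
have th_le h : `|th h| <= `|a h|.
  by rewrite /th; case: xgetP => [s -> []//|_]; rewrite normr0.
have th0 : th h @[h --> 0^'] --> 0.
  apply/norm_cvg0P; apply: (@squeeze_cvgr _ _ _ _ (cst 0) (fun h => `|a h|)).
  - by apply: nearW => h /=; rewrite normr_ge0 th_le.
  - exact: cvg_cst.
  - exact/norm_cvg0P.
have line0 (b : R -> R) : b h @[h --> 0^'] --> 0 -> q h + (b h)%:C *: e @[h --> 0^'] --> y0.
  move=> b0; apply/cvg_rVP => j; under eq_fun do rewrite !mxE.
  rewrite -[y0 0 j]addr0 -(mul0r (e 0 j)); apply: cvgD.
    by move/cvg_rVP : qy; exact.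
  by apply: cvgM; [exact: cvg_real_complex b0|exact: cvg_cst].
have : dg (q h + (th h)%:C *: e) * (h^-1 * a h) @[h --> 0^'] --> dg y0 * d.
  by apply: cvgM => //; apply: (@cvg_comp _ _ _ _ dg 0^' (nbhs y0)) => //; exact: line0.
apply: cvg_trans; apply: near_eq_cvg.
move/nbhs_rVP : dg0 => [r r0 dg0].
(* One half of [r] for the distance from [q h] to [y0], the other for the increment along [e]. *)
have r20 : 0 < r / 2 by rewrite divr_gt0.
have r2C : 0 < (r / 2)%:C :> C by rewrite ltcR.
near=> h.
suff [_ ->] : good h (th h) by rewrite mulrCA.
apply: (@xgetPex _ 0 (good h)).
have qy1 j : `|q h 0 j - y0 0 j| < (r / 2)%:C.
  move: j; near: h; apply: filter_forall => j.
  by move/cvg_rVP : qy => /(_ j)/cvgr_distC_lt; exact.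
have ae j : `|a h| %:C * `|e 0 j| < (r / 2)%:C.
  move: j; near: h; apply: filter_forall => j.
  have : (a h)%:C * e 0 j @[h --> 0^'] --> 0.
    rewrite -(mul0r (e 0 j)); apply: cvgM; [exact: cvg_real_complex a0|exact: cvg_cst].
  move/cvgr0_norm_lt => /(_ _ r2C); apply: filterS => h0.
  by rewrite normrM norm_real_complex.
have [s sa E] : exists2 s, `|s| <= `|a h| &
    g (q h + (a h)%:C *: e) - g (q h + (0 : R)%:C *: e) = dg (q h + s%:C *: e) * a h.
  apply: (real_MVT (f := fun s => g (q h + s%:C *: e)) (df := fun s => dg (q h + s%:C *: e))).
  move=> s sa.
  have : is_derive (0:R) (1:R) (fun t => g ((q h + s%:C *: e) + t%:C *: e)) (dg (q h + s%:C *: e)).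
    apply: dg0 => j; rewrite !mxE addrAC.
    apply: le_lt_trans (ler_normD _ _) _.
    rewrite [ltRHS](_ : _ = (r / 2)%:C + (r / 2)%:C); last by rewrite -rmorphD -splitr.
    apply: ltrD => //; apply: le_lt_trans (ae j).
    by rewrite normrM norm_real_complex ler_wpM2r // lecR.
  move=> /is_derive_cvgP H; apply/is_derive_cvgP; move: H.
  rewrite scale0r !addr0; apply: cvg_trans; apply: near_eq_cvg; apply: nearW => t /=.
  by rewrite addr0 rmorphD scalerDl (addrC (_ *: e)) addrA.
by exists s; split => //; move: E; rewrite scale0r addr0.
Unshelve. all: by end_near. Qed.

Lemma slope_complex n (g dg : 'rV[C]_n -> C) (e y0 : 'rV[C]_n) (q : R -> 'rV[C]_n)
    (a : R -> R) (d : R) :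
  (\forall y \near y0, rd e g y (dg y)) ->
  cont_at dg y0 -> q h @[h --> 0^'] --> y0 -> a h @[h --> 0^'] --> 0 ->
  h^-1 * a h @[h --> 0^'] --> d ->
  (h^-1)%:C * (g (q h + (a h)%:C *: e) - g (q h)) @[h --> 0^'] --> dg y0 * d%:C.
Proof.
move=> dg0 /cont_atP/cvg_complexP[cr ci] qy a0 ad.
have Mr (z : C) (x : R) : complex.Re (z * x%:C) = complex.Re z * x.
  by rewrite mulrC ReMr mulrC.
have Mi (z : C) (x : R) : complex.Im (z * x%:C) = complex.Im z * x.
  by rewrite mulrC ImMr mulrC.
apply/cvg_complexP; rewrite Mr Mi; split.
  under eq_fun do rewrite ReMr raddfB.
  apply: (slope_real (g := fun y => complex.Re (g y)) (dg := fun y => complex.Re (dg y))) => //.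
  by apply: filterS dg0 => y /rdP[].
under eq_fun do rewrite ImMr raddfB.
apply: (slope_real (g := fun y => complex.Im (g y)) (dg := fun y => complex.Im (dg y))) => //.
by apply: filterS dg0 => y /rdP[].
Qed.

(** Replace the coordinates of [y0] by those of [F 0], ..., [F h] one at a time. *)
Lemma cderiv_comp n (U : set 'rV[C]_n) (f : 'rV[C]_n -> C) (F : R -> 'rV[C]_n)
    (t : R) (d : 'I_n -> C) :
  open U -> Ck 1 U f -> U (F t) -> (forall j, cderiv (fun s => F s 0 j) t (d j)) ->
  cderiv (fun s => f (F s)) t
    (\sum_j (rderive (dir_x j) f (F t) * (complex.Re (d j))%:C +
             rderive (dir_y j) f (F t) * (complex.Im (d j))%:C)).
Proof.
move=> oU Cf UF dF; apply/cderiv_cvgP.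
set y0 := F t.
(* [q k h] already has the first [k] coordinates of [F (h + t)]. The next one is changed in two
   moves, its real part in [q'] and its imaginary part in [qS], since only derivatives along
   [dir_x k] and [dir_y k] are available. *)
pose q (k : nat) h : 'rV[C]_n := \row_j if (j < k)%N then F (h + t) 0 j else y0 0 j.
pose q' (k : 'I_n) h : 'rV[C]_n := q k h + (complex.Re (F (h + t) 0 k - y0 0 k))%:C *: dir_x k.
have qn h : q n h = F (h + t) by apply/rowP => j; rewrite mxE ltn_ord.
have q0 h : q 0%N h = y0 by apply/rowP => j; rewrite mxE.
have qS (k : 'I_n) h : q k.+1 h =
    q' k h + (complex.Im (F (h + t) 0 k - y0 0 k))%:C *: dir_y k.
  apply/rowP => j; rewrite !mxE eqxx /= ltnS leq_eqVlt.
  have -> : (j == k :> nat) = (j == k) by [].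
  case: (eqVneq j k) => [->|_]; last by rewrite !mulr0 !addr0 orFb.
  rewrite orTb ltnn !mulr1 -addrA [_ + _ * 'i%C](_ : _ = F (h + t) 0 k - y0 0 k); last first.
    by rewrite [RHS]complexE [_ * 'i%C]mulrC.
  by rewrite addrCA subrr addr0.
have tele h : (h^-1)%:C * (f (F (h + t)) - f y0) =
    \sum_(k < n) ((h^-1)%:C * (f (q' k h) - f (q k h)) +
                  (h^-1)%:C * (f (q k.+1 h) - f (q' k h))).
  rewrite -[in LHS]qn -[in LHS](q0 h) -(telescope_sumr (fun k => f (q k h))) // big_mkord.
  rewrite mulr_sumr; apply: eq_bigr => k _.
  by rewrite -mulrDr; congr (_ * _); ring.
rewrite (_ : (fun h : R => _) = (fun h => \sum_(k < n) ((h^-1)%:C * (f (q' k h) - f (q k h)) +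
                  (h^-1)%:C * (f (q k.+1 h) - f (q' k h))))); last exact/funext/tele.
have Fc j : F (h + t) 0 j @[h --> 0^'] --> y0 0 j.
  have ht : h + t @[h --> 0^'] --> 0 + t.
    apply: cvg_within_filter.
    by apply: cvgD; [exact: cvg_id|exact: cvg_cst].
  rewrite add0r in ht.
  exact: (@cvg_comp _ _ _ _ (fun s => F s 0 j) _ (nbhs t)) ht (cderiv_cvg (dF j)).
have qc k : q k h @[h --> 0^'] --> y0.
  apply/cvg_rVP => j; case E : (j < k)%N; under eq_fun do rewrite mxE E.
    exact: Fc.
  exact: cvg_cst.
have Dc j : F (h + t) 0 j - y0 0 j @[h --> 0^'] --> (0 : C).
  by apply/subr_cvg0; exact: Fc.
have rc j : complex.Re (F (h + t) 0 j - y0 0 j) @[h --> 0^'] --> (0 : R).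
  by have /cvg_complexP[] := Dc j.
have ic j : complex.Im (F (h + t) 0 j - y0 0 j) @[h --> 0^'] --> (0 : R).
  by have /cvg_complexP[] := Dc j.
have q'c k : q' k h @[h --> 0^'] --> y0.
  apply/cvg_rVP => j; under eq_fun do rewrite /q' mxE [X in _ + X]mxE.
  have E : y0 0 j = y0 0 j + 0 * dir_x k 0 j by rewrite mul0r addr0.
  rewrite E; apply: cvgD; first by have /cvg_rVP := qc k; exact.
  by apply: cvgM; [exact: cvg_real_complex (rc k)|exact: cvg_cst].
have nU : \forall y \near y0, U y by apply: open_nbhs_nbhs.
apply: cvg_csum => k _; apply: cvgD.
  have [fd Cfd] : (forall x, U x -> rd (dir_x k) f x (rderive (dir_x k) f x)) /\
     Ck 0 U (rderive (dir_x k) f) by case/CkSP: Cf => _; apply; left.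
  apply: slope_complex => //.
  - by apply: filterS nU.
  - by apply: Ck_cont Cfd _.
  - by have [/is_derive_cvgP + _] := dF k; under eq_fun do rewrite -raddfB.
have [fd Cfd] : (forall x, U x -> rd (dir_y k) f x (rderive (dir_y k) f x)) /\
   Ck 0 U (rderive (dir_y k) f) by case/CkSP: Cf => _; apply; right.
under eq_fun do rewrite qS.
apply: (slope_complex (q := q' k)) => //.
- by apply: filterS nU.
- by apply: Ck_cont Cfd _.
- by have [_ /is_derive_cvgP] := dF k; under eq_fun do rewrite -raddfB.
Qed.

End ChainRule.

(** * Smooth functions and Wirtinger calculus *)

Section SmoothCalculus.
Context {R : realType} {n : nat}.
Local Notation C := R[i].
Local Notation V := 'rV[R[i]]_n.
Implicit Types (v x : V) (f g : V -> C) (U W : set V).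

Lemma rd_cst v (c : C) x : rd v (fun=> c) x 0.
Proof. exact/rdP/cderiv_cst. Qed.

Lemma rdD v f g x a b : rd v f x a -> rd v g x b -> rd v (fun y => f y + g y) x (a + b).
Proof. by move=> /rdP fa /rdP gb; apply/rdP; exact: cderivD. Qed.

Lemma rdM v f g x a b : rd v f x a -> rd v g x b ->
  rd v (fun y => f y * g y) x (a * g x + f x * b).
Proof.
move=> /rdP fa /rdP gb; apply/rdP; have := cderivM fa gb.
by rewrite scale0r addr0.
Qed.

Lemma rd_conj v f x a : rd v f x a -> rd v (fun y => (f y)^*%C) x a^*%C.
Proof. by move=> /rdP fa; apply/rdP; exact: cderiv_conj. Qed.

Lemma rd_coord v x k : rd v (fun y => y 0 k) x (v 0 k).
Proof.
apply/rdP; under eq_fun do rewrite !mxE.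
have := cderivD (cderiv_cst (x 0 k) 0) (cderivM (cderiv_id 0) (cderiv_cst (v 0 k) 0)).
by rewrite add0r mulr0 addr0 mul1r.
Qed.

Lemma smooth_rd j v U f x : smooth_on U f -> U x -> v = dir_x j \/ v = dir_y j ->
  rd v f x (rderive v f x).
Proof.
move=> sf Ux vj; have /CkSP[_ /(_ j v vj)[fd _]] := sf 1%N.
exact: fd.
Qed.

Lemma smooth_rderive j v U f : smooth_on U f -> v = dir_x j \/ v = dir_y j ->
  smooth_on U (rderive v f).
Proof. by move=> sf vj k; have /CkSP[_ /(_ j v vj)[_ Cf]] := sf k.+1. Qed.

Lemma smooth_cont U f x : smooth_on U f -> U x -> cont_at f x.
Proof. by move=> sf; exact: Ck_cont (sf 0%N). Qed.

Lemma smooth_sub U W f : U `<=` W -> smooth_on W f -> smooth_on U f.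
Proof. by move=> UW sf k; exact: Ck_sub (sf k). Qed.

Lemma smooth_loc U f : (forall x, U x -> exists2 W, W x & smooth_on W f) -> smooth_on U f.
Proof. by move=> Uf k; apply: Ck_loc => x /Uf[W Wx sf]; exists W. Qed.

Lemma smooth_eq U f g : open U -> (forall x, U x -> f x = g x) ->
  smooth_on U f -> smooth_on U g.
Proof. by move=> oU fg sf k; exact: Ck_eq (sf k). Qed.

Lemma smooth_cst U (c : C) : smooth_on U (fun=> c).
Proof. by move=> k; exact: Ck_cst. Qed.

Lemma smooth_coord U j : open U -> smooth_on U (fun x => x 0 j).
Proof. by move=> oU k; exact: Ck_coord. Qed.

Lemma smooth_add U f g : open U -> smooth_on U f -> smooth_on U g ->
  smooth_on U (fun x => f x + g x).
Proof. by move=> oU sf sg k; exact: Ck_add. Qed.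

Lemma smooth_mul U f g : open U -> smooth_on U f -> smooth_on U g ->
  smooth_on U (fun x => f x * g x).
Proof. by move=> oU sf sg k; exact: Ck_mul. Qed.

Lemma smooth_conj U f : open U -> smooth_on U f -> smooth_on U (fun x => (f x)^*%C).
Proof. by move=> oU sf k; exact: Ck_conj. Qed.

Lemma smooth_inv U f : open U -> (forall x, U x -> f x != 0) -> smooth_on U f ->
  smooth_on U (fun x => (f x)^-1).
Proof. by move=> oU f0 sf k; exact: Ck_inv. Qed.

Lemma smooth_real_comp U (O : set R) (Phi : nat -> R -> R) (f : V -> R) i : open U ->
  (forall i t, O t -> is_derive t 1 (Phi i) (Phi i.+1 t)) ->
  (forall x, U x -> O (f x)) -> smooth_on U (fun x => (f x)%:C) ->
  smooth_on U (fun x => (Phi i (f x))%:C).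
Proof. by move=> oU dP UO sf k; exact: (@Ck_real_comp _ _ k U O). Qed.

Lemma smooth_sum (I : Type) (r : seq I) (P : pred I) (F : I -> V -> C) U : open U ->
  (forall i, P i -> smooth_on U (F i)) -> smooth_on U (fun x => \sum_(i <- r | P i) F i x).
Proof.
move=> oU sF; elim: r => [|i r IH].
  by under eq_fun do rewrite big_nil; exact: smooth_cst.
under eq_fun do rewrite big_cons.
by case Pi : (P i); [apply: smooth_add; [exact: oU|exact: sF|exact: IH]|exact: IH].
Qed.

Lemma smooth_prod (I : Type) (r : seq I) (P : pred I) (F : I -> V -> C) U : open U ->
  (forall i, P i -> smooth_on U (F i)) -> smooth_on U (fun x => \prod_(i <- r | P i) F i x).
Proof.
move=> oU sF; elim: r => [|i r IH].
  by under eq_fun do rewrite big_nil; exact: smooth_cst.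
under eq_fun do rewrite big_cons.
by case Pi : (P i); [apply: smooth_mul; [exact: oU|exact: sF|exact: IH]|exact: IH].
Qed.

Lemma Re_conj (z : C) : (complex.Re z)%:C = 2^-1 * (z + z^*%C).
Proof. by rewrite addcJ mulKf // pnatr_eq0. Qed.

Lemma Im_conj (z : C) : (complex.Im z)%:C = (- 2^-1 * 'i%C) * (z - z^*%C).
Proof.
rewrite subcJ -!mulrA mulNr (mulrCA 'i%C) mulKf ?pnatr_eq0 // mulrCA -expr2 sqr_i.
by rewrite mulrN1 opprK.
Qed.

Lemma Ck_Re k U f : open U -> Ck k U f -> Ck k U (fun x => (complex.Re (f x))%:C).
Proof.
move=> oU Cf; under eq_fun do rewrite Re_conj.
by apply: Ck_mul => //; [exact: Ck_cst|apply: Ck_add => //; exact: Ck_conj].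
Qed.

Lemma Ck_Im k U f : open U -> Ck k U f -> Ck k U (fun x => (complex.Im (f x))%:C).
Proof.
move=> oU Cf; under eq_fun do rewrite Im_conj.
apply: Ck_mul => //; [exact: Ck_cst|apply: Ck_add => //].
under eq_fun do rewrite -mulN1r.
by apply: Ck_mul => //; [exact: Ck_cst|exact: Ck_conj].
Qed.

Lemma d_zE f x j a b : rd (dir_x j) f x a -> rd (dir_y j) f x b ->
  d_z j f x = 2^-1 * (a - 'i%C * b) /\ d_zbar j f x = 2^-1 * (a + 'i%C * b).
Proof. by rewrite /d_z /d_zbar => /rd_rderive[_ ->] /rd_rderive[_ ->]. Qed.

Lemma rderive_eq v f g x : (\near x, f x = g x) -> rderivable v f x ->
  rderive v g x = rderive v f x.
Proof. by move=> fg /rd_of_rderivable/(rd_eq fg)/rd_rderive[]. Qed.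

Lemma d_z_eq U f g x j : (\near x, f x = g x) -> smooth_on U f -> U x ->
  d_z j g x = d_z j f x /\ d_zbar j g x = d_zbar j f x.
Proof.
move=> fg sf Ux; rewrite /d_z /d_zbar.
have fx := smooth_rd sf Ux (or_introl (erefl (dir_x j))).
have fy := smooth_rd sf Ux (or_intror (erefl (dir_y j))).
by rewrite !(rderive_eq fg (rderivable_of_rd fx)) !(rderive_eq fg (rderivable_of_rd fy)).
Qed.

Lemma smooth_d_z U f j : open U -> smooth_on U f -> smooth_on U (d_z j f).
Proof.
move=> oU sf; have sx := smooth_rderive sf (or_introl (erefl (dir_x j))).
have sy := smooth_rderive sf (or_intror (erefl (dir_y j))).
apply: smooth_mul => //; first exact: smooth_cst.
apply: smooth_add => //.
have -> : (fun x => - ('i%C * rderive (dir_y j) f x)) = (fun x => - 'i%C * rderive (dir_y j) f x).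
  by apply/funext => x; rewrite mulNr.
by apply: smooth_mul => //; exact: smooth_cst.
Qed.

Lemma smooth_d_zbar U f j : open U -> smooth_on U f -> smooth_on U (d_zbar j f).
Proof.
move=> oU sf; have sx := smooth_rderive sf (or_introl (erefl (dir_x j))).
have sy := smooth_rderive sf (or_intror (erefl (dir_y j))).
apply: smooth_mul => //; first exact: smooth_cst.
by apply: smooth_add => //; apply: smooth_mul => //; exact: smooth_cst.
Qed.

Lemma d_zD U f g x j : smooth_on U f -> smooth_on U g -> U x ->
  d_z j (fun y => f y + g y) x = d_z j f x + d_z j g x /\
  d_zbar j (fun y => f y + g y) x = d_zbar j f x + d_zbar j g x.
Proof.
move=> sf sg Ux.
have fx := smooth_rd sf Ux (or_introl (erefl (dir_x j))).
have fy := smooth_rd sf Ux (or_intror (erefl (dir_y j))).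
have gx := smooth_rd sg Ux (or_introl (erefl (dir_x j))).
have gy := smooth_rd sg Ux (or_intror (erefl (dir_y j))).
have [-> ->] := d_zE (rdD fx gx) (rdD fy gy); rewrite /d_z /d_zbar.
move: (rderive (dir_x j) f x) (rderive (dir_y j) f x) => a b.
by move: (rderive (dir_x j) g x) (rderive (dir_y j) g x) => c d; split; ring.
Qed.

Lemma d_zM U f g x j : smooth_on U f -> smooth_on U g -> U x ->
  d_z j (fun y => f y * g y) x = d_z j f x * g x + f x * d_z j g x /\
  d_zbar j (fun y => f y * g y) x = d_zbar j f x * g x + f x * d_zbar j g x.
Proof.
move=> sf sg Ux.
have fx := smooth_rd sf Ux (or_introl (erefl (dir_x j))).
have fy := smooth_rd sf Ux (or_intror (erefl (dir_y j))).
have gx := smooth_rd sg Ux (or_introl (erefl (dir_x j))).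
have gy := smooth_rd sg Ux (or_intror (erefl (dir_y j))).
have [-> ->] := d_zE (rdM fx gx) (rdM fy gy); rewrite /d_z /d_zbar.
move: (rderive (dir_x j) f x) (rderive (dir_y j) f x) (f x) => a b fx0.
by move: (rderive (dir_x j) g x) (rderive (dir_y j) g x) (g x) => c d gx0; split; ring.
Qed.

Lemma d_z_cst (c : C) x j : d_z j (fun=> c) x = 0 /\ d_zbar j (fun=> c) x = 0.
Proof.
have [-> ->] := d_zE (rd_cst (dir_x j) c x) (rd_cst (dir_y j) c x).
by split; ring.
Qed.

Lemma d_z_coord x j k :
  d_z j (fun y => y 0 k) x = (k == j)%:R /\ d_zbar j (fun y => y 0 k) x = 0.
Proof.
have [-> ->] := d_zE (rd_coord (dir_x j) x k) (rd_coord (dir_y j) x k).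
rewrite /dir_x /dir_y !mxE eqxx /= mulrA -expr2 sqr_i mulN1r opprK subrr mulr0; split => //.
by move: ((k == j)%:R) => b; field.
Qed.

Lemma d_z_conj U f x j : smooth_on U f -> U x ->
  d_z j (fun y => (f y)^*%C) x = (d_zbar j f x)^*%C /\
  d_zbar j (fun y => (f y)^*%C) x = (d_z j f x)^*%C.
Proof.
move=> sf Ux.
have fx := smooth_rd sf Ux (or_introl (erefl (dir_x j))).
have fy := smooth_rd sf Ux (or_intror (erefl (dir_y j))).
have [-> ->] := d_zE (rd_conj fx) (rd_conj fy).
rewrite /d_z /d_zbar.
move: (rderive (dir_x j) f x) (rderive (dir_y j) f x) => a b.
have E2 : ((2^-1)^*)%C = 2^-1 :> C by rewrite conjc_inv conjc_nat.
have Ep u w : ((2^-1 * (u + 'i%C * w))^*)%C = 2^-1 * (u^*%C - 'i%C * w^*%C) :> C.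
  have cM (z z' : C) : (z * z')^*%C = z^*%C * z'^*%C by exact: rmorphM.
  rewrite cM E2; congr (_ * _); case: u w => [u1 u2] [w1 w2].
  by apply/eqP; rewrite eq_complex /=; apply/andP; split; apply/eqP; ring.
have Em u w : ((2^-1 * (u - 'i%C * w))^*)%C = 2^-1 * (u^*%C + 'i%C * w^*%C) :> C.
  rewrite -mulrN Ep; congr (_ * _); case: u w => [u1 u2] [w1 w2].
  by apply/eqP; rewrite eq_complex /=; apply/andP; split; apply/eqP; ring.
by rewrite Ep Em.
Qed.

Lemma holo_smooth U f : holomorphic_on U f -> smooth_on U f.
Proof. by case. Qed.

(** Cauchy-Riemann: [d_zbar j f x = 0] makes the derivative along [dir_y j] equal to 'i times the
    derivative along [dir_x j]. *)
Lemma holo_rderive U f x j : holomorphic_on U f -> U x ->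
  rderive (dir_x j) f x = d_z j f x /\ rderive (dir_y j) f x = 'i%C * d_z j f x.
Proof.
move=> [_ fb] Ux; have := fb x j Ux; rewrite /d_zbar => /eqP.
rewrite mulf_eq0 invr_eq0 pnatr_eq0 /= addr_eq0 => /eqP E.
have E2 : rderive (dir_y j) f x = 'i%C * rderive (dir_x j) f x.
  by rewrite E mulrN mulrA -expr2 sqr_i mulN1r opprK.
rewrite /d_z E2 mulrA -expr2 sqr_i mulN1r opprK.
move: (rderive (dir_x j) f x) => a.
have -> : a + a = 2 * a by ring.
by rewrite mulKf ?pnatr_eq0.
Qed.

Lemma holo_sub U W f : U `<=` W -> holomorphic_on W f -> holomorphic_on U f.
Proof. by move=> UW [sf fb]; split; [exact: smooth_sub sf|move=> x j /UW; exact: fb]. Qed.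

Lemma holo_loc U f : (forall x, U x -> exists2 W, W x & holomorphic_on W f) ->
  holomorphic_on U f.
Proof.
move=> Uf; split; first by apply: smooth_loc => x /Uf[W Wx [sf _]]; exists W.
by move=> x j /Uf[W Wx [_ fb]]; exact: fb.
Qed.

Lemma holo_eq U f g : open U -> (forall x, U x -> f x = g x) ->
  holomorphic_on U f -> holomorphic_on U g.
Proof.
move=> oU fg [sf fb]; split; first exact: smooth_eq sf.
move=> x j Ux; have nfg : \near x, f x = g x.
  by move: (open_nbhs_nbhs (conj oU Ux)); apply: filterS => y /fg.
by have [_ ->] := d_z_eq j nfg sf Ux; exact: fb.
Qed.

Lemma holo_cst U (c : C) : holomorphic_on U (fun=> c).
Proof. by split; [exact: smooth_cst|move=> x j _; have [] := d_z_cst c x j]. Qed.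

Lemma holo_coord U k : open U -> holomorphic_on U (fun x => x 0 k).
Proof. by move=> oU; split; [exact: smooth_coord|move=> x j _; have [] := d_z_coord x j k]. Qed.

Lemma holo_add U f g : open U -> holomorphic_on U f -> holomorphic_on U g ->
  holomorphic_on U (fun x => f x + g x).
Proof.
move=> oU [sf fb] [sg gb]; split; first exact: smooth_add.
by move=> x j Ux; have [_ ->] := d_zD j sf sg Ux; rewrite fb // gb // addr0.
Qed.

Lemma holo_mul U f g : open U -> holomorphic_on U f -> holomorphic_on U g ->
  holomorphic_on U (fun x => f x * g x).
Proof.
move=> oU [sf fb] [sg gb]; split; first exact: smooth_mul.
by move=> x j Ux; have [_ ->] := d_zM j sf sg Ux; rewrite fb // gb // mul0r mulr0 addr0.
Qed.

Lemma holo_inv U f : open U -> (forall x, U x -> f x != 0) -> holomorphic_on U f ->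
  holomorphic_on U (fun x => (f x)^-1).
Proof.
move=> oU f0 [sf fb]; have si := smooth_inv oU f0 sf; split; first exact: si.
move=> x j Ux; have [_] := d_zM j sf si Ux.
(* Applying [d_zbar j] to f * f^-1 = 1 leaves f * d_zbar j (f^-1) = 0. *)
have n1 : \near x, (fun=> 1) x = (fun y => f y * (f y)^-1) x.
  by move: (open_nbhs_nbhs (conj oU Ux)); apply: filterS => y /f0 fy; rewrite divff.
have [_ ->] := d_z_eq j n1 (smooth_cst U 1) Ux.
have [_ ->] := d_z_cst 1 x j; rewrite fb // mul0r add0r => /eqP.
by rewrite eq_sym mulf_eq0 (negPf (f0 x Ux)) => /eqP.
Qed.

Lemma holo_prod (I : Type) (r : seq I) (P : pred I) (F : I -> V -> C) U : open U ->
  (forall i, P i -> holomorphic_on U (F i)) ->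
  holomorphic_on U (fun x => \prod_(i <- r | P i) F i x).
Proof.
move=> oU sF; elim: r => [|i r IH].
  by under eq_fun do rewrite big_nil; exact: holo_cst.
under eq_fun do rewrite big_cons.
by case Pi : (P i); [apply: holo_mul; [exact: oU|exact: sF|exact: IH]|exact: IH].
Qed.

End SmoothCalculus.

Section Composition.
Context {R : realType} {n m : nat}.
Local Notation C := R[i].
Implicit Types (U : set 'rV[C]_n) (W : set 'rV[C]_m) (F : 'rV[C]_n -> 'rV[C]_m).

Lemma cont_comp (f : 'rV[C]_m -> C) F x : (forall l, cont_at (fun y => F y 0 l) x) ->
  cont_at f (F x) -> cont_at (fun y => f (F y)) x.
Proof.
move=> Fc /cont_atP fc; apply/cont_atP.
apply: (@cvg_comp _ _ _ F f (nbhs x) (nbhs (F x))); last exact: fc.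
by apply/cvg_rVP => l; have /cont_atP := Fc l.
Qed.

Lemma rd_comp U W (f : 'rV[C]_m -> C) F x v (d : 'I_m -> C) : open W -> Ck 1 W f -> W (F x) ->
  (forall l, rd v (fun y => F y 0 l) x (d l)) ->
  rd v (fun y => f (F y)) x
    (\sum_l (rderive (dir_x l) f (F x) * (complex.Re (d l))%:C +
             rderive (dir_y l) f (F x) * (complex.Im (d l))%:C)).
Proof.
move=> oW Cf WF dF; apply/rdP.
have E0 : x + (0 : R)%:C *: v = x by rewrite scale0r addr0.
have WF' : W (F (x + (0 : R)%:C *: v)) by rewrite E0.
have dF' l : cderiv (fun t => F (x + t%:C *: v) 0 l) 0 (d l) by have /rdP := dF l.
have := @cderiv_comp _ _ W f (fun t => F (x + t%:C *: v)) 0 d oW Cf WF' dF'.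
by rewrite E0.
Qed.

Lemma Ck_comp k U W (f : 'rV[C]_m -> C) F : open U -> open W ->
  (forall x, U x -> W (F x)) -> (forall l, Ck k U (fun x => F x 0 l)) -> Ck k W f ->
  Ck k U (fun x => f (F x)).
Proof.
move=> oU oW UW; elim: k f => [|k IH] f CF Cf.
  apply/Ck0P => x Ux; apply: cont_comp; last exact: Ck_cont Cf (UW x Ux).
  by move=> l; exact: Ck_cont (CF l) Ux.
pose D v x := \sum_l (rderive (dir_x l) f (F x) * (complex.Re (rderive v (fun y => F y 0 l) x))%:C +
             rderive (dir_y l) f (F x) * (complex.Im (rderive v (fun y => F y 0 l) x))%:C).
have CF' l : Ck k U (fun x => F x 0 l) by exact: Ck_pred (CF l).
have C1f : Ck 1 W f by elim: (k) Cf => // k' IHk /Ck_pred; exact: IHk.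
apply: (@CkS _ _ k U _ D oU).
  move=> x Ux; apply: cont_comp; last exact: Ck_cont Cf (UW x Ux).
  by move=> l; exact: Ck_cont (CF l) Ux.
move=> j v vj; split.
  move=> x Ux; apply: (@rd_comp U W f F x v (fun l => rderive v (fun y => F y 0 l) x) oW C1f (UW x Ux)).
  by move=> l; have /CkSP[_ /(_ j v vj)[Fd _]] := CF l; exact: Fd.
move/CkSP: Cf => [_ fd].
have CD l : Ck k U (rderive v (fun y => F y 0 l)).
  by have /CkSP[_ /(_ j v vj)[_ Fd]] := CF l; exact: Fd.
rewrite /D; elim: (index_enum _) => [|l r IHr].
  by under eq_fun do rewrite big_nil; exact: Ck_cst.
under eq_fun do rewrite big_cons.
apply: Ck_add => //; apply: Ck_add => //; apply: Ck_mul => //.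
- by apply: IH => //; have [] := fd l _ (or_introl erefl).
- exact: Ck_Re.
- by apply: IH => //; have [] := fd l _ (or_intror erefl).
- exact: Ck_Im.
Qed.

Lemma smooth_comp U W (f : 'rV[C]_m -> C) F : open U -> open W ->
  (forall x, U x -> W (F x)) -> (forall l, smooth_on U (fun x => F x 0 l)) -> smooth_on W f ->
  smooth_on U (fun x => f (F x)).
Proof. by move=> oU oW UW sF sf k; apply: (@Ck_comp k U W) => // l; exact: sF. Qed.

Lemma d_z_comp U W (f : 'rV[C]_m -> C) F x k : open W -> U x ->
  (forall x, U x -> W (F x)) -> (forall l, holomorphic_on U (fun x => F x 0 l)) ->
  smooth_on W f ->
  d_z k (fun x => f (F x)) x = \sum_l d_z k (fun x => F x 0 l) x * d_z l f (F x) /\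
  d_zbar k (fun x => f (F x)) x = \sum_l (d_z k (fun x => F x 0 l) x)^*%C * d_zbar l f (F x).
Proof.
move=> oW Ux UW hF sf.
have sF l := holo_smooth (hF l).
have rx := @rd_comp U W f F x (dir_x k) _ oW (sf 1%N) (UW x Ux)
  (fun l => smooth_rd (sF l) Ux (or_introl erefl)).
have ry := @rd_comp U W f F x (dir_y k) _ oW (sf 1%N) (UW x Ux)
  (fun l => smooth_rd (sF l) Ux (or_intror erefl)).
have [-> ->] := d_zE rx ry.
have E l := holo_rderive k (hF l) Ux.
have iE (z : C) : 'i%C * z = - (complex.Im z)%:C + 'i%C * (complex.Re z)%:C.
  by rewrite {1}[z]complexE mulrDr mulrA -expr2 sqr_i mulN1r addrC.
have R1 (z : C) : complex.Re ('i%C * z) = - complex.Im z by rewrite mulrC ReiNIm.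
have I1 (z : C) : complex.Im ('i%C * z) = complex.Re z by rewrite mulrC ImiRe.
rewrite !mulr_sumr -!sumrB -!big_split !mulr_sumr.
split; apply: eq_bigr => l _; cbv beta; have [-> ->] := E l.
  rewrite R1 I1 [in RHS](complexE (d_z k _ x)) [d_z l f _]/d_z.
  move: (d_z k (fun x => F x 0 l) x) => z.
  rewrite rmorphN /=; set a := (complex.Re z)%:C; set b := (complex.Im z)%:C.
  move: (rderive (dir_x l) f (F x)) (rderive (dir_y l) f (F x)) a b => u w a b.
  (* To [ring], 'i is an atom: its square is replaced by -1 between two polynomial identities. *)
  have ii : 'i%C * 'i%C = -1 :> C by rewrite -expr2 sqr_i.
  transitivity (2^-1 * (a * u + b * w + 'i%C * b * u - 'i%C * a * w)); first by ring.
  transitivity (2^-1 * (a * u - ('i%C * 'i%C) * b * w + 'i%C * b * u - 'i%C * a * w)); last by ring.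
  by rewrite ii; ring.
rewrite R1 I1 /d_zbar.
move: (d_z k (fun x => F x 0 l) x) => z.
have -> : z^*%C = (complex.Re z)%:C - 'i%C * (complex.Im z)%:C.
  by rewrite [LHS]complexE; case: z => c d /=; rewrite rmorphN mulrN.
rewrite rmorphN /=; set a := (complex.Re z)%:C; set b := (complex.Im z)%:C.
move: (rderive (dir_x l) f (F x)) (rderive (dir_y l) f (F x)) a b => u w a b.
have ii : 'i%C * 'i%C = -1 :> C by rewrite -expr2 sqr_i.
transitivity (2^-1 * (a * u + b * w - 'i%C * b * u + 'i%C * a * w)); first by ring.
transitivity (2^-1 * (a * u - ('i%C * 'i%C) * b * w - 'i%C * b * u + 'i%C * a * w)); last by ring.
by rewrite ii; ring.
Qed.

Lemma holo_comp U W (f : 'rV[C]_m -> C) F : open U -> open W ->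
  (forall x, U x -> W (F x)) -> (forall l, holomorphic_on U (fun x => F x 0 l)) ->
  holomorphic_on W f -> holomorphic_on U (fun x => f (F x)).
Proof.
move=> oU oW UW hF [sf fb]; split.
  by apply: (@smooth_comp U W) => // l; exact: holo_smooth.
move=> x k Ux; have [_ ->] := d_z_comp k oW Ux UW hF sf.
by apply: big1 => l _; rewrite fb ?mulr0 //; exact: UW.
Qed.

End Composition.

(** * Flat functions and bumps *)

Section FlatFunctions.
Context {R : realType}.
Implicit Types (p : {poly R}) (t u : R).

(** [p(1/t) exp(-1/t)] for [t > 0]; all derivatives are of the same form. *)
Definition flat p t : R := if 0 < t then p.[t^-1] * expR (- t^-1) else 0.

(** One term of the exponential series, two degrees above [u ^+ k]: for u = 1 / t the surplus
    [u ^- 2] is the factor t^2 that kills the difference quotient of [flat] at 0. *)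
Lemma pow_exp_le (k : nat) u : 0 < u -> u ^+ k * expR (- u) <= k.+2`!%:R * u ^- 2.
Proof.
move=> u0.
have H : u ^+ k.+2 / k.+2`!%:R <= expR u.
  by apply: le_trans (expR_ge1Dxn k.+1 (ltW u0)); rewrite lerDr ler01.
have f0 : 0 < (k.+2`!)%:R :> R by rewrite ltr0n fact_gt0.
rewrite expRN ler_pdivrMr ?expR_gt0 // mulrAC ler_pdivlMr ?exprn_gt0 //.
by rewrite -exprD addn2 -ler_pdivrMl // mulrC.
Qed.

Lemma flat_bound p : exists2 c, 0 <= c & forall t, `|flat p t| <= c * t ^+ 2.
Proof.
pose B i : R := `|p`_i| * i.+2`!%:R.
have B0 : 0 <= \sum_(i < size p) B i by apply: sumr_ge0 => i _; rewrite mulr_ge0.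
exists (\sum_(i < size p) B i) => // t; rewrite /flat.
case: ifP => [t0|_]; last by rewrite normr0 mulr_ge0 // sqr_ge0.
rewrite horner_coef !mulr_suml.
apply: le_trans (ler_norm_sum _ _ _) _; apply: ler_sum => i _.
have u0 : 0 < t^-1 by rewrite invr_gt0.
rewrite !normrM -!mulrA /B ler_wpM2l //.
rewrite (ger0_norm (ltW (expR_gt0 _))) ger0_norm; last by rewrite exprn_ge0 // ltW.
by have := pow_exp_le i u0; rewrite -[t^-1 ^- 2]exprVn invrK.
Qed.

(** With u = 1 / t one has du/dt = - u^2, so p(u) exp(-u) has derivative u^2 (p - p')(u) exp(-u). *)
Definition flat_d p : {poly R} := 'X^2 * (p - p^`()).

Lemma flat_derive p t : is_derive t 1 (flat p) (flat (flat_d p) t).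
Proof.
have [t0|t0|->] := ltgtP t 0.
- apply: (@near_eq_is_derive _ _ _ (cst 0)); last first.
    by rewrite /flat ltNge (ltW t0) /=; exact: is_derive_cst.
  have : \forall s \near t, s < 0 by apply: open_nbhs_nbhs; split; [exact: open_lt|].
  by apply: filterS => s s0; rewrite /flat ltNge (ltW s0).
- have dV : is_derive t 1 (fun s : R => s^-1) (- t ^- 2).
    have := @is_deriveV R id t 1 1; rewrite /= => H.
    by have := H (lt0r_neq0 t0) (is_derive_id _ _); rewrite [_ *: 1]mulr1.
  have dN : is_derive t 1 (fun s : R => - s^-1) (t ^- 2).
    by have := is_deriveN dV; rewrite opprK.
  have d1 : is_derive t 1 (fun s => p.[s^-1]) (p^`().[t^-1] * - t ^- 2).
    exact: (@is_derive1_comp _ (horner p) (fun s => s^-1)).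
  have d2 : is_derive t 1 (fun s => expR (- s^-1)) (expR (- t^-1) * t ^- 2).
    exact: (@is_derive1_comp _ expR (fun s => - s^-1)).
  apply: (@near_eq_is_derive _ _ _ ((fun s => p.[s^-1]) * (fun s => expR (- s^-1)))).
    have : \forall s \near t, 0 < s by apply: open_nbhs_nbhs; split; [exact: open_gt|].
    by apply: filterS => s s0; rewrite /flat s0.
  apply: (is_derive_eq (is_deriveM d1 d2)).
  rewrite /flat t0 /flat_d hornerM hornerXn hornerD hornerN exprVn /GRing.scale /=; ring.
(* At 0 the quadratic bound makes the quotient at most c |h|; since [c] may be 0, the divisor is c +
   1. *)
- apply/is_derive_cvgP; rewrite /flat ltxx.
  have [c c0 cP] := flat_bound p.
  apply/cvgrPdist_lt => /= e e0.
  have c1 : 0 < c + 1 by rewrite ltr_wpDl.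
  near=> h; rewrite sub0r normrN addr0 subr0 normrM -/(flat p h).
  have h0 : 0 < `|h| by rewrite normr_gt0; near: h; exact: nbhs_dnbhs_neq.
  rewrite normfV mulrC ltr_pdivrMr //.
  apply: le_lt_trans (cP h) _; rewrite -real_normK ?num_real // expr2 mulrA ltr_pM2r //.
  apply: (@le_lt_trans _ _ ((c + 1) * `|h|)); first by rewrite ler_wpM2r // lerDl.
  rewrite mulrC -ltr_pdivlMr //.
  by near: h; apply: dnbhs0_lt; rewrite divr_gt0.
Unshelve. all: by end_near. Qed.

Lemma flat1_gt0 t : (0 < flat 1 t) = (0 < t).
Proof. by rewrite /flat; case: ifP => [_|]; rewrite ?ltxx // hornerC mul1r expR_gt0. Qed.

Lemma flat1_ge0 t : 0 <= flat 1 t.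
Proof. by rewrite /flat; case: ifP => _ //; rewrite hornerC mul1r expR_ge0. Qed.

Lemma smooth_flat n (U : set 'rV[R[i]]_n) (f : 'rV[R[i]]_n -> R) : open U ->
  smooth_on U (fun x => (f x)%:C) -> smooth_on U (fun x => (flat 1 (f x))%:C).
Proof.
move=> oU sf.
apply: (@smooth_real_comp _ _ U setT (fun i => flat (iter i flat_d 1)) f 0) => //.
by move=> i t _; exact: flat_derive.
Qed.

End FlatFunctions.

Section Bump.
Context {R : realType} {n : nat}.
Local Notation C := R[i].
Local Notation V := 'rV[R[i]]_n.

Lemma sqnormE (z : C) : (sqnorm z)%:C = z * z^*%C.
Proof. by rewrite /sqnorm add_Re2_Im2 sqr_normc. Qed.

Lemma norm_sqnorm (z : C) (r : R) : 0 <= r -> (`|z| <= r%:C) = (sqnorm z <= r ^+ 2).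
Proof.
move=> r0; rewrite normc_def lecR -/(sqnorm z).
by rewrite -(ler_sqr (x := Num.sqrt _)) ?nnegrE ?sqrtr_ge0 // sqr_sqrtr // addr_ge0 ?sqr_ge0.
Qed.

Lemma norm_sqnorm_lt (z : C) (r : R) : 0 <= r -> (`|z| < r%:C) = (sqnorm z < r ^+ 2).
Proof.
move=> r0; rewrite normc_def ltcR -/(sqnorm z).
by rewrite -(ltr_sqr (x := Num.sqrt _)) ?nnegrE ?sqrtr_ge0 // sqr_sqrtr // addr_ge0 ?sqr_ge0.
Qed.

Lemma sqnorm_ge0 (z : C) : 0 <= sqnorm z.
Proof. by rewrite addr_ge0 ?sqr_ge0. Qed.

Lemma bump_exists (z : V) (r : R) : 0 < r -> exists (chi : V -> R) (s : R),
  [/\ smooth_on setT (fun x => (chi x)%:C), 0 < s,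
      forall x, 0 <= chi x <= 1,
      forall x : V, (forall k, `|x 0 k - z 0 k| < s%:C) -> chi x = 1 &
      forall x : V, chi x != 0 -> forall k, `|x 0 k - z 0 k| <= r%:C].
Proof.
move=> r0.
pose rho (x : V) : R := \sum_k sqnorm (x 0 k - z 0 k).
have srho : smooth_on setT (fun x => (rho x)%:C).
  have -> : (fun x => (rho x)%:C) =
      (fun x : V => \sum_k (x 0 k + - z 0 k) * (x 0 k + - z 0 k)^*%C).
    by apply/funext => x; rewrite rmorph_sum /=; apply: eq_bigr => k _; rewrite sqnormE.
  apply: smooth_sum; first exact: openT.
  move=> k _; have sk : smooth_on setT (fun x : V => x 0 k + - z 0 k).
    by apply: smooth_add; [exact: openT|exact: smooth_coord openT|exact: smooth_cst].
  by apply: smooth_mul; [exact: openT|exact: sk|exact: smooth_conj openT sk].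
have saff (a b : R) : smooth_on setT (fun x => (a + b * rho x)%:C).
  have -> : (fun x => (a + b * rho x)%:C) = (fun x => a%:C + b%:C * (rho x)%:C).
    by apply/funext => x; rewrite rmorphD rmorphM.
  apply: smooth_add; [exact: openT|exact: smooth_cst|].
  by apply: smooth_mul; [exact: openT|exact: smooth_cst|exact: srho].
(* [A] is positive exactly where rho < r^2 and [B] exactly where rho > r^2 / 2. So A + B never
   vanishes, and A / (A + B) is 1 on the smaller ball and 0 off the larger one. *)
pose A x := flat 1 (r ^+ 2 + (-1) * rho x).
pose B x := flat 1 (- (r ^+ 2 / 2) + 1 * rho x).
have r2 : 0 < r ^+ 2 by rewrite exprn_gt0.
have AB x : 0 < A x + B x.
  have [Lr|Lr] := ltP (rho x) (r ^+ 2).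
    by apply: ltr_wpDr; [exact: flat1_ge0|rewrite flat1_gt0 mulN1r subr_gt0].
  apply: ltr_pwDr; last exact: flat1_ge0.
  rewrite flat1_gt0 mul1r addrC subr_gt0; apply: lt_le_trans Lr.
  by rewrite ltr_pdivrMr // mulr_natr mulr2n ltrDl.
(* A polydisc of radius s lies in the ball rho <= r^2 / 2 once n s^2 <= r^2 / 2; r / (n + 2) works
   since 2 n <= (n + 2)^2, also for n = 0. *)
have sk : exists2 s : R, 0 < s & s ^+ 2 * n%:R <= r ^+ 2 / 2.
  exists (r / (n.+2)%:R); first by rewrite divr_gt0.
  rewrite expr_div_n -mulrA ler_wpM2l ?sqr_ge0 // mulrC ler_pdivrMr ?exprn_gt0 //.
  rewrite mulrC ler_pdivlMr // -natrX -natrM ler_nat.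
  by rewrite expnS expn1; nia.
have [s s0 sn] := sk.
exists (fun x => A x / (A x + B x)), s; split => //.
- have -> : (fun x => (A x / (A x + B x))%:C) = (fun x => (A x)%:C * ((A x)%:C + (B x)%:C)^-1).
    by apply/funext => x; rewrite rmorphM fmorphV rmorphD.
  have sA : smooth_on setT (fun x => (A x)%:C) by exact: smooth_flat openT (saff _ _).
  have sB : smooth_on setT (fun x => (B x)%:C) by exact: smooth_flat openT (saff _ _).
  apply: smooth_mul; [exact: openT|exact: sA|apply: smooth_inv; first exact: openT].
    by move=> x _; rewrite -rmorphD; rewrite (inj_eq (@complexI R)) gt_eqF.
  by apply: smooth_add; [exact: openT|exact: sA|exact: sB].
- move=> x; rewrite divr_ge0 ?(ltW (AB x)) ?flat1_ge0 //=.
  by rewrite ler_pdivrMr // mul1r lerDl flat1_ge0.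
- move=> x xz; have B0 : B x = 0.
    rewrite /B /flat mul1r addrC subr_gt0 ltNge.
    suff -> : rho x <= r ^+ 2 / 2 by [].
    apply: le_trans sn; have -> : s ^+ 2 * n%:R = \sum_(k < n) s ^+ 2.
      by rewrite sumr_const card_ord mulr_natr.
    by apply: ler_sum => k _; rewrite -norm_sqnorm ?(ltW s0) // ltW.
  by have := AB x; rewrite B0 addr0 => A0; rewrite divff // gt_eqF.
- move=> x; rewrite mulf_eq0 negb_or => /andP[A0 _] k.
  have : 0 < A x by rewrite lt_def A0 flat1_ge0.
  rewrite flat1_gt0 mulN1r subr_gt0 => Lr.
  rewrite norm_sqnorm ?(ltW r0) //; apply: le_trans (ltW Lr).
  rewrite /rho (bigD1 k) //= lerDl; apply: sumr_ge0 => i _; exact: sqnorm_ge0.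
Qed.

Lemma sqnorm_continuous (w : C) : continuous (fun y : C => sqnorm (y - w)).
Proof.
move=> y; have yw : y - w @[y --> y] --> y - w by exact: (@cvgD _ _ _ (nbhs y) _ id (cst (- w)) y (- w) cvg_id (cvg_cst _)).
have /cvg_complexP[yr yi] := yw.
have -> : (fun y => sqnorm (y - w)) = (fun y => complex.Re (y - w) * complex.Re (y - w)
    + complex.Im (y - w) * complex.Im (y - w)).
  by apply/funext => u; rewrite /sqnorm !expr2.
exact: cvgD (cvgM yr yr) (cvgM yi yi).
Qed.

(** In each coordinate, a closed disc is a closed part of the continuous image of a square; a
    product of compact sets is compact. *)
Lemma compact_polydisc (z : V) (r : R) :
  compact [set x : V | forall k, `|x 0 k - z 0 k| <= r%:C].
Proof.
have cC (w : C) : compact [set y : C | `|y - w| <= r%:C].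
  have [r0|r0] := ltP r 0.
    rewrite (_ : [set y | _] = set0); first exact: compact0.
    apply/seteqP; split => y //= yr.
    have : 0 <= r%:C by exact: le_trans yr.
    by rewrite lecR leNgt r0.
  pose f (ab : R * R) : C := ab.1 +i* ab.2.
  have cf : continuous f.
    by move=> ab; apply/cvg_complexP; split => /=; [exact: cvg_fst|exact: cvg_snd].
  pose K := `[complex.Re w - r, complex.Re w + r] `*` `[complex.Im w - r, complex.Im w + r].
  have cK : compact (f @` K).
    apply: continuous_compact; first exact: continuous_subspaceT.
    by apply: compact_setX; exact: segment_compact.
  apply: (subclosed_compact _ cK).
    have -> : [set y : C | `|y - w| <= r%:C] =
        (fun y : C => sqnorm (y - w)) @^-1` [set t | t <= r ^+ 2].
      by apply/seteqP; split => y /=; rewrite norm_sqnorm.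
    by apply: closed_comp; [move=> y _; exact: sqnorm_continuous|exact: closed_le].
  move=> y /= yr; exists (complex.Re y, complex.Im y); last by case: (y).
  by split; rewrite /= in_itv /= -ler_distl -lecR;
    [rewrite -(raddfB (@complex.Re R))|rewrite -(raddfB (@complex.Im R))];
    [exact: le_trans (Re_le_norm _) yr|exact: le_trans (Im_le_norm _) yr].
have := @rV_compact C n (fun k => [set y : C | `|y - z 0 k| <= r%:C]) (fun k => cC _).
exact.
Qed.

End Bump.

Opaque dir_x dir_y.

(** * Symmetry of second derivatives *)

Section Schwarz.
Context {R : realType} {n : nat}.
Local Notation C := R[i].
Local Notation V := 'rV[R[i]]_n.
Implicit Types (v w x y : V) (U : set V).

Lemma is_derive_line (g : V -> R) y v (s d : R) :
  is_derive (0 : R) (1 : R) (fun t => g (y + s%:C *: v + t%:C *: v)) d ->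
  is_derive s (1 : R) (fun t => g (y + t%:C *: v)) d.
Proof.
move=> /is_derive_cvgP H; apply/is_derive_cvgP; move: H.
rewrite scale0r !addr0; apply: cvg_trans; apply: near_eq_cvg; apply: nearW => t /=.
by rewrite addr0 rmorphD scalerDl (addrC (_ *: v)) addrA.
Qed.

Lemma real_cvg_unique (f : R -> R) (a b : R) :
  f h @[h --> (0 : R)^'] --> a -> f h @[h --> (0 : R)^'] --> b -> a = b.
Proof.
by move=> fa fb; rewrite -(cvg_lim (@Rhausdorff R) fa) -(cvg_lim (@Rhausdorff R) fb).
Qed.

(** Both orders of differentiation are limits of the same second difference. *)
Lemma second_difference (g gv gvw : V -> R) v w x :
  (\forall y \near x, is_derive (0 : R) (1 : R) (fun s => g (y + s%:C *: v)) (gv y)) ->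
  (\forall y \near x, is_derive (0 : R) (1 : R) (fun s => gv (y + s%:C *: w)) (gvw y)) ->
  gvw @ x --> gvw x ->
  h ^- 2 * (g (x + h%:C *: v + h%:C *: w) - g (x + h%:C *: v)
            - (g (x + h%:C *: w) - g x)) @[h --> 0^'] --> gvw x.
Proof.
move=> dg dgv cg.
pose D h := g (x + h%:C *: v + h%:C *: w) - g (x + h%:C *: v) - (g (x + h%:C *: w) - g x).
pose good h (ab : R * R) := [/\ `|ab.1| <= `|h|, `|ab.2| <= `|h| &
  D h = h ^+ 2 * gvw (x + ab.1%:C *: v + ab.2%:C *: w)].
(* The default keeps both parameters bounded by |h| even where no good pair exists. *)
pose th h := xget (0, 0) (good h).
have th_le h : `|(th h).1| <= `|h| /\ `|(th h).2| <= `|h|.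
  by rewrite /th; case: xgetP => [s -> []//|_] /=; rewrite normr0 normr_ge0.
have h0 : `|h| @[h --> (0:R)^'] --> (0:R).
  by apply/norm_cvg0P; apply: cvg_within_filter; exact: cvg_id.
have sq (a : R -> R) : (forall h, `|a h| <= `|h|) -> a h @[h --> 0^'] --> (0:R).
  move=> ale; apply/norm_cvg0P; apply: (@squeeze_cvgr _ _ _ _ (cst 0) (fun h => `|h|)) => //.
  - by apply: nearW => h /=; rewrite normr_ge0 ale.
  - exact: cvg_cst.
have c1 : (th h).1 @[h --> 0^'] --> (0:R) by apply: sq => h; have [] := th_le h.
have c2 : (th h).2 @[h --> 0^'] --> (0:R) by apply: sq => h; have [] := th_le h.
have cx : x + ((th h).1)%:C *: v + ((th h).2)%:C *: w @[h --> 0^'] --> x.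
  apply/cvg_rVP => j; under eq_fun do rewrite !mxE.
  suff : x 0 j + ((th h).1)%:C * v 0 j + ((th h).2)%:C * w 0 j @[h --> 0^'] -->
    x 0 j + 0 * v 0 j + 0 * w 0 j by rewrite !mul0r !addr0.
  apply: cvgD; first apply: cvgD.
  - exact: cvg_cst.
  - by apply: cvgM; [exact: cvg_real_complex c1|exact: cvg_cst].
  - by apply: cvgM; [exact: cvg_real_complex c2|exact: cvg_cst].
have : gvw (x + ((th h).1)%:C *: v + ((th h).2)%:C *: w) @[h --> 0^'] --> gvw x.
  exact: (@cvg_comp _ _ _ _ gvw 0^' (nbhs x)) cx cg.
apply: cvg_trans; apply: near_eq_cvg.
have /nbhs_rVP[r r0 rP] : \forall y \near x,
    is_derive (0 : R) (1 : R) (fun s => g (y + s%:C *: v)) (gv y) /\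
    is_derive (0 : R) (1 : R) (fun s => gv (y + s%:C *: w)) (gvw y).
  by apply: filterS2 dg dgv => y.
near=> h.
have hn0 : h != 0 by near: h; exact: nbhs_dnbhs_neq.
suff [_ _] : good h (th h).
  by rewrite /D => ->; rewrite mulrA mulVf ?mul1r // expf_neq0.
apply: (@xgetPex _ (0, 0) (good h)).
have small j : `|h|%:C * (`|v 0 j| + `|w 0 j|) < r%:C.
  move: j; near: h; apply: filter_forall => j.
  have : `|h|%:C * (`|v 0 j| + `|w 0 j|) @[h --> (0:R)^'] --> 0 * (`|v 0 j| + `|w 0 j|).
    by apply: cvgM; [exact: cvg_real_complex h0|exact: cvg_cst].
  rewrite mul0r => /cvgr0_norm_lt => /(_ r%:C); rewrite ltcR => /(_ r0).
  apply: filterS => h; apply: le_lt_trans.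
  by rewrite [leRHS]ger0_norm // mulr_ge0 ?addr_ge0 // ler0c.
have box s t : `|s| <= `|h| -> `|t| <= `|h| ->
    is_derive (0 : R) (1 : R) (fun u => g ((x + s%:C *: v + t%:C *: w) + u%:C *: v))
      (gv (x + s%:C *: v + t%:C *: w)) /\
    is_derive (0 : R) (1 : R) (fun u => gv ((x + s%:C *: v + t%:C *: w) + u%:C *: w))
      (gvw (x + s%:C *: v + t%:C *: w)).
  move=> sh tth; apply: rP => j; rewrite !mxE.
  have -> (a b c : C) : a + b + c - a = b + c by ring.
  apply: le_lt_trans (small j); apply: le_trans (ler_normD _ _) _.
  by rewrite mulrDr !normrM !norm_real_complex; apply: lerD; rewrite ler_wpM2r // lecR.
(* The mean value theorem is used along [v] for the difference of two copies of [g] offset by h w,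
   and then along [w] for [gv]. *)
have [a ah Ea] : exists2 a : R, `|a| <= `|h| &
    (g (x + h%:C *: v + h%:C *: w) - g (x + h%:C *: v)) -
    (g (x + (0:R)%:C *: v + h%:C *: w) - g (x + (0:R)%:C *: v)) =
    (gv (x + a%:C *: v + h%:C *: w) - gv (x + a%:C *: v)) * h.
  apply: (real_MVT (f := fun s => g (x + s%:C *: v + h%:C *: w) - g (x + s%:C *: v))
    (df := fun s => gv (x + s%:C *: v + h%:C *: w) - gv (x + s%:C *: v))) => s sh.
  have H1 : is_derive s (1 : R) (fun s => g (x + s%:C *: v + h%:C *: w))
      (gv (x + s%:C *: v + h%:C *: w)).
    have -> : (fun s => g (x + s%:C *: v + h%:C *: w)) = (fun s => g ((x + h%:C *: w) + s%:C *: v)).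
      by apply/funext => s'; rewrite addrAC.
    apply: is_derive_line; have [+ _] := box s h sh (lexx _).
    by rewrite (addrAC x).
  have H2 : is_derive s (1 : R) (fun s => g (x + s%:C *: v)) (gv (x + s%:C *: v)).
    apply: is_derive_line; have [|+ _] := box s 0 sh; first by rewrite normr0.
    by rewrite scale0r addr0.
  exact: is_deriveB H1 H2.
have [b bh Eb] : exists2 b : R, `|b| <= `|h| &
    gv (x + a%:C *: v + h%:C *: w) - gv (x + a%:C *: v + (0:R)%:C *: w) =
    gvw (x + a%:C *: v + b%:C *: w) * h.
  apply: (real_MVT (f := fun t => gv (x + a%:C *: v + t%:C *: w))
    (df := fun t => gvw (x + a%:C *: v + t%:C *: w))) => t tth.
  by apply: is_derive_line; have [] := box a t ah tth.
exists (a, b); split => //=.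
move: Ea; rewrite /D scale0r addr0 => ->; move: Eb; rewrite scale0r addr0 => ->.
by move: (gvw _) => c; ring.
Unshelve. all: by end_near. Qed.

Lemma smooth_rd_near U f x j v : open U -> smooth_on U f -> U x ->
  v = dir_x j \/ v = dir_y j -> \forall y \near x, rd v f y (rderive v f y).
Proof.
move=> oU sf Ux vj; move: (open_nbhs_nbhs (conj oU Ux)); apply: filterS => y Uy.
exact: smooth_rd sf Uy vj.
Qed.

Lemma near_rd_Re v (f df : V -> C) x : (\forall y \near x, rd v f y (df y)) ->
  \forall y \near x, is_derive (0 : R) (1 : R) (fun s => complex.Re (f (y + s%:C *: v)))
    (complex.Re (df y)).
Proof. by apply: filterS => y /rdP[]. Qed.

Lemma near_rd_Im v (f df : V -> C) x : (\forall y \near x, rd v f y (df y)) ->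
  \forall y \near x, is_derive (0 : R) (1 : R) (fun s => complex.Im (f (y + s%:C *: v)))
    (complex.Im (df y)).
Proof. by apply: filterS => y /rdP[]. Qed.

Lemma Schwarz U (f : V -> C) x j k v w : open U -> smooth_on U f -> U x ->
  v = dir_x j \/ v = dir_y j -> w = dir_x k \/ w = dir_y k ->
  rderive w (rderive v f) x = rderive v (rderive w f) x.
Proof.
move=> oU sf Ux vj wk.
have sv := smooth_rderive sf vj; have sw := smooth_rderive sf wk.
have nv := smooth_rd_near oU sf Ux vj; have nw := smooth_rd_near oU sf Ux wk.
have nvw := smooth_rd_near oU sv Ux wk; have nwv := smooth_rd_near oU sw Ux vj.
have /cont_atP/cvg_complexP[cr ci] := smooth_cont (smooth_rderive sv wk) Ux.
have /cont_atP/cvg_complexP[dr di] := smooth_cont (smooth_rderive sw vj) Ux.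
have swap (g : V -> R) h : g (x + h%:C *: v + h%:C *: w) - g (x + h%:C *: v)
    - (g (x + h%:C *: w) - g x) = g (x + h%:C *: w + h%:C *: v) - g (x + h%:C *: w)
    - (g (x + h%:C *: v) - g x).
  by rewrite (addrAC x); move: (g _) (g _) (g _) (g _) => a b c d; ring.
have Er : complex.Re (rderive w (rderive v f) x) = complex.Re (rderive v (rderive w f) x).
  have H1 := @second_difference (fun y => complex.Re (f y)) (fun y => complex.Re (rderive v f y))
    (fun y => complex.Re (rderive w (rderive v f) y)) v w x
    (near_rd_Re nv)
    (near_rd_Re nvw) cr.
  have H2 := @second_difference (fun y => complex.Re (f y)) (fun y => complex.Re (rderive w f y))
    (fun y => complex.Re (rderive v (rderive w f) y)) w v x
    (near_rd_Re nw)
    (near_rd_Re nwv) dr.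
  apply: real_cvg_unique H1 _; move: H2; apply: cvg_trans; apply: near_eq_cvg.
  by apply: nearW => h; rewrite (swap (fun y => complex.Re (f y))).
have Ei : complex.Im (rderive w (rderive v f) x) = complex.Im (rderive v (rderive w f) x).
  have H1 := @second_difference (fun y => complex.Im (f y)) (fun y => complex.Im (rderive v f y))
    (fun y => complex.Im (rderive w (rderive v f) y)) v w x
    (near_rd_Im nv)
    (near_rd_Im nvw) ci.
  have H2 := @second_difference (fun y => complex.Im (f y)) (fun y => complex.Im (rderive w f y))
    (fun y => complex.Im (rderive v (rderive w f) y)) w v x
    (near_rd_Im nw)
    (near_rd_Im nwv) di.
  apply: real_cvg_unique H1 _; move: H2; apply: cvg_trans; apply: near_eq_cvg.
  by apply: nearW => h; rewrite (swap (fun y => complex.Im (f y))).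
by rewrite [LHS]complexE Er Ei -complexE.
Qed.

Lemma rderive_comb U (f g : V -> C) x k v (a b : C) : smooth_on U f -> smooth_on U g -> U x ->
  v = dir_x k \/ v = dir_y k ->
  rderive v (fun y => a * (f y + b * g y)) x = a * (rderive v f x + b * rderive v g x).
Proof.
move=> sf sg Ux vk.
have fx := smooth_rd sf Ux vk; have gx := smooth_rd sg Ux vk.
have H := rdM (rd_cst v a x) (rdD fx (rdM (rd_cst v b x) gx)).
have [_ ->] := rd_rderive H.
by rewrite mul0r add0r mul0r add0r.
Qed.

Lemma d_zbar_d_z U (f : V -> C) x j k : open U -> smooth_on U f -> U x ->
  d_zbar j (d_z k f) x = d_z k (d_zbar j f) x.
Proof.
move=> oU sf Ux.
have xl (i : 'I_n) : (dir_x i : V) = dir_x i \/ (dir_x i : V) = dir_y i by left.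
have yl (i : 'I_n) : (dir_y i : V) = dir_x i \/ (dir_y i : V) = dir_y i by right.
have sx i := smooth_rderive sf (xl i); have sy i := smooth_rderive sf (yl i).
have -> : d_z k f = fun y => 2^-1 * (rderive (dir_x k) f y + (- 'i%C) * rderive (dir_y k) f y).
  by apply/funext => y; rewrite mulNr.
have -> : d_zbar j f = fun y => 2^-1 * (rderive (dir_x j) f y + 'i%C * rderive (dir_y j) f y) by [].
rewrite /d_zbar /d_z.
rewrite (rderive_comb _ _ (sx k) (sy k) Ux (xl j)) (rderive_comb _ _ (sx k) (sy k) Ux (yl j)).
rewrite (rderive_comb _ _ (sx j) (sy j) Ux (xl k)) (rderive_comb _ _ (sx j) (sy j) Ux (yl k)).
move: (Schwarz oU sf Ux (xl k) (xl j)) (Schwarz oU sf Ux (yl k) (xl j)).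
move: (Schwarz oU sf Ux (xl k) (yl j)) (Schwarz oU sf Ux (yl k) (yl j)).
move: (@rderive R n) (@dir_x R n) (@dir_y R n) => D dx dy -> -> -> ->.
move: (D _ (D (dx j) f) x) (D _ (D (dx j) f) x) (D _ (D (dy j) f) x) (D _ (D (dy j) f) x).
by move=> a b c d; ring.
Qed.

Lemma laplacian U (f : V -> C) x j : open U -> smooth_on U f -> U x ->
  rderive (dir_x j) (rderive (dir_x j) f) x + rderive (dir_y j) (rderive (dir_y j) f) x
  = 4 * d_zbar j (d_z j f) x.
Proof.
move=> oU sf Ux.
have xl : (dir_x j : V) = dir_x j \/ (dir_x j : V) = dir_y j by left.
have yl : (dir_y j : V) = dir_x j \/ (dir_y j : V) = dir_y j by right.
have sx := smooth_rderive sf xl; have sy := smooth_rderive sf yl.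
have -> : d_z j f = fun y => 2^-1 * (rderive (dir_x j) f y + (- 'i%C) * rderive (dir_y j) f y).
  by apply/funext => y; rewrite mulNr.
rewrite /d_zbar (rderive_comb _ _ sx sy Ux xl) (rderive_comb _ _ sx sy Ux yl).
have ii : 'i%C * 'i%C = -1 :> C by rewrite -expr2 sqr_i.
move: (Schwarz oU sf Ux yl xl).
move: (@rderive R n) (@dir_x R n) (@dir_y R n) => D dx dy ->.
move: (D (dx j) (D (dx j) f) x) (D (dy j) (D (dx j) f) x) (D (dy j) (D (dy j) f) x) => a b c.
transitivity (a - ('i%C * 'i%C) * c); first by rewrite ii; ring.
by field.
Qed.

Lemma holo_d_z U (f : V -> C) j : open U -> holomorphic_on U f -> holomorphic_on U (d_z j f).
Proof.
move=> oU [sf fb]; split; first exact: smooth_d_z.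
move=> x k Ux; rewrite (d_zbar_d_z k j oU sf Ux).
have n0 : \near x, (fun=> 0) x = d_zbar k f x.
  by move: (open_nbhs_nbhs (conj oU Ux)); apply: filterS => y Uy; rewrite fb.
have [-> _] := d_z_eq j n0 (smooth_cst U 0) Ux.
by have [] := d_z_cst (0 : C) x j.
Qed.

End Schwarz.

Transparent dir_x dir_y.

(** * Identity theorem and division by a coordinate *)

Section MaximumPrinciple.
Context {R : realType}.
Local Notation C := R[i].

Definition polydisc n (z : 'rV[C]_n) (r : R) : set 'rV[C]_n :=
  [set x | forall k, `|x 0 k - z 0 k| < r%:C].

Lemma polydisc_center n (z : 'rV[C]_n) r : 0 < r -> polydisc z r z.
Proof. by move=> r0 k; rewrite subrr normr0 ltcR. Qed.

Lemma open_polydisc n (z : 'rV[C]_n) r : open (polydisc z r).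
Proof.
rewrite openE => x zx.
suff : nbhs x [set y : 'rV[C]_n | forall k, `|y 0 k - z 0 k| < r%:C] by [].
apply: (@filter_forall _ _ (fun k => [set y : 'rV[C]_n | `|y 0 k - z 0 k| < r%:C]) (nbhs x)) => k.
have [s s0 Es] : exists2 s : R, 0 < s & s%:C <= r%:C - `|x 0 k - z 0 k|.
  have := zx k; rewrite -subr_gt0 => /gt0_complexP[s s0 E]; exists s => //.
  by rewrite E.
have /cvgr_dist_lt H := @continuous_coord R n k x.
have s0' : 0 < s%:C :> C by rewrite ltcR.
apply: filterS (H _ s0') => y yx /=.
have -> : y 0 k - z 0 k = - (x 0 k - y 0 k) + (x 0 k - z 0 k) by ring.
apply: le_lt_trans (ler_normD _ _) _; rewrite normrN -ltrBrDr.
exact: lt_le_trans yx Es.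
Qed.

Lemma nbhs_polydisc n (z : 'rV[C]_n) (A : set 'rV[C]_n) :
  nbhs z A <-> exists2 r : R, 0 < r & polydisc z r `<=` A.
Proof. exact: nbhs_rVP. Qed.

Lemma polydiscS n (z : 'rV[C]_n) r s : r <= s -> polydisc z r `<=` polydisc z s.
Proof. by move=> rs x zx k; apply: lt_le_trans (zx k) _; rewrite lecR. Qed.

(** If [c] were positive, [dphi], which is 0 at 0, would be positive just to the right of 0, and the
    mean value theorem would give a value of [phi] above [phi 0]. *)
Lemma second_derivative_at_max (phi dphi : R -> R) (c e : R) : 0 < e ->
  (forall t, `|t| < e -> is_derive t (1 : R) phi (dphi t)) ->
  is_derive (0 : R) (1 : R) dphi c -> (forall t, `|t| < e -> phi t <= phi 0) -> c <= 0.
Proof.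
move=> e0 dp ddp pmax.
have inE t : t \in `]- e, e[%R = (`|t| < e) by rewrite in_itv /= ltr_norml.
have d0 : dphi 0 = 0.
  have [_ E1] : is_derive (0 : R) (1 : R) phi (dphi 0) by apply: dp; rewrite normr0.
  have [_ E2] : is_derive (0 : R) (1 : R) phi 0.
    apply: (@derive1_at_max _ phi (- e) e 0).
    - by rewrite ge0_cp // ltW.
    - by move=> t; rewrite inE => /dp[].
    - by rewrite inE normr0.
    - by move=> t; rewrite inE; exact: pmax.
  by rewrite -E1 E2.
rewrite leNgt; apply/negP => c0.
move/is_derive_cvgP: ddp; rewrite d0 => /cvgr_gt /(_ 0 c0).
rewrite /dnbhs /within /= => /nbhs_ballP[d /= d00 dP].
pose t0 := Num.min (d / 2) (e / 2).
have t00 : 0 < t0 by rewrite lt_min !divr_gt0.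
have t0d : t0 < d.
  by rewrite /t0 gt_min; apply/orP; left; rewrite ltr_pdivrMr // mulr_natr mulr2n ltrDl.
have t0e : t0 < e.
  by rewrite /t0 gt_min; apply/orP; right; rewrite ltr_pdivrMr // mulr_natr mulr2n ltrDl.
have dpos t : 0 < t -> t <= t0 -> 0 < dphi t.
  move=> t1 tt0; have := dP t; rewrite /ball /= sub0r normrN gtr0_norm // addr0 subr0.
  move=> /(_ (le_lt_trans tt0 t0d) (lt0r_neq0 t1)).
  by rewrite pmulr_rgt0 // invr_gt0.
have [|| s /itvP sa E] := @MVT R phi dphi 0 t0 t00.
- by move=> s /itvP sa; apply: dp; rewrite gtr0_norm ?sa // (lt_trans _ t0e) ?sa.
- apply: continuous_in_subspaceT => s; rewrite mem_setE => /itvP sa.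
  have /dp[ds _] : `|s| < e by rewrite ger0_norm ?sa // (le_lt_trans _ t0e) ?sa.
  exact/differentiable_continuous/derivable1_diffP.
have := pmax t0; rewrite gtr0_norm // => /(_ t0e).
by rewrite leNgt -subr_gt0 E subr0 mulr_gt0 // dpos ?sa // ltW // sa.
Qed.

(** In the variable z_j, the function |g|^2 + eps |z_j|^2 has Laplacian 4 (|d_z j g|^2 + eps) > 0,
    whereas at a maximum both second derivatives are at most 0. The term in [eps] makes the
    inequality strict, so that points where [d_z j g] vanishes are covered. *)
Lemma no_interior_max n (U : set 'rV[C]_n) (g : 'rV[C]_n -> C) (x0 : 'rV[C]_n) j (eps : R) :
  open U -> holomorphic_on U g -> U x0 -> 0 < eps ->
  ~ \forall y \near x0, sqnorm (g y) + eps * sqnorm (y 0 j) <= sqnorm (g x0) + eps * sqnorm (x0 0 j).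
Proof.
move=> oU [sg gb] Ux0 eps0 umax.
pose G y := g y * (g y)^*%C + eps%:C * (y 0 j * (y 0 j)^*%C).
have ReG y : complex.Re (G y) = sqnorm (g y) + eps * sqnorm (y 0 j).
  by rewrite /G -!sqnormE raddfD /= mul0r subr0.
have sgc := smooth_conj oU sg; have sc := smooth_coord j oU; have scc := smooth_conj oU sc.
have s1 := smooth_mul oU sg sgc; have s2 := smooth_mul oU sc scc.
have s3 : smooth_on U (fun y : 'rV[C]_n => eps%:C * (y 0 j * (y 0 j)^*%C)).
  by apply: smooth_mul; [exact: oU|exact: smooth_cst|exact: s2].
have sG : smooth_on U G by exact: smooth_add oU s1 s3.
have nU : \forall y \near x0, U y by apply: open_nbhs_nbhs.
have secder v : v = dir_x j \/ v = dir_y j -> complex.Re (rderive v (rderive v G) x0) <= 0.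
  move=> vj; have sv := smooth_rderive sG vj.
  have /line_near-/(_ v) : \forall y \near x0, U y /\ complex.Re (G y) <= complex.Re (G x0).
    by apply: filterS2 nU umax => y Uy; rewrite !ReG.
  move=> /nbhs_ballP[e /= e0 eP].
  apply: (@second_derivative_at_max (fun t => complex.Re (G (x0 + t%:C *: v)))
    (fun t => complex.Re (rderive v G (x0 + t%:C *: v))) _ e).
  - exact: e0.
  - move=> t te; have [Ut _] : U (x0 + t%:C *: v) /\ complex.Re (G (x0 + t%:C *: v)) <= complex.Re (G x0).
      by apply: eP; rewrite /ball /= sub0r normrN.
    by have /(rd_line v G x0 t)[H _] := smooth_rd sG Ut vj; exact: H.
  - by have /rdP[H _] := smooth_rd sv Ux0 vj; exact: H.
  - move=> t te; rewrite scale0r addr0.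
    by have [] : U (x0 + t%:C *: v) /\ complex.Re (G (x0 + t%:C *: v)) <= complex.Re (G x0);
      first by apply: eP; rewrite /ball /= sub0r normrN.
have Rx := secder _ (or_introl erefl); have Ry := secder _ (or_intror erefl).
have := lerD Rx Ry; rewrite addr0 -raddfD (laplacian j oU sG Ux0).
have dzG y : U y -> d_z j G y = d_z j g y * (g y)^*%C + eps%:C * (y 0 j)^*%C.
  move=> Uy; have [-> _] := d_zD j s1 s3 Uy.
  have [-> _] := d_zM j sg sgc Uy; have [-> _] := d_z_conj j sg Uy.
  have [-> _] := d_zM j (smooth_cst U eps%:C) s2 Uy; have [-> _] := d_z_cst (eps%:C : C) y j.
  have [-> _] := d_zM j sc scc Uy; have [-> _] := d_z_conj j sc Uy.
  have [-> ->] := d_z_coord y j j; rewrite gb // !conjc0 eqxx.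
  by rewrite !mulr0 !mul0r !add0r !addr0 !mul1r.
have n1 : \near x0, (fun y => d_z j g y * (g y)^*%C + eps%:C * (y 0 j)^*%C) x0 = d_z j G x0.
  by apply: filterS nU => y /dzG ->.
have sd := smooth_d_z j oU sg.
have s4 := smooth_mul oU sd sgc; have s5 := smooth_mul oU (smooth_cst U eps%:C) scc.
have [_ ->] := d_z_eq j n1 (smooth_add oU s4 s5) Ux0.
have [_ ->] := d_zD j s4 s5 Ux0.
have [_ ->] := d_zM j sd sgc Ux0; have [_ ->] := d_z_conj j sg Ux0.
have [_ ->] := d_zM j (smooth_cst U eps%:C) scc Ux0; have [_ ->] := d_z_cst (eps%:C : C) x0 j.
have [_ ->] := d_z_conj j sc Ux0; have [-> _] := d_z_coord x0 j j.
have [_ hb] := holo_d_z j oU (conj sg gb); rewrite hb //.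
rewrite eqxx mul0r add0r mul0r add0r conjc1 mulr1 -sqnormE -rmorphD.
rewrite -[4]/(4%:R) -(rmorph_nat (real_complex R)) -rmorphM /=.
by rewrite leNgt pmulr_rgt0 // ltr_wpDl // sqnorm_ge0.
Qed.

Lemma sqnormM (z w : C) : sqnorm (z * w) = sqnorm z * sqnorm w.
Proof. by case: z w => a b [c d]; rewrite /sqnorm /=; ring. Qed.

Lemma sqnorm_eq0 (z : C) : (sqnorm z == 0) = (z == 0).
Proof.
case: z => a b; rewrite /sqnorm /= paddr_eq0 ?sqr_ge0 // !sqrf_eq0.
by rewrite eq_complex.
Qed.

Lemma sqnormX (z : C) k : sqnorm (z ^+ k) = sqnorm z ^+ k.
Proof.
elim: k => [|k IH]; last by rewrite !exprS sqnormM IH.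
by rewrite /sqnorm /= expr1n expr0n addr0.
Qed.

Lemma sqnormV (z : C) : sqnorm z^-1 = (sqnorm z)^-1.
Proof.
have [->|z0] := eqVneq z 0; first by rewrite invr0 /sqnorm /= expr0n addr0 invr0.
have sz0 : sqnorm z != 0 by rewrite sqnorm_eq0.
apply: (mulfI sz0); rewrite -sqnormM !divff //.
by rewrite /sqnorm /= expr1n expr0n addr0.
Qed.

Lemma cont_sqnorm n (g : 'rV[C]_n -> C) x : cont_at g x -> sqnorm (g y) @[y --> x] --> sqnorm (g x).
Proof.
move=> /cont_atP gx.
have := @cvg_comp _ _ _ g (fun y : C => sqnorm (y - 0)) (nbhs x) (nbhs (g x)) _ gx (@sqnorm_continuous _ 0 (g x)).
by rewrite subr0; under eq_fun do rewrite subr0.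
Qed.

(** Dividing by [z ^+ N] does not destroy holomorphy, so the maximum principle on
    a disc of radius [r > |z|] bounds [g z] by [M (|z| / r) ^+ N] for every [N]. *)
Lemma disc_identity (g : 'rV[C]_1 -> C) (rho delta : R) :
  holomorphic_on (polydisc 0 rho) g -> 0 < delta ->
  (forall z, polydisc 0 delta z -> g z = 0) -> forall z, polydisc 0 rho z -> g z = 0.
Proof.
move=> hg d0 g0 z1 z1r; apply/eqP/negPn/negP => gz1.
have pE (z : 'rV[C]_1) r : polydisc 0 r z <-> `|z 0 0| < r%:C.
  by split => [/(_ 0)|H k]; [|rewrite ord1]; rewrite mxE subr0.
have rho0 : 0 < rho.
  by move/pE: z1r => /(le_lt_trans (normr_ge0 _)); rewrite ltcR.
pose a := sqnorm (z1 0 0).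
have a_rho : a < rho ^+ 2 by rewrite -norm_sqnorm_lt ?ltW //; apply/pE.
have z10 : z1 0 0 != 0.
  apply: contraNneq gz1 => z0; apply/eqP/g0/pE; by rewrite z0 normr0 ltcR.
have a0 : 0 < a by rewrite lt_def sqnorm_ge0 sqnorm_eq0 z10.
(* The square of a radius strictly between |z1| and rho: the closed disc [K] stays in the domain,
   and a / b < 1. *)
pose b := (a + rho ^+ 2) / 2.
have ab : a < b by rewrite /b ltr_pdivlMr // mulr_natr mulr2n ltrD2l.
have b_rho : b < rho ^+ 2 by rewrite /b ltr_pdivrMr // mulr_natr mulr2n ltrD2r.
have b0 : 0 < b by exact: lt_trans ab.
pose K := [set z : 'rV[C]_1 | sqnorm (z 0 0) <= b].
have cC : continuous (fun z : 'rV[C]_1 => sqnorm (z 0 0)).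
  by move=> z; apply: (@cont_sqnorm 1 (fun z => z 0 0)); exact: cont_coord.
have cK : compact K.
  apply: (subclosed_compact _ (@compact_polydisc R 1 0 rho)).
    apply: (@closed_comp _ _ (fun z : 'rV[C]_1 => sqnorm (z 0 0)) [set t | t <= b]).
      by move=> z _; exact: cC.
    exact: closed_le.
  move=> z /= zb k; rewrite ord1 mxE subr0 norm_sqnorm ?(ltW rho0) //.
  exact: le_trans zb (ltW b_rho).
have KU z : K z -> polydisc 0 rho z.
  move=> zb; apply/pE; rewrite norm_sqnorm_lt ?(ltW rho0) //; exact: le_lt_trans zb b_rho.
have Kz1 : K z1 by exact: ltW.
have oU := @open_polydisc 1 0 rho.
pose h N (z : 'rV[C]_1) := g z * (z 0 0 ^+ N)^-1.
have hh N : holomorphic_on (polydisc 0 rho) (h N).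
  apply: holo_loc => z zr; have [z0|z0] := eqVneq (z 0 0) 0.
    (* Near 0 the numerator vanishes identically, so the quotient is the constant 0 there. *)
    exists (polydisc 0 delta); first by apply/pE; rewrite z0 normr0 ltcR.
    apply: (@holo_eq _ _ _ (fun=> 0)); [exact: open_polydisc| |exact: holo_cst].
    by move=> y yd; rewrite /h g0 // mul0r.
  pose W := polydisc 0 rho `&` [set y : 'rV[C]_1 | y 0 0 != 0].
  have oW : open W.
    apply: openI; first exact: oU.
    rewrite openE => y /= y0; have := @continuous_coord R 1 0 y.
    by move/cvgr_neq0/(_ y0).
  exists W; first by [].
  apply: holo_mul; [exact: oW|by apply: holo_sub hg => y []|].
  apply: holo_inv; [exact: oW|by move=> y [_ y0]; rewrite expf_neq0|].
  have -> : (fun x : 'rV[C]_1 => x 0 0 ^+ N) = (fun x => \prod_(i < N) x 0 0).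
    by apply/funext => y; rewrite prodr_const card_ord.
  by apply: holo_prod => // i _; exact: holo_coord.
have [M M0 MP] : exists2 M, 0 <= M & forall z, K z -> sqnorm (g z) <= M.
  have [|c _ cP] := @compact_EVT_max _ R (fun z => sqnorm (g z)) K (ex_intro _ z1 Kz1) cK.
    apply: continuous_in_subspaceT => z; rewrite inE => /KU zr.
    by apply: cont_sqnorm; exact: smooth_cont (holo_smooth hg) zr.
  exists (sqnorm (g c)); first exact: sqnorm_ge0.
  by move=> z Kz; apply: cP; rewrite inE.
have bound N eps : 0 < eps -> sqnorm (h N z1) <= M / b ^+ N + eps * b.
  move=> eps0.
  have [|c] := @compact_EVT_max _ R (fun z => sqnorm (h N z) + eps * sqnorm (z 0 0)) K (ex_intro _ z1 Kz1) cK.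
    apply: continuous_in_subspaceT => z; rewrite inE => /KU zr.
    apply: (@cvgD _ _ _ (nbhs z) _ (fun z => sqnorm (h N z)) (fun z => eps * sqnorm (z 0 0))).
      by apply: cont_sqnorm; exact: smooth_cont (holo_smooth (hh N)) zr.
    by apply: (@cvgM _ _ (nbhs z) _ (cst eps) (fun z => sqnorm (z 0 0))); [exact: cvg_cst|exact: cC].
  rewrite inE => Kc cP.
  (* A maximum with |c|^2 < b would be interior, which the term in [eps] excludes. So it lies on the
     boundary circle, where the squared denominator is b^N. *)
  have cb : sqnorm (c 0 0) = b.
    apply/eqP; rewrite eq_le Kc leNgt; apply/negP => cb.
    apply: (no_interior_max (j := 0) oU (hh N) (KU c Kc) eps0).
    have : nbhs c [set y : 'rV[C]_1 | sqnorm (y 0 0) < b] by have := cC c; move/cvgr_lt => /(_ b cb).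
    by apply: filterS => y yb; apply: cP; rewrite inE; exact: ltW.
  have := cP z1; rewrite inE => /(_ Kz1); rewrite cb => H.
  apply: (@le_trans _ _ (sqnorm (h N z1) + eps * sqnorm (z1 0 0))).
    by rewrite lerDl mulr_ge0 ?(ltW eps0) ?sqnorm_ge0.
  apply: (le_trans H); rewrite lerD2r /h sqnormM sqnormV sqnormX cb.
  by rewrite ler_wpM2r ?MP // invr_ge0 exprn_ge0 // ltW.
have bound2 N : sqnorm (g z1) <= M * (a / b) ^+ N.
  have : sqnorm (h N z1) <= M / b ^+ N.
    apply/ler_addgt0Pr => e e0; have := bound N (e / b); rewrite divr_gt0 // => /(_ isT).
    by rewrite divfK ?gt_eqF.
  have -> : M * (a / b) ^+ N = M / b ^+ N * a ^+ N by rewrite expr_div_n mulrA mulrAC.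
  by rewrite /h sqnormM sqnormV sqnormX -/a ler_pdivrMr ?exprn_gt0.
have : M * (a / b) ^+ N @[N --> \oo] --> M * 0.
  apply: cvgM; first exact: cvg_cst.
  apply: cvg_expr; rewrite ger0_norm; last by exact: divr_ge0 (ltW a0) (ltW b0).
  by rewrite ltr_pdivrMr // mul1r.
move=> /cvgr_lt /(_ (sqnorm (g z1))).
have -> : M * 0 < sqnorm (g z1) by rewrite mulr0 lt_def sqnorm_ge0 sqnorm_eq0 gz1.
by move=> /(_ isT)[N _ /(_ N (leqnn N))]; rewrite /= ltNge bound2.
Qed.

(** The complex line through [q] and [x] stays in the hyperplane, so the one-variable statement
    applies to the restriction of [f] to that line. *)
Lemma hyperplane_identity n i (f : 'rV[C]_n -> C) (p q x : 'rV[C]_n) (r : R) :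
  holomorphic_on (polydisc p r) f -> polydisc p (r / 4) q -> polydisc p (r / 4) x ->
  q 0 i = 0 -> x 0 i = 0 -> nbhs q [set y : 'rV[C]_n | y 0 i = 0 -> f y = 0] -> f x = 0.
Proof.
move=> hf pq px qi xi fq.
(* For |t| < 3/2 the point [F t] is within r/4 + (3/2)(r/4 + r/4) = r of [p] in each coordinate, and
   t = 1, where the line passes through [x], lies in this disc. *)
pose F (t : 'rV[C]_1) : 'rV[C]_n := q + t 0 0 *: (x - q).
have FU t : polydisc 0 (3 / 2) t -> polydisc p r (F t).
  move=> t32 k; rewrite !mxE.
  have -> : q 0 k + t 0 0 * (x 0 k - q 0 k) - p 0 k =
      (q 0 k - p 0 k) + t 0 0 * ((x 0 k - p 0 k) - (q 0 k - p 0 k)) by ring.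
  have tn : `|t 0 0| <= (3 / 2)%:C by have := t32 0; rewrite mxE subr0 => /ltW.
  have xq : `|(x 0 k - p 0 k) - (q 0 k - p 0 k)| <= (r / 4)%:C + (r / 4)%:C.
    by apply: le_trans (ler_normB _ _) _; apply: lerD; exact: ltW.
  apply: le_lt_trans (ler_normD _ _) _.
  have -> : r%:C = (r / 4)%:C + (3 / 2)%:C * ((r / 4)%:C + (r / 4)%:C).
    by rewrite -rmorphD -rmorphM -rmorphD; congr (_%:C); field.
  apply: ltr_leD; first exact: pq.
  by rewrite normrM ler_pM.
have hF k : holomorphic_on (polydisc 0 (3 / 2)) (fun t => F t 0 k).
  have -> : (fun t => F t 0 k) = (fun t => q 0 k + t 0 0 * (x 0 k - q 0 k)).
    by apply/funext => t; rewrite !mxE.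
  have o := @open_polydisc 1 0 (3 / 2).
  apply: holo_add; [exact: o|exact: holo_cst|].
  by apply: holo_mul; [exact: o|exact: holo_coord|exact: holo_cst].
have hfF := holo_comp (@open_polydisc 1 0 (3 / 2)) (@open_polydisc n p r) FU hF hf.
have [d d0 dP] : exists2 d : R, 0 < d & forall t, polydisc 0 d t -> f (F t) = 0.
  have F0 : F 0 = q by rewrite /F mxE scale0r addr0.
  have : F t @[t --> (0 : 'rV[C]_1)] --> F 0.
    apply/(@cvg_rVP R _ n (nbhs (0 : 'rV[C]_1))) => k; have /smooth_cont H := holo_smooth (hF k).
    by apply/cont_atP/H/polydisc_center; rewrite divr_gt0.
  rewrite F0 => /(_ _ fq)/nbhs_polydisc[d d0 dP]; exists d => // t /dP; apply.
  by rewrite !mxE qi xi subrr mulr0 addr0.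
have := disc_identity hfF d0 dP (z := const_mx 1).
rewrite /F mxE scale1r addrCA subrr addr0; apply => k.
by rewrite !mxE subr0 normr1 ltcR; lra.
Qed.

End MaximumPrinciple.

(** * Division of a holomorphic function by a coordinate *)

Section Division.
Context {R : realType} {n : nat}.
Local Notation C := R[i].
Local Notation V := 'rV[R[i]]_n.
Local Notation mu := (@lebesgue_measure R).
Context (i : 'I_n) (p : V) (r : R) (pi0 : p 0 i = 0).
Let W := polydisc p r.
Implicit Types (f F : V -> C) (z v : V) (t : R).

Let scl t z : V := \row_k (if k == i then t%:C * z 0 k else z 0 k).

(** [fun z => \int_0^1 t ^ m F (z_0, .., t z_i, .., z_n) dt] *)
Let avg (m : nat) F z : C :=
  (\int[mu]_(t in `[0, 1]) (t ^+ m * complex.Re (F (scl t z)))) +i*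
  (\int[mu]_(t in `[0, 1]) (t ^+ m * complex.Im (F (scl t z)))).

Let oW : open W.
Proof. exact: open_polydisc. Qed.

Let scl_in t z (s : R) : 0 <= t <= 1 -> (forall k, `|z 0 k - p 0 k| <= s%:C) ->
  forall k, `|scl t z 0 k - p 0 k| <= s%:C.
Proof.
move=> /andP[t0 t1] zs k; rewrite mxE; case: eqP => [->|_]; last exact: zs.
have := zs i; rewrite pi0 !subr0 normrM norm_real_complex (ger0_norm t0).
have tC : t%:C <= (1 : C) by rewrite lecE /= eqxx.
by move=> zi; apply: le_trans zi; rewrite ler_piMl.
Qed.

Let sclW t z : 0 <= t <= 1 -> W z -> W (scl t z).
Proof.
move=> /andP[t0 t1] zs k; rewrite mxE; case: eqP => [->|_]; last exact: zs.
have := zs i; rewrite pi0 !subr0 normrM norm_real_complex (ger0_norm t0).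
have tC : t%:C <= (1 : C) by rewrite lecE /= eqxx.
by move=> zi; apply: le_lt_trans zi; rewrite ler_piMl.
Qed.

Let scl1 z : scl 1 z = z.
Proof. by apply/rowP => k; rewrite mxE mul1r if_same. Qed.

Let scl_cvg2 t z : scl x.1 x.2 @[x --> (t, z)] --> scl t z.
Proof.
apply/(@cvg_rVP R _ n (nbhs (t, z))) => k; rewrite mxE; case ki : (k == i); under eq_fun do rewrite mxE ki.
  apply: (@cvgM _ _ (nbhs (t, z)) _ (fun x => x.1%:C) (fun x => x.2 0 k)).
    by apply: (@cvg_real_complex _ _ (nbhs (t, z))); exact: cvg_fst.
  apply: (@cvg_comp _ _ _ snd (fun z : V => z 0 k) (nbhs (t, z)) (nbhs z)); first exact: cvg_snd.
  exact: continuous_coord.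
apply: (@cvg_comp _ _ _ snd (fun z : V => z 0 k) (nbhs (t, z)) (nbhs z)); first exact: cvg_snd.
exact: continuous_coord.
Qed.

Let scl_cont z t : scl s z @[s --> t] --> scl t z.
Proof.
apply/(@cvg_rVP R _ n (nbhs t)) => k; rewrite mxE; case ki : (k == i); under eq_fun do rewrite mxE ki.
  by apply: cvgM; [apply: cvg_real_complex; exact: cvg_id|exact: cvg_cst].
exact: cvg_cst.
Qed.

Let itv01 t : `[0, 1]%classic t = (0 <= t <= 1).
Proof. by rewrite /= in_itv. Qed.

Let int_cont (g : R -> R) : (forall t, 0 <= t <= 1 -> g s @[s --> t] --> g t) ->
  mu.-integrable `[0, 1] (EFin \o g).
Proof.
move=> cg; apply: continuous_compact_integrable; first exact: segment_compact.
by apply: continuous_in_subspaceT => t; rewrite inE itv01 => /cg.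
Qed.

Let pow_cont m (g : R -> R) t : g s @[s --> t] --> g t ->
  s ^+ m * g s @[s --> t] --> t ^+ m * g t.
Proof. by move=> gt; apply: cvgM gt; exact: exprn_continuous. Qed.

Let line_scl F z t : cont_at F (scl t z) -> F (scl s z) @[s --> t] --> F (scl t z).
Proof.
move=> /cont_atP Fc; apply: (@cvg_comp _ _ _ (fun s => scl s z) F (nbhs t) (nbhs (scl t z))).
  exact: scl_cont.
exact: Fc.
Qed.

Let int_avg (part : C -> R) m F z : (forall w : C, part u @[u --> w] --> part w) ->
  (forall x, W x -> cont_at F x) -> W z ->
  mu.-integrable `[0, 1] (EFin \o (fun t => t ^+ m * part (F (scl t z)))).
Proof.
move=> pc Fc Wz; apply: int_cont => t t01; apply: (@pow_cont m (fun t => part (F (scl t z)))).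
apply: (@cvg_comp _ _ _ (fun s => F (scl s z)) part (nbhs t) (nbhs (F (scl t z)))); last exact: pc.
by apply: line_scl; apply: Fc; exact: sclW.
Qed.

Let measure01 : fine (mu `[0, 1]%classic) = 1.
Proof. by rewrite lebesgue_measure_itv /= lte01 oppr0 adde0. Qed.

Let m01 : measurable (`[0, 1]%classic : set (measurableTypeR R)).
Proof. exact: measurable_itv. Qed.

(** [part] is the real or the imaginary part. Compactness of [0, 1] makes the continuity in [y]
    uniform in [t], and t^m is at most 1. *)
Let avg_part_cont (part : C -> R) m F z : (forall w : C, part u @[u --> w] --> part w) ->
  (forall x, W x -> cont_at F x) -> W z ->
  \int[mu]_(t in `[0, 1]) (t ^+ m * part (F (scl t y))) @[y --> z] -->
  \int[mu]_(t in `[0, 1]) (t ^+ m * part (F (scl t z))).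
Proof.
move=> pc Fc Wz; apply/(@cvgrPdist_le _ _ _ (nbhs z)) => e e0.
have cov : forall t, `[0, 1]%classic t ->
    \forall t' \near t & y \near z, `|part (F (scl t' z)) - part (F (scl t' y))| <= e.
  move=> t; rewrite itv01 => t01; have e20 : 0 < e / 2 by rewrite divr_gt0.
  have c0 : part (F (scl x.1 x.2)) @[x --> (t, z)] --> part (F (scl t z)).
    apply: (@cvg_comp _ _ _ (fun x => F (scl x.1 x.2)) part (nbhs (t, z)) (nbhs (F (scl t z)))); last exact: pc.
    apply: (@cvg_comp _ _ _ (fun x => scl x.1 x.2) F (nbhs (t, z)) (nbhs (scl t z))).
      exact: scl_cvg2.
    by apply/cont_atP; apply: Fc; exact: sclW.
  have c1 : part (F (scl x.1 z)) @[x --> (t, z)] --> part (F (scl t z)).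
    apply: (@cvg_comp _ _ _ fst (fun s => part (F (scl s z))) (nbhs (t, z)) (nbhs t)); first exact: cvg_fst.
    apply: (@cvg_comp _ _ _ (fun s => F (scl s z)) part (nbhs t) (nbhs (F (scl t z)))); last exact: pc.
    by apply: line_scl; apply: Fc; exact: sclW.
  move/cvgrPdist_lt: c0 => /(_ _ e20) c0; move/cvgrPdist_lt: c1 => /(_ _ e20) c1.
  suff : \forall x \near (t, z), `|part (F (scl x.1 z)) - part (F (scl x.1 x.2))| <= e by [].
  apply: filterS2 c0 c1 => -[t' y] /= d0 d1.
  rewrite -(subrK (part (F (scl t z))) (part (F (scl t' z)))) -addrA.
  apply: le_trans (ler_normD _ _) _; rewrite [leRHS]splitr; apply: lerD; last exact: ltW.
  by rewrite distrC ltW.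
have := compact_near_coveringP (`[0, 1]%classic : set R).
move=> [/(_ (@segment_compact R 0 1)) + _]; move=> /(_ _ (nbhs z) (fun y t => `|part (F (scl t z)) - part (F (scl t y))| <= e) _ cov).
move=> near_e; have nW : nbhs z W by apply: open_nbhs_nbhs.
apply: filterS2 near_e nW => y ye Wy /=.
rewrite -RintegralB; [|exact: m01|exact: (@int_avg part m F z)|exact: (@int_avg part m F y)].
have intB : mu.-integrable `[0, 1] (EFin \o (fun t => t ^+ m * part (F (scl t z)) - t ^+ m * part (F (scl t y)))).
  apply: int_cont => t t01; apply: cvgB; apply: (@pow_cont m (fun t => part (F (scl t _)))).
    apply: (@cvg_comp _ _ _ (fun s => F (scl s z)) part (nbhs t) (nbhs (F (scl t z)))); last exact: pc.
    by apply: line_scl; apply: Fc; exact: sclW.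
  apply: (@cvg_comp _ _ _ (fun s => F (scl s y)) part (nbhs t) (nbhs (F (scl t y)))); last exact: pc.
  by apply: line_scl; apply: Fc; exact: sclW.
apply: le_trans (le_normr_Rintegral m01 intB) _.
have -> : e = \int[mu]_(t in `[0, 1]) e by rewrite Rintegral_cst // measure01 mulr1.
apply: le_Rintegral => //.
- exact: integrable_norm intB.
- by apply: int_cont => t _; exact: cvg_cst.
- move=> t t01; rewrite -mulrBr normrM; move: (t01); rewrite itv01 => /andP[t0 t1].
  rewrite -[leRHS]mul1r; apply: ler_pM => //; last exact: ye.
  by rewrite ger0_norm ?exprn_ge0 // exprn_ile1.
Qed.

Lemma avg_cont m F z : smooth_on W F -> W z -> cont_at (avg m F) z.
Proof.
move=> sF Wz; have Fc x : W x -> cont_at F x by move=> Wx; exact: smooth_cont sF Wx.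
apply/cont_atP/(@cvg_complexP R _ (nbhs z)); split.
  exact: (@avg_part_cont (@complex.Re R) m F z (@Re_continuous R) Fc Wz).
exact: (@avg_part_cont (@complex.Im R) m F z (@Im_continuous R) Fc Wz).
Qed.

Let scl_line v t z (s : R) j : v = dir_x j \/ v = dir_y j ->
  scl t (z + s%:C *: v) = scl t z + (t ^+ (v 0 i != 0) * s)%:C *: v.
Proof.
move=> vj; apply/rowP => k; rewrite !mxE.
have [->|ki] := eqVneq k i.
  case: (eqVneq (v 0 i) 0) => [->|_] /=; first by rewrite !mulr0 !addr0.
  by rewrite expr1 rmorphM mulrDr mulrA.
have [vi|vi] := eqVneq (v 0 i) 0; first by rewrite /= expr0 mul1r.
have -> : v 0 k = 0; last by rewrite !mulr0.
move: vi; rewrite !(dir_coord _ vj); case: (eqVneq i j) => [ij _|_]; last by rewrite eqxx.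
by rewrite -ij (negPf ki).
Qed.

(** [W] is open, so z - p may be stretched by some factor 1 + e / 2 without leaving it. The smaller
    polydisc has compact closure in [W], which provides the bounds for differentiation under the
    integral. *)
Let interior_radius z : W z -> exists2 r', r' < r & polydisc p r' z.
Proof.
move=> Wz; have r0 : 0 < r.
  by have := le_lt_trans (normr_ge0 _) (Wz i); rewrite ltcR.
have /(line_near (z - p)) : nbhs z W by apply: open_nbhs_nbhs.
move=> /nbhs_ballP[e /= e0 eW].
have e20 : 0 < e / 2 by rewrite divr_gt0.
have c0 : 0 < 1 + e / 2 by rewrite addr_gt0.
exists (r / (1 + e / 2)); first by rewrite ltr_pdivrMr // ltr_pMr // ltrDl.
have : W (z + (e / 2)%:C *: (z - p)).
  apply: eW; rewrite /ball /= sub0r normrN gtr0_norm // ltr_pdivrMr // mulr_natr mulr2n.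
  by rewrite ltrDl.
move=> H k; have := H k; rewrite !mxE.
have -> : z 0 k + (e / 2)%:C * (z 0 k - p 0 k) - p 0 k = (1 + e / 2)%:C * (z 0 k - p 0 k).
  by rewrite rmorphD rmorph1; ring.
rewrite normrM norm_real_complex (gtr0_norm c0) => H2.
rewrite rmorphM fmorphV /= ltr_pdivlMr; last by rewrite ltcR.
by rewrite mulrC.
Qed.

(** Differentiation under the integral sign with a constant dominating function. The bound by 1 +
    |w|^2 fits because [sqnorm] of a continuous function attains its maximum on a compact
    polydisc. *)
Let avg_part_derive (part : C -> R) m F z v j :
  (forall w : C, part u @[u --> w] --> part w) ->
  (forall g t d, cderiv g t d -> is_derive t (1 : R) (fun s => part (g s)) (part d)) ->
  (forall (a : R) w, part (a%:C * w) = a * part w) ->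
  (forall w, `|part w| <= 1 + sqnorm w) ->
  smooth_on W F -> W z -> v = dir_x j \/ v = dir_y j ->
  is_derive (0 : R) (1 : R) (fun s => \int[mu]_(t in `[0, 1]) (t ^+ m * part (F (scl t (z + s%:C *: v)))))
    (\int[mu]_(t in `[0, 1]) (t ^+ (m + (v 0 i != 0)) * part (rderive v F (scl t z)))).
Proof.
move=> pc pd pM pb sF Wz vj.
have sD := smooth_rderive sF vj.
have Fc x : W x -> cont_at F x by move=> Wx; exact: smooth_cont sF Wx.
have [r' rr' zr'] := interior_radius Wz.
have [e e0 eW] : exists2 e : R, 0 < e & forall s, `|s| < e -> polydisc p r' (z + s%:C *: v).
  have /(line_near v) : nbhs z (polydisc p r').
    by apply: open_nbhs_nbhs; split; [exact: open_polydisc|].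
  move=> /nbhs_ballP[e /= e0 eW]; exists e => // s se.
  by apply: eW; rewrite /ball /= sub0r normrN.
have WW s : `|s| < e -> W (z + s%:C *: v).
  by move=> /eW; apply: polydiscS; exact: ltW.
pose K := [set y : V | forall k, `|y 0 k - p 0 k| <= r'%:C].
have KW y : K y -> W y by move=> Ky k; apply: le_lt_trans (Ky k) _; rewrite ltcR.
have Kz : K z by move=> k; exact: ltW.
have [M M0 MP] : exists2 M, 0 <= M & forall y, K y -> sqnorm (rderive v F y) <= M.
  have [|c _ cP] := @compact_EVT_max _ R (fun y => sqnorm (rderive v F y)) K (ex_intro _ z Kz)
      (@compact_polydisc _ _ p r').
    apply: continuous_in_subspaceT => y; rewrite inE => /KW Wy.
    by apply: cont_sqnorm; exact: smooth_cont sD Wy.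
  exists (sqnorm (rderive v F c)); first exact: sqnorm_ge0.
  by move=> y Ky; apply: cP; rewrite inE.
pose f s t : R := t ^+ m * part (F (scl t (z + s%:C *: v))).
pose df s t : R := t ^+ (m + (v 0 i != 0)) * part (rderive v F (scl t (z + s%:C *: v))).
have inI s : (`]- e, e[%classic : set R) s -> `|s| < e by rewrite /= in_itv /= ltr_norml.
have fd s t : `|s| < e -> 0 <= t <= 1 -> is_derive s (1 : R) (f ^~ t) (df s t).
  move=> se t01; have Wt := sclW t01 (WW s se).
  have rF := smooth_rd sD.
  have H : cderiv (fun u => F (scl t (z + u%:C *: v))) s
      ((t ^+ (v 0 i != 0))%:C * rderive v F (scl t (z + s%:C *: v))).
    have -> : (fun u => F (scl t (z + u%:C *: v))) =
        (fun u => F (scl t z + (t ^+ (v 0 i != 0) * u)%:C *: v)).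
      by apply/funext => u; rewrite (@scl_line v t z u j vj).
    apply: (@cderiv_scale _ (fun u => F (scl t z + u%:C *: v))).
    apply/rd_line; rewrite -(@scl_line v t z s j vj).
    exact: smooth_rd sF Wt vj.
  have := is_deriveZ (t ^+ m) (pd _ _ _ H).
  by rewrite pM /df exprD -mulrA.
have Ia : (`]- e, e[%classic : set R) 0 by rewrite /= in_itv /= oppr_lt0 e0.
have intf s : (`]- e, e[%classic : set R) s -> mu.-integrable `[0, 1] (EFin \o f s).
  by move=> /inI se; apply: (@int_avg part m F _ pc Fc); exact: WW.
have d1E s t : `|s| < e -> 0 <= t <= 1 -> partial1of2 f s t = df s t.
  by move=> se t01; rewrite partial1of2E; have [_] := fd s t se t01.
have ub s t : (`]- e, e[%classic : set R) s -> (`[0, 1]%classic : set R) t ->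
    `|partial1of2 f s t| <= 1 + M.
  rewrite itv01 => /inI se t01; rewrite d1E // /df normrM; move: (t01) => /andP[t0 t1].
  rewrite -[leRHS]mul1r; apply: ler_pM => //.
    by rewrite ger0_norm ?exprn_ge0 // exprn_ile1.
  apply: le_trans (pb _) _; rewrite lerD2l; apply: MP.
  by apply: scl_in => // k; apply: ltW; exact: eW.
have intG : mu.-integrable `[0, 1] (EFin \o (cst (1 + M))).
  by apply: int_cont => t _; exact: cvg_cst.
have := @cvg_differentiation_under_integral R _ _ mu f `[0, 1] m01 0 (- e) e Ia intf
  (fun s t Is t01 => ex_derive (is_derive := fd s t (inI s Is) (eq_ind _ id t01 _ (itv01 t))))
  (cst (1 + M)) (fun _ => addr_ge0 ler01 M0) intG ub.
move=> H; apply/is_derive_cvgP; rewrite /f in H.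
have E : \int[mu]_(t in `[0, 1]) partial1of2 f 0 t =
    \int[mu]_(t in `[0, 1]) (t ^+ (m + (v 0 i != 0)) * part (rderive v F (scl t z))).
  apply: eq_Rintegral => t; rewrite inE itv01 => t01.
  by rewrite d1E ?normr0 // /df scale0r addr0.
by rewrite -E.
Qed.

Let abs_le (x : R) : `|x| <= 1 + x ^+ 2.
Proof.
have := sqr_ge0 (`|x| - 1 / 2); have : `|x| ^+ 2 = x ^+ 2 by rewrite real_normK ?num_real.
by move=> <-; nra.
Qed.

Lemma avg_rd m F z v j : smooth_on W F -> W z -> v = dir_x j \/ v = dir_y j ->
  rd v (avg m F) z (avg (m + (v 0 i != 0)) (rderive v F) z).
Proof.
move=> sF Wz vj; apply/rdP; split.
  apply: (@avg_part_derive (@complex.Re R) m F z v j (@Re_continuous R)) => //.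
  - by move=> g t d [].
  - exact: ReMr.
  - by move=> w; apply: le_trans (abs_le _) _; rewrite lerD2l /sqnorm lerDl sqr_ge0.
apply: (@avg_part_derive (@complex.Im R) m F z v j (@Im_continuous R)) => //.
- by move=> g t d [].
- exact: ImMr.
- by move=> w; apply: le_trans (abs_le _) _; rewrite lerD2l /sqnorm lerDr sqr_ge0.
Qed.

(** Scaling z_i by [t] multiplies derivatives along [dir_x i] and [dir_y i] by [t] and leaves the
    other directions alone. Derivatives of averages are therefore averages with a possibly larger
    exponent, which is why [m] is a parameter. *)
Lemma avg_smooth m F : smooth_on W F -> smooth_on W (avg m F).
Proof.
move=> sF k; elim: k m F sF => [|k IH] m F sF.
  by apply/Ck0P => z Wz; exact: avg_cont.
apply: (@CkS _ _ k W _ (fun v => avg (m + (v 0 i != 0)) (rderive v F)) oW).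
  by move=> z Wz; exact: avg_cont.
move=> j v vj; split; first by move=> z Wz; exact: avg_rd sF Wz vj.
by apply: IH; exact: smooth_rderive sF vj.
Qed.

(** Fundamental theorem of calculus for the function [f (scl s z)] of [s], from the hyperplane,
    where [f] is 0, to [z]. By holomorphy its derivative is z_i times [d_z i f], without a conjugate
    term. *)
Lemma avg_FTC f z : holomorphic_on W f -> (forall y, W y -> y 0 i = 0 -> f y = 0) -> W z ->
  f z = z 0 i * avg 0 (d_z i f) z.
Proof.
move=> hf f0 Wz; have sf := holo_smooth hf; have sd := smooth_d_z i oW sf.
have dc x : W x -> cont_at (d_z i f) x by move=> Wx; exact: smooth_cont sd Wx.
have dphi t : 0 <= t <= 1 -> cderiv (fun s => f (scl s z)) t (d_z i f (scl t z) * z 0 i).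
  move=> t01; have Wt := sclW t01 Wz.
  have H := @cderiv_comp _ _ W f (fun s => scl s z) t (fun k => if k == i then z 0 i else 0)
    oW (sf 1%N) Wt.
  have E : \sum_j (rderive (dir_x j) f (scl t z) * (complex.Re (if j == i then z 0 i else 0))%:C +
             rderive (dir_y j) f (scl t z) * (complex.Im (if j == i then z 0 i else 0))%:C)
      = d_z i f (scl t z) * z 0 i.
    rewrite (bigD1 i) //= eqxx big1 ?addr0; last first.
      have Z (a b : C) : a * (complex.Re (0 : C))%:C + b * (complex.Im (0 : C))%:C = 0.
        by rewrite [a * _]mulr0 [b * _]mulr0 addr0.
      by move=> k /negPf ki; rewrite ki; exact: Z.
    have [-> ->] := holo_rderive i hf Wt.
    by rewrite [in RHS](complexE (z 0 i)); move: (d_z i f _) => a; ring.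
  rewrite -E; apply: H => k; case: eqVneq => [->|ki]; last first.
    have -> : (fun s => scl s z 0 k) = (fun=> z 0 k).
      by apply/funext => s; rewrite mxE (negPf ki).
    exact: cderiv_cst.
  have -> : (fun s => scl s z 0 i) = (fun s => s%:C * z 0 i).
    by apply/funext => s; rewrite mxE eqxx.
  have := cderivM (cderiv_id t) (cderiv_cst (z 0 i) t).
  by rewrite mul1r mulr0 addr0.
have FTC (part : C -> R) : (forall g t d, cderiv g t d -> is_derive t (1 : R) (fun s => part (g s)) (part d)) ->
    (forall w : C, part u @[u --> w] --> part w) -> part 0 = 0 ->
    part (f z) = \int[mu]_(t in `[0, 1]) part (d_z i f (scl t z) * z 0 i).
  move=> pd pc p0.
  have := @continuous_FTC2 R (fun t => part (d_z i f (scl t z) * z 0 i)) (fun t => part (f (scl t z))) 0 1 ltr01.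
  rewrite /Rintegral => ->.
  - rewrite /= scl1 (_ : f (scl 0 z) = 0) ?p0 ?subr0 //.
    by apply: f0; [apply: sclW => //; rewrite lexx ler01|rewrite mxE eqxx mul0r].
  - apply: continuous_in_subspaceT => t; rewrite inE itv01 => t01.
    apply: (@cvg_comp _ _ _ (fun s => d_z i f (scl s z) * z 0 i) part (nbhs t) (nbhs (d_z i f (scl t z) * z 0 i))); last exact: pc.
    apply: cvgM; last exact: cvg_cst.
    by apply: line_scl; apply: dc; exact: sclW.
  - have cphi t : 0 <= t <= 1 -> (fun s => part (f (scl s z))) @ t --> part (f (scl t z)).
      by move=> /dphi/pd[H _]; move/derivable1_diffP/differentiable_continuous : H.
    split.
    + move=> t; rewrite in_itv /= => /andP[t0 t1].
      by have [] := pd _ _ _ (dphi t _); rewrite ?(ltW t0) ?(ltW t1).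
    + by apply: cvg_at_right_filter; apply: cphi; rewrite lexx ler01.
    + by apply: cvg_at_left_filter; apply: cphi; rewrite lexx ler01.
  - move=> t; rewrite in_itv /= => /andP[t0 t1]; rewrite derive1E.
    by have [] := pd _ _ _ (dphi t _); rewrite ?(ltW t0) ?(ltW t1).
have fRe := FTC (@complex.Re R) (fun g t d H => H.1) (@Re_continuous R) erefl.
have fIm := FTC (@complex.Im R) (fun g t d H => H.2) (@Im_continuous R) erefl.
have iRe : mu.-integrable `[0, 1] (EFin \o (fun t => complex.Re (d_z i f (scl t z)))).
  have -> : (fun t => complex.Re (d_z i f (scl t z))) = (fun t => t ^+ 0 * complex.Re (d_z i f (scl t z))).
    by apply/funext => t; rewrite expr0 mul1r.
  exact: (@int_avg (@complex.Re R) 0 (d_z i f) z (@Re_continuous R) dc Wz).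
have iIm : mu.-integrable `[0, 1] (EFin \o (fun t => complex.Im (d_z i f (scl t z)))).
  have -> : (fun t => complex.Im (d_z i f (scl t z))) = (fun t => t ^+ 0 * complex.Im (d_z i f (scl t z))).
    by apply/funext => t; rewrite expr0 mul1r.
  exact: (@int_avg (@complex.Im R) 0 (d_z i f) z (@Im_continuous R) dc Wz).
have iZ (c : R) (g : R -> R) : mu.-integrable `[0, 1] (EFin \o g) ->
    mu.-integrable `[0, 1] (EFin \o (fun t => c * g t)).
  by move=> ig; have := integrableZl m01 c ig.
have J (g : R -> R) : \int[mu]_(t in `[0, 1]) (t ^+ 0 * g t) = \int[mu]_(t in `[0, 1]) g t.
  by apply: eq_Rintegral => t _; rewrite expr0 mul1r.
have Er : complex.Re (f z) = complex.Re (z 0 i * avg 0 (d_z i f) z).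
  rewrite fRe ReM /avg [complex.Re (_ +i* _)]/= [complex.Im (_ +i* _)]/= !J.
  rewrite -(RintegralZl _ m01 iRe) -(RintegralZl _ m01 iIm) -RintegralB; [|exact: m01|exact: iZ|exact: iZ].
  by apply: eq_Rintegral => t _; rewrite ReM; congr (_ - _); exact: mulrC.
have Ei : complex.Im (f z) = complex.Im (z 0 i * avg 0 (d_z i f) z).
  rewrite fIm ImM /avg [complex.Re (_ +i* _)]/= [complex.Im (_ +i* _)]/= !J.
  rewrite -(RintegralZl _ m01 iRe) -(RintegralZl _ m01 iIm) -RintegralD; [|exact: m01|exact: iZ|exact: iZ].
  by apply: eq_Rintegral => t _; rewrite ImM addrC; congr (_ + _); exact: mulrC.
by rewrite [LHS]complexE [RHS]complexE Er Ei.
Qed.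

(** Points of the hyperplane are limits of points off it, along [dir_x i]. *)
Lemma cont_eq0 (h : V -> C) z : (forall y, W y -> y 0 i != 0 -> h y = 0) ->
  (forall y, W y -> cont_at h y) -> W z -> h z = 0.
Proof.
move=> h0 hc Wz; have [zi|zi] := eqVneq (z 0 i) 0; last exact: h0.
have lh : h (z + t%:C *: dir_x i) @[t --> (0 : R)^'] --> h z.
  have := @line_continuous _ _ z (dir_x i) 0; rewrite /continuous_at scale0r addr0 => lc.
  apply: (@cvg_comp _ _ _ (fun t : R => z + t%:C *: dir_x i) h 0^' (nbhs z)).
    exact: cvg_within_filter lc.
  by apply/cont_atP; exact: hc.
have l0 : h (z + t%:C *: dir_x i) @[t --> (0 : R)^'] --> (0 : C).
  have nW : \forall t \near (0 : R)^', W (z + t%:C *: dir_x i).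
    have /(line_near (dir_x i)) : nbhs z W by apply: open_nbhs_nbhs.
    by apply: cvg_within.
  have n0 : \forall t \near (0 : R)^', t != 0 by exact: nbhs_dnbhs_neq.
  apply: cvg_trans (@cvg_cst _ (0 : C) _ ((0 : R)^') _); apply: near_eq_cvg.
  apply: filterS2 nW n0 => t Wt t0; rewrite h0 // mxE zi add0r mxE.
  have := dir_coord i (or_introl (erefl (dir_x i : V))); rewrite !eqxx => ->.
  by rewrite mulr1 eq_complex /= negb_and t0.
have /cvg_complexP[lr li] := lh; have /cvg_complexP[l0r l0i] := l0.
by rewrite [LHS]complexE (real_cvg_unique lr l0r) (real_cvg_unique li l0i) mulr0 addr0.
Qed.

(** Off the hyperplane the average is f / z_i, hence holomorphic. It is smooth everywhere, so its
    [d_zbar k] is continuous and vanishes on the hyperplane too. *)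
Lemma holo_division f : holomorphic_on W f -> (forall z, W z -> z 0 i = 0 -> f z = 0) ->
  exists2 G : V -> C, holomorphic_on W G & forall z, W z -> f z = z 0 i * G z.
Proof.
move=> hf f0; have sG := avg_smooth 0 (smooth_d_z i oW (holo_smooth hf)).
exists (avg 0 (d_z i f)); last by move=> z; exact: avg_FTC.
split; first exact: sG.
move=> z k Wz; have sdb := smooth_d_zbar k oW sG.
apply: (@cont_eq0 (d_zbar k (avg 0 (d_z i f))) z) => //; last first.
  by move=> y Wy; exact: smooth_cont sdb Wy.
move=> y Wy yi.
pose U := W `&` [set y : V | y 0 i != 0].
have oU : open U.
  apply: openI; first exact: oW.
  rewrite openE => x /= x0; have := @continuous_coord R n i x.
  by move/cvgr_neq0/(_ x0).
have Uy : U y by [].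
have hq : holomorphic_on U (fun y => f y * (y 0 i)^-1).
  apply: holo_mul; [exact: oU|by apply: holo_sub hf => x []|].
  by apply: holo_inv; [exact: oU|by move=> x []|exact: holo_coord].
have E : forall x, U x -> f x * (x 0 i)^-1 = avg 0 (d_z i f) x.
  by move=> x [Wx xi]; rewrite avg_FTC // mulrC mulKf.
by have [_ H] := holo_eq oU E hq; exact: H.
Qed.

End Division.

(** * Exterior algebra *)

Section ExteriorAlgebra.
Local Open Scope set_scope.
Context {R : realType} {n : nat}.
Local Notation C := R[i].
Local Notation ext := (ext R n).
Local Notation I := 'I_(n + n).
Local Notation dis A B := (A :&: B == finset.set0).
Implicit Types (a b c : ext) (A B D S : {set I}) (i j : I).

(** As a product over pairs, the sign is visibly multiplicative in each argument under disjoint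
    unions; associativity of the wedge product comes down to this. *)
Lemma shuffle_signE A B :
  shuffle_sign A B = \prod_(i in A) \prod_(j in B) (-1) ^+ (j < i)%N :> C.
Proof.
rewrite /shuffle_sign -sum1_card pair_big /= big_mkcond /=.
rewrite [RHS]big_mkcond /=.
apply: (big_rec2 (fun (x : nat) (y : C) => (-1) ^+ x = y)); first by rewrite expr0.
move=> [i j] x y _ <- /=; rewrite inE /= exprD; congr (_ * _).
by case: (i \in A); case: (j \in B) => //=; case: (j < i)%N.
Qed.

Lemma dis_sym A B : dis A B = dis B A.
Proof. by rewrite finset.setIC. Qed.

Lemma disUl A B D : dis (A :|: B) D = dis A D && dis B D.
Proof. by rewrite finset.setIUl finset.setU_eq0. Qed.

Lemma disUr A B D : dis A (B :|: D) = dis A B && dis A D.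
Proof. by rewrite finset.setIUr finset.setU_eq0. Qed.

Lemma dis_setD A B : dis A B -> (A :|: B) :\: A = B.
Proof.
move=> /eqP AB; rewrite finset.setDUl finset.setDv finset.set0U; apply/finset.setDidPl.
by rewrite -setI_eq0 finset.setIC AB.
Qed.

Lemma big_dis (M : Monoid.com_law (1 : C)) (F : I -> C) A B : dis A B ->
  \big[M/1]_(i in A :|: B) F i = M (\big[M/1]_(i in A) F i) (\big[M/1]_(i in B) F i).
Proof.
by move=> AB; rewrite (big_setID A) /= dis_setD // (finset.setIidPr _) // finset.subsetUl.
Qed.

Lemma shuffle_signUl A B D : dis A B ->
  shuffle_sign (A :|: B) D = shuffle_sign A D * shuffle_sign B D :> C.
Proof. by move=> AB; rewrite !shuffle_signE big_dis. Qed.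

Lemma shuffle_signUr A B D : dis A B ->
  shuffle_sign D (A :|: B) = shuffle_sign D A * shuffle_sign D B :> C.
Proof.
move=> AB; rewrite !shuffle_signE -big_split; apply: eq_bigr => i _.
by rewrite big_dis.
Qed.

Lemma shuffle_sign0l A : shuffle_sign finset.set0 A = 1 :> C.
Proof. by rewrite shuffle_signE big_set0. Qed.

Lemma shuffle_sign0r A : shuffle_sign A finset.set0 = 1 :> C.
Proof. by rewrite shuffle_signE big1 // => i _; rewrite big_set0. Qed.

Lemma shuffle_sign1 i j : shuffle_sign [set i]%SET [set j]%SET = (-1) ^+ (j < i)%N :> C.
Proof. by rewrite shuffle_signE !big_set1. Qed.

Lemma shuffle_sign_neq0 A B : shuffle_sign A B != 0 :> C.
Proof. by rewrite /shuffle_sign expf_neq0 // oppr_eq0 oner_eq0. Qed.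

Definition ext_basis A : ext := [ffun S => (S == A)%:R].

Lemma ext_scaleE (z : C) a S : ext_scale z a S = z * a S.
Proof. by rewrite ffunE. Qed.

Lemma ext_sumE (T : Type) (r : seq T) (P : pred T) (F : T -> ext) S :
  (\sum_(i <- r | P i) F i) S = \sum_(i <- r | P i) F i S.
Proof.
elim: r => [|x r IH]; first by rewrite !big_nil ffunE.
by rewrite !big_cons; case: (P x); rewrite ?ffunE IH.
Qed.

Lemma ext_basis_sum a : a = \sum_S ext_scale (a S) (ext_basis S).
Proof.
apply/ffunP => S; rewrite ext_sumE (bigD1 S) //= big1 ?addr0.
  by rewrite ext_scaleE ffunE eqxx mulr1.
by move=> T TS; rewrite ext_scaleE ffunE eq_sym (negPf TS) mulr0.
Qed.

Lemma ext_wedge_suml (T : Type) (r : seq T) (P : pred T) (F : T -> ext) b :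
  ext_wedge (\sum_(i <- r | P i) F i) b = \sum_(i <- r | P i) ext_wedge (F i) b.
Proof.
apply/ffunP => S; rewrite ext_sumE ffunE.
under [RHS]eq_bigr do rewrite ffunE.
rewrite exchange_big /=; apply: eq_bigr => A _.
by rewrite ext_sumE mulr_sumr mulr_suml.
Qed.

Lemma ext_wedge_sumr (T : Type) (r : seq T) (P : pred T) (F : T -> ext) a :
  ext_wedge a (\sum_(i <- r | P i) F i) = \sum_(i <- r | P i) ext_wedge a (F i).
Proof.
apply/ffunP => S; rewrite ext_sumE ffunE.
under [RHS]eq_bigr do rewrite ffunE.
rewrite exchange_big /=; apply: eq_bigr => A _.
by rewrite ext_sumE mulr_sumr.
Qed.

Lemma ext_wedge_scalel (z : C) a b : ext_wedge (ext_scale z a) b = ext_scale z (ext_wedge a b).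
Proof.
apply/ffunP => S; rewrite !ffunE mulr_sumr; apply: eq_bigr => A _.
by rewrite ext_scaleE; ring.
Qed.

Lemma ext_wedge_scaler (z : C) a b : ext_wedge a (ext_scale z b) = ext_scale z (ext_wedge a b).
Proof.
apply/ffunP => S; rewrite !ffunE mulr_sumr; apply: eq_bigr => A _.
by rewrite ext_scaleE; ring.
Qed.

Lemma ext_scaleA (z w : C) a : ext_scale z (ext_scale w a) = ext_scale (z * w) a.
Proof. by apply/ffunP => S; rewrite !ext_scaleE mulrA. Qed.

Lemma ext_scale1 a : ext_scale 1 a = a.
Proof. by apply/ffunP => S; rewrite ext_scaleE mul1r. Qed.

Lemma ext_scale0 a : ext_scale 0 a = 0.
Proof. by apply/ffunP => S; rewrite ext_scaleE mul0r ffunE. Qed.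

Lemma ext_scaler0 (z : C) : ext_scale z (0 : ext) = 0.
Proof. by apply/ffunP => S; rewrite ext_scaleE !ffunE mulr0. Qed.

Lemma ext_wedge0l a : ext_wedge 0 a = 0.
Proof. by have := ext_wedge_suml [::] xpredT (fun _ : nat => 0) a; rewrite !big_nil. Qed.

Lemma ext_wedge0r a : ext_wedge a 0 = 0.
Proof. by have := ext_wedge_sumr [::] xpredT (fun _ : nat => 0) a; rewrite !big_nil. Qed.

Lemma ext_scale_sum (T : Type) (r : seq T) (P : pred T) (F : T -> ext) (z : C) :
  ext_scale z (\sum_(i <- r | P i) F i) = \sum_(i <- r | P i) ext_scale z (F i).
Proof.
apply/ffunP => S; rewrite ext_sumE ext_scaleE ext_sumE mulr_sumr.
by apply: eq_bigr => x _; rewrite ext_scaleE.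
Qed.

Lemma ext_wedge_basis A B : ext_wedge (ext_basis A) (ext_basis B) =
  if dis A B then ext_scale (shuffle_sign A B) (ext_basis (A :|: B)) else 0.
Proof.
apply/ffunP => S; rewrite ffunE.
have -> : (if dis A B then ext_scale (shuffle_sign A B) (ext_basis (A :|: B)) else 0) S
  = (if dis A B && (S == A :|: B) then shuffle_sign A B else 0 : C).
  by case: (dis A B) => /=; rewrite !ffunE //; case: eqP; rewrite ?mulr1 ?mulr0.
have H D : D \subset S -> D != A ->
    shuffle_sign D (S :\: D) * ext_basis A D * ext_basis B (S :\: D) = 0.
  by move=> _ DA; rewrite !ffunE (negPf DA) mulr0 mul0r.
have [AS|AS] := boolP (A \subset S); last first.
  rewrite big1; last by move=> D DS; apply: H => //; apply: contraNneq AS => <-.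
  by case: (S =P A :|: B) => [E|_]; rewrite ?andbF //; case/negP: AS; rewrite E finset.subsetUl.
rewrite (bigD1 A) //= big1 ?addr0; last by move=> D /andP[DS]; exact: H.
have E : (S :\: A == B) = dis A B && (S == A :|: B).
  apply/eqP/andP => [<-|[AB /eqP ->]]; last exact: dis_setD.
  split; last by rewrite eq_sym; apply/eqP; rewrite -[RHS](finset.setID S A) (finset.setIidPr AS).
  by apply/eqP/setP => x; rewrite !inE; case: (x \in A).
rewrite !ffunE eqxx mulr1 E; case: ifP => /andP; last by rewrite mulr0.
by case=> AB /eqP ->; rewrite mulr1 dis_setD.
Qed.

Lemma ext_one_basis : ext_one = ext_basis finset.set0.
Proof. by []. Qed.

Lemma ext_gen_basis i : ext_gen i = ext_basis [set i].
Proof. by []. Qed.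

Lemma ext_wedge_basis3 A B D :
  ext_wedge (ext_basis A) (ext_wedge (ext_basis B) (ext_basis D)) =
  ext_wedge (ext_wedge (ext_basis A) (ext_basis B)) (ext_basis D).
Proof.
rewrite !ext_wedge_basis.
have [AB|AB] := boolP (dis A B); have [BD|BD] := boolP (dis B D); rewrite ?ext_wedge0l ?ext_wedge0r //.
- rewrite ext_wedge_scalel ext_wedge_scaler !ext_wedge_basis disUl disUr AB BD andbT /=.
  case: ifP => AD; last by rewrite !ext_scaler0.
  rewrite !ext_scaleA finset.setUA shuffle_signUl // shuffle_signUr //.
  by congr (ext_scale _ _); ring.
- by rewrite ext_wedge_scalel ext_wedge_basis disUl (negPf BD) andbF ext_scaler0.
- by rewrite ext_wedge_scaler ext_wedge_basis disUr (negPf AB) ext_scaler0.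
Qed.

Lemma ext_wedgeA : associative (@ext_wedge R n).
Proof.
move=> a b c; rewrite (ext_basis_sum a) !ext_wedge_suml; apply: eq_bigr => A _.
rewrite !ext_wedge_scalel; congr (ext_scale _ _); rewrite (ext_basis_sum b).
rewrite !(ext_wedge_suml, ext_wedge_sumr); apply: eq_bigr => B _.
rewrite !(ext_wedge_scalel, ext_wedge_scaler); congr (ext_scale _ _); rewrite (ext_basis_sum c).
rewrite !ext_wedge_sumr; apply: eq_bigr => D _.
by rewrite !ext_wedge_scaler ext_wedge_basis3.
Qed.

Lemma ext_wedge1l : left_id (@ext_one R n) (@ext_wedge R n).
Proof.
move=> a; rewrite [a in LHS]ext_basis_sum [RHS]ext_basis_sum ext_wedge_sumr.
apply: eq_bigr => A _; rewrite ext_wedge_scaler ext_one_basis ext_wedge_basis.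
by rewrite finset.set0I eqxx finset.set0U shuffle_sign0l ext_scale1.
Qed.

Lemma ext_wedge1r : right_id (@ext_one R n) (@ext_wedge R n).
Proof.
move=> a; rewrite [a in LHS]ext_basis_sum [RHS]ext_basis_sum ext_wedge_suml.
apply: eq_bigr => A _; rewrite ext_wedge_scalel ext_one_basis ext_wedge_basis.
by rewrite finset.setI0 eqxx finset.setU0 shuffle_sign0r ext_scale1.
Qed.

HB.instance Definition _ := Monoid.isLaw.Build ext (@ext_one R n) (@ext_wedge R n)
  ext_wedgeA ext_wedge1l ext_wedge1r.

Definition ext_lin (u : I -> C) : ext := \sum_i ext_scale (u i) (ext_gen i).

Lemma ext_wedge_gen i j : ext_wedge (ext_gen i) (ext_gen j) =
  ext_scale (-1) (ext_wedge (ext_gen j) (ext_gen i)) :> ext.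
Proof.
rewrite !ext_gen_basis !ext_wedge_basis dis_sym.
case: ifP => [D|_]; last by apply/ffunP => S; rewrite ext_scaleE ffunE mulr0.
rewrite ext_scaleA finset.setUC !shuffle_sign1.
have ij : i != j by apply: contraTneq D => ->; rewrite finset.setIid -finset.cards_eq0 finset.cards1.
congr (ext_scale _ _); have [lt|gt|E] := ltngtP i j; last by rewrite -val_eqE /= E eqxx in ij.
  by rewrite expr0 expr1 mulrNN mulr1.
by rewrite expr0 expr1 mulr1.
Qed.

Lemma ext_wedge_lin (u v : I -> C) : ext_wedge (ext_lin u) (ext_lin v) =
  ext_scale (-1) (ext_wedge (ext_lin v) (ext_lin u)).
Proof.
rewrite /ext_lin !ext_wedge_suml ext_scale_sum.
under eq_bigr do rewrite ext_wedge_sumr.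
under [RHS]eq_bigr do rewrite ext_wedge_sumr ext_scale_sum.
rewrite exchange_big /=; apply: eq_bigr => j _; apply: eq_bigr => i _.
rewrite !(ext_wedge_scalel, ext_wedge_scaler) ext_wedge_gen !ext_scaleA.
by congr (ext_scale _ _); ring.
Qed.

Lemma ext_wedge_lin_sq (u : I -> C) : ext_wedge (ext_lin u) (ext_lin u) = 0.
Proof.
apply/ffunP => S; have /ffunP/(_ S) := ext_wedge_lin u u.
rewrite ext_scaleE mulN1r ffunE => /eqP; rewrite -addr_eq0 -mulr2n mulrn_eq0 /=.
by move/eqP => ->; rewrite ffunE.
Qed.

Lemma sorted_enum_ord (Q : {pred I}) : sorted (fun i j : I => (i < j)%N) (enum Q).
Proof.
have -> : enum Q = [seq i <- enum I | i \in Q] by rewrite [enum I]enumT.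
apply: sorted_filter; first by move=> x y z; exact: ltn_trans.
by have := iota_ltn_sorted 0 (n + n); rewrite -val_enum_ord sorted_map.
Qed.

(** The product runs through the set in increasing order and is not commutative: a new minimum is
    the leftmost factor and splits off without a sign. *)
Lemma big_ext_min (g : I -> ext) i A : (forall j, j \in A -> (i < j)%N) ->
  \big[@ext_wedge R n/ext_one]_(j in i |: A) g j =
  ext_wedge (g i) (\big[@ext_wedge R n/ext_one]_(j in A) g j).
Proof.
move=> iA; rewrite -big_filter -[in RHS]big_filter.
have fE (Q : pred I) : [seq j <- index_enum I | Q j] = enum Q.
  by rewrite [index_enum I]unlock.
rewrite !fE; have -> : enum (fun j => j \in i |: A) = i :: enum (fun j => j \in A); last by rewrite big_cons.
apply: (@irr_sorted_eq _ (fun i j : I => (i < j)%N)).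
- by move=> x y z; exact: ltn_trans.
- by move=> x; rewrite ltnn.
- exact: sorted_enum_ord.
- rewrite /= path_sortedE; last by move=> x y z; exact: ltn_trans.
  rewrite sorted_enum_ord andbT; apply/allP => j; rewrite mem_enum; exact: iA.
- by move=> j; rewrite mem_enum in_cons mem_enum; have := in_setU1 j i A.
Qed.

(** Induction adapted to [big_ext_min]: each new element is smaller than those already present. *)
Lemma set_min_ind (P : {set I} -> Prop) : P finset.set0 ->
  (forall i A, (forall j, j \in A -> (i < j)%N) -> P A -> P (i |: A)) -> forall A, P A.
Proof.
move=> P0 PS A; move: {2}(#|A|) (leqnn #|A|) => k; elim: k A => [|k IH] A Ak.
  by move: Ak; rewrite leqn0 finset.cards_eq0 => /eqP ->.
have [->//|[i0 i0A]] := finset.set_0Vmem A.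
case: (arg_minnP (fun i : I => val i) i0A) => i iA imin.
rewrite -(finset.setD1K iA); apply: PS.
  by move=> j; rewrite !inE => /andP[ji jA]; rewrite ltn_neqAle eq_sym ji imin.
apply: IH; move: Ak; have iA' : i \in A by [].
by rewrite (cardsD1 i) iA' add1n ltnS.
Qed.

Section Multiplicativity.
Variable u : I -> I -> C.
Let g i := ext_lin (u i).
Let P A := \big[@ext_wedge R n/ext_one]_(j in A) g j.

Let sign_min i A : (forall j, j \in A -> (i < j)%N) -> shuffle_sign [set i] A = 1 :> C.
Proof.
move=> iA; rewrite shuffle_signE big_set1 big1 // => j /iA ij.
by rewrite ltnNge (ltnW ij).
Qed.

Let notin_min i A : (forall j, j \in A -> (i < j)%N) -> i \notin A.
Proof. by move=> iA; apply/negP => /iA; rewrite ltnn. Qed.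

Let dis1 i A : dis [set i] A = (i \notin A).
Proof. by rewrite finset.setI_eq0 disjoints1. Qed.

(** [g i] reaches its place by anticommuting past the smaller factors, which counts the inversions
    in [shuffle_sign]; if it meets an equal factor the product is 0. *)
Lemma ext_lin_wedge_prod i A : ext_wedge (g i) (P A) =
  if i \notin A then ext_scale (shuffle_sign [set i] A) (P (i |: A)) else 0.
Proof.
elim/set_min_ind: A => [|a A aA IH].
  rewrite inE /= shuffle_sign0r ext_scale1 /P finset.setU0 big_set0 big_set1.
  by rewrite ext_wedge1r.
have [ia|ia|E] := ltngtP i a.
- have ia' j : j \in a |: A -> (i < j)%N.
    by rewrite !inE => /orP[/eqP ->//|/aA aj]; exact: ltn_trans aj.
  by rewrite notin_min // sign_min // ext_scale1 /P (big_ext_min g ia').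
- rewrite {1}/P (big_ext_min g aA) -/(P A) ext_wedgeA /g ext_wedge_lin ext_wedge_scalel -ext_wedgeA.
  rewrite -/(g i) -/(g a) IH !inE negb_or.
  have -> /= : i != a by apply: contraTneq ia => ->; rewrite ltnn.
  case: ifP => iA; last by rewrite ext_wedge0r ext_scaler0.
  rewrite ext_wedge_scaler ext_scaleA shuffle_signUr; last by rewrite dis1 notin_min.
  rewrite shuffle_sign1 ia expr1; congr (ext_scale _ _).
  have ai j : j \in i |: A -> (a < j)%N by rewrite !inE => /orP[/eqP ->//|/aA].
  by rewrite /P -(big_ext_min g ai) finset.setUCA.
- have -> : i = a by exact: val_inj.
  rewrite !inE eqxx /= {1}/P (big_ext_min g aA) ext_wedgeA /g ext_wedge_lin_sq ext_wedge0l.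
  by [].
Qed.

(** Products of arbitrary degree-one elements obey the multiplication table of the basis. This is
    why [ext_pull], defined on basis elements, respects wedge products. *)
Lemma ext_prod_wedge A B : ext_wedge (P A) (P B) =
  if dis A B then ext_scale (shuffle_sign A B) (P (A :|: B)) else 0.
Proof.
elim/set_min_ind: A => [|a A aA IH].
  by rewrite finset.set0I eqxx finset.set0U shuffle_sign0l ext_scale1 {1}/P big_set0 ext_wedge1l.
rewrite {1}/P (big_ext_min g aA) -/(P A) -ext_wedgeA IH disUl dis1 andbC.
case: ifP => AB /=; last by rewrite ext_wedge0r.
rewrite ext_wedge_scaler ext_lin_wedge_prod inE (negPf (notin_min aA)) /=.
case: ifP => aB; last by rewrite ext_scaler0.
have dA : dis [set a] A by rewrite dis1 notin_min.
rewrite ext_scaleA finset.setUA shuffle_signUl // shuffle_signUr //.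
by rewrite (sign_min aA) mul1r mulrC.
Qed.

End Multiplicativity.

Section Pullback.
Variable M : 'M[C]_n.

Lemma ext_pull_gen_lin i : exists u, ext_pull_gen M i = ext_lin u :> ext.
Proof.
rewrite /ext_pull_gen; case: (fintype.split i) => l.
  exists (fun j => if fintype.split j is inl k then M k l else 0).
  rewrite /ext_lin big_split_ord /= [X in _ + X]big1 ?addr0 => [|k _].
    by apply: eq_bigr => k _; rewrite (unsplitK (inl k)).
  by rewrite (unsplitK (inr k)) ext_scale0.
exists (fun j => if fintype.split j is inr k then (M k l)^*%C else 0).
rewrite /ext_lin big_split_ord /= [X in X + _]big1 ?add0r => [|k _].
  by apply: eq_bigr => k _; rewrite (unsplitK (inr k)).
by rewrite (unsplitK (inl k)) ext_scale0.
Qed.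

Lemma ext_pull_sum (T : Type) (r : seq T) (Q : pred T) (F : T -> ext) :
  ext_pull M (\sum_(i <- r | Q i) F i) = \sum_(i <- r | Q i) ext_pull M (F i).
Proof.
rewrite /ext_pull exchange_big /=; apply: eq_bigr => S _.
apply/ffunP => S'; rewrite ext_scaleE ext_sumE mulr_suml ext_sumE.
by apply: eq_bigr => x _; rewrite ext_scaleE.
Qed.

Lemma ext_pull_scale z a : ext_pull M (ext_scale z a) = ext_scale z (ext_pull M a).
Proof. by rewrite /ext_pull ext_scale_sum; apply: eq_bigr => S _; rewrite ext_scaleA ext_scaleE. Qed.

Lemma ext_pull_basis A : ext_pull M (ext_basis A) =
  \big[@ext_wedge R n/ext_one]_(i in A) ext_pull_gen M i.
Proof.
rewrite /ext_pull (bigD1 A) //= ffunE eqxx ext_scale1 [X in _ + X]big1 ?addr0 // => S SA.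
by rewrite ffunE (negPf SA) ext_scale0.
Qed.

Lemma ext_pull_one : ext_pull M (ext_one) = ext_one :> ext.
Proof. by rewrite ext_one_basis ext_pull_basis big_set0. Qed.

Lemma ext_pullE_gen i : ext_pull M (ext_gen i) = ext_pull_gen M i.
Proof. by rewrite ext_gen_basis ext_pull_basis big_set1. Qed.

Lemma ext_pull_wedge a b : ext_pull M (ext_wedge a b) = ext_wedge (ext_pull M a) (ext_pull M b).
Proof.
have [u uE] : exists u : I -> I -> C, forall i, ext_pull_gen M i = ext_lin (u i).
  by have /choice[u uE] := ext_pull_gen_lin; exists u.
have pE A : ext_pull M (ext_basis A) = \big[@ext_wedge R n/ext_one]_(i in A) ext_lin (u i).
  by rewrite ext_pull_basis; apply: eq_bigr => i _.
rewrite (ext_basis_sum a) (ext_basis_sum b) !(ext_wedge_suml, ext_pull_sum).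
apply: eq_bigr => A _; rewrite !(ext_wedge_sumr, ext_pull_sum).
apply: eq_bigr => B _; rewrite !(ext_wedge_scalel, ext_wedge_scaler, ext_pull_scale).
congr (ext_scale _ (ext_scale _ _)); rewrite !pE ext_prod_wedge ext_wedge_basis.
case: ifP => _; first by rewrite ext_pull_scale pE.
by have := ext_pull_sum [::] xpredT (fun _ : nat => 0); rewrite !big_nil.
Qed.

End Pullback.

End ExteriorAlgebra.

(** * Bidegree and top-degree forms *)

Section Bidegree.
Context {R : realType} {n : nat}.
Local Open Scope set_scope.
Local Notation C := R[i].
Local Notation ext := (ext R n).
Local Notation I := 'I_(n + n).
Implicit Types (a b : ext) (A B S : {set I}).

Lemma bidegree0 p q : bidegree p q (0 : ext).
Proof. by move=> S; rewrite ffunE eqxx. Qed.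

Lemma bidegree_scale p q z a : bidegree p q a -> bidegree p q (ext_scale z a).
Proof. by move=> ha S; rewrite ext_scaleE mulf_eq0 negb_or => /andP[_]; exact: ha. Qed.

Lemma bidegree_add p q a b : bidegree p q a -> bidegree p q b -> bidegree p q (a + b).
Proof.
move=> ha hb S; rewrite ffunE => ab0; have [a0|a0] := eqVneq (a S) 0; last exact: ha.
by apply: hb; apply: contraNneq ab0 => ->; rewrite a0 addr0.
Qed.

Lemma bidegree_sum p q (T : Type) (r : seq T) (P : pred T) (F : T -> ext) :
  (forall i, P i -> bidegree p q (F i)) -> bidegree p q (\sum_(i <- r | P i) F i).
Proof.
move=> hF; elim/big_rec: _ => [|i a Pi ha]; first exact: bidegree0.
by apply: bidegree_add; [exact: hF|exact: ha].
Qed.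

Lemma bidegree_basis p q A : #|[pred k : 'I_n | lshift n k \in A]| = p ->
  #|[pred k : 'I_n | rshift n k \in A]| = q -> bidegree p q (ext_basis A : ext).
Proof. by move=> hp hq S; rewrite ffunE; case: (S =P A) => [->|_] //; rewrite eqxx. Qed.

Lemma bidegree_one : bidegree 0 0 (ext_one : ext).
Proof. by rewrite ext_one_basis; apply: bidegree_basis; apply: eq_card0 => k; rewrite !inE. Qed.

Lemma bidegree_dz (f : 'I_n -> C) : bidegree 1 0 (\sum_k ext_scale (f k) (ext_dz k) : ext).
Proof.
apply: bidegree_sum => k _; apply: bidegree_scale; rewrite /ext_dz ext_gen_basis.
apply: bidegree_basis.
  by rewrite -(card1 k); apply: eq_card => j; rewrite !inE (inj_eq (@lshift_inj _ _)).
by apply: eq_card0 => j; rewrite !inE eq_rlshift.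
Qed.

Lemma bidegree_dzbar (f : 'I_n -> C) : bidegree 0 1 (\sum_k ext_scale (f k) (ext_dzbar k) : ext).
Proof.
apply: bidegree_sum => k _; apply: bidegree_scale; rewrite /ext_dzbar ext_gen_basis.
apply: bidegree_basis.
  by apply: eq_card0 => j; rewrite !inE eq_lrshift.
by rewrite -(card1 k); apply: eq_card => j; rewrite !inE (inj_eq (@rshift_inj _ _)).
Qed.

Lemma card_split (T : finType) (f : T -> I) A S : A \subset S ->
  #|[pred k | f k \in S]| = (#|[pred k | f k \in A]| + #|[pred k | f k \in S :\: A]|)%N.
Proof.
move=> AS; rewrite -(cardID [pred k | f k \in A] [pred k | f k \in S]); congr (_ + _)%N.
  apply: eq_card => k; rewrite !inE andbC; case: (boolP (f k \in A)) => //= fA.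
  by rewrite (fintype.subsetP AS).
by apply: eq_card => k; rewrite !inE.
Qed.

Lemma bidegree_wedge p q p' q' a b : bidegree p q a -> bidegree p' q' b ->
  bidegree (p + p') (q + q') (ext_wedge a b).
Proof.
move=> ha hb S; rewrite ffunE => S0.
have [A AS AS0] : exists2 A : {set I}, A \subset S & shuffle_sign A (S :\: A) * a A * b (S :\: A) != 0.
  apply/exists_inP; apply: contraNT S0; rewrite negb_exists_in => /forall_inP H.
  by rewrite big1 // => A /H; rewrite negbK => /eqP.
move: AS0; rewrite !mulf_eq0 !negb_or => /andP[/andP[_ a0] b0].
have [pA qA] := ha _ a0; have [pB qB] := hb _ b0.
by rewrite !(card_split _ AS) pA qA pB qB.
Qed.

(** There are only n generators of each kind, so the full set is the only index of bidegree (n,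
    n). *)
Lemma bidegree_top a : bidegree n n a -> a = ext_scale (a finset.setT) (ext_basis finset.setT).
Proof.
move=> ha; apply/ffunP => S; rewrite ext_scaleE ffunE.
case: eqP => [->|ST]; first by rewrite mulr1.
rewrite mulr0; apply/eqP/negPn/negP => /ha[hl hr]; case: ST; apply/setP => i.
have full (Q : pred 'I_n) k : #|Q| = n -> Q k.
  move=> Qn; have /subset_cardP/(_ (subset_predT _))/(_ k) : #|Q| = #|'I_n| by rewrite card_ord.
  by [].
rewrite inE; case: (splitP i) => k ik.
  have -> : i = lshift n k by exact: val_inj.
  exact: (full [pred k : 'I_n | lshift n k \in S]).
have -> : i = rshift n k by exact: val_inj.
exact: (full [pred k : 'I_n | rshift n k \in S]).
Qed.

Definition spans A (u : ext) := exists2 z : C, z != 0 & u = ext_scale z (ext_basis A).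

Lemma spans_wedge A B u v : A :&: B = finset.set0 -> spans A u -> spans B v ->
  spans (A :|: B) (ext_wedge u v).
Proof.
move=> /eqP AB [z z0 ->] [w w0 ->]; exists (z * (w * shuffle_sign A B)).
  by rewrite !mulf_neq0 // shuffle_sign_neq0.
by rewrite ext_wedge_scalel ext_wedge_scaler ext_wedge_basis AB !ext_scaleA mulrA.
Qed.

Definition dz_pair (k : 'I_n) : {set I} := [set lshift n k; rshift n k].

Lemma spans_pair k : spans (dz_pair k) (ext_wedge (ext_dz k) (ext_dzbar k)).
Proof.
apply: spans_wedge; last 2 first.
- by exists 1; rewrite ?oner_eq0 // ext_scale1.
- by exists 1; rewrite ?oner_eq0 // ext_scale1.
by apply/eqP; rewrite finset.setI_eq0 disjoints1 inE eq_lrshift.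
Qed.

Lemma spans_prod (T : finType) (J : {set T}) (f : T -> 'I_n) : {in J &, injective f} ->
  spans (\bigcup_(j in J) dz_pair (f j))
    (\big[@ext_wedge R n/ext_one]_(j in J) ext_wedge (ext_dz (f j)) (ext_dzbar (f j))).
Proof.
move=> finj; have := index_enum_uniq T.
elim: (index_enum T) => [|j r IH].
  by rewrite !big_nil => _; exists 1; rewrite ?oner_eq0 // ext_scale1.
rewrite /= => /andP[jr ru]; rewrite !big_cons; case: ifP => jJ; last exact: IH.
apply: spans_wedge; [|exact: spans_pair|exact: IH].
apply/eqP; rewrite -finset.subset0; apply/fintype.subsetP => x; rewrite inE => /andP[xj xr].
have [l [lr lJ xl]] : exists l, [/\ l \in r, l \in J & x \in dz_pair (f l)].
  move: xr; elim: (r) => [|l r' IHr]; first by rewrite big_nil inE.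
  rewrite big_cons; case: ifP => lJ; last first.
    by move=> /IHr[m [mr mJ xm]]; exists m; rewrite in_cons mr orbT.
  rewrite inE => /orP[xl|/IHr[m [mr mJ xm]]]; first by exists l; rewrite mem_head.
  by exists m; rewrite in_cons mr orbT.
have E : f j = f l.
  move: xj xl; rewrite !inE => /orP[]/eqP-> /orP[]/eqP.
  - exact: lshift_inj.
  - by move/eqP; rewrite eq_lrshift.
  - by move/eqP; rewrite eq_rlshift.
  - exact: rshift_inj.
by move: jr; rewrite (finj _ _ jJ lJ E) lr.
Qed.

(** The pairs over the complement of [K] and those over [J] are disjoint and exhaust the generators.
    This product is the value at [p] of the form by which the numerator of omega is divided. *)
Lemma spans_full (T : finType) (J : {set T}) (f : T -> 'I_n) (K : {set 'I_n}) :
  {in J &, injective f} -> (forall k, k \in K <-> exists2 j, j \in J & f j = k) ->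
  ext_wedge (\big[@ext_wedge R n/ext_one]_(k in ~: K) ext_wedge (ext_dz k) (ext_dzbar k))
    (\big[@ext_wedge R n/ext_one]_(j in J) ext_wedge (ext_dz (f j)) (ext_dzbar (f j)))
    finset.setT != 0.
Proof.
move=> finj fK.
have s1 := @spans_prod _ (~: K) id (fun x y _ _ => id).
have s2 := spans_prod finj.
have pairE x k : (x \in dz_pair k) = (match fintype.split x with inl l => l == k | inr l => l == k end).
  rewrite !inE; case: splitP => l xl.
    have -> : x = lshift n l by exact: val_inj.
    by rewrite eq_lrshift orbF (inj_eq (@lshift_inj _ _)).
  have -> : x = rshift n l by exact: val_inj.
  by rewrite eq_rlshift (inj_eq (@rshift_inj _ _)).
have uniqk x k l : x \in dz_pair k -> x \in dz_pair l -> k = l.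
  by rewrite !pairE; case: (fintype.split x) => m /eqP <- /eqP <-.
have [|z z0 ->] := spans_wedge _ s1 s2.
  apply/eqP; rewrite -finset.subset0; apply/fintype.subsetP => x; rewrite inE => /andP[].
  move=> /bigcupP[k kK xk] /bigcupP[j jJ xj]; move: kK; rewrite inE => /negP[].
  by apply/fK; exists j => //; exact: uniqk xj xk.
rewrite ext_scaleE ffunE mulf_neq0 //.
suff -> : finset.setT = \bigcup_(j in ~: K) dz_pair (id j) :|: \bigcup_(j in J) dz_pair (f j).
  by rewrite eqxx oner_eq0.
apply/setP => x; rewrite !inE; apply/esym/orP.
have [k xk] : exists k, x \in dz_pair k.
  by case E : (fintype.split x) => [k|k]; exists k; rewrite pairE E.
have [/fK[j jJ fj]|kK] := boolP (k \in K).
  by right; apply/bigcupP; exists j => //; rewrite fj.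
by left; apply/bigcupP; exists k => //; rewrite inE.
Qed.

End Bidegree.

(** * Functions and forms on a complex manifold *)

Section Charts.
Context {R : realType} {n : nat} {T : topologicalType}.
Local Notation C := R[i].
Implicit Types (c d : chart R n T) (W : set T) (x : T).

Lemma cimgP c W x : cdom c x -> W x -> cimg c W (cmap c x).
Proof. by move=> cx Wx; exists x. Qed.

Lemma cimg_sub c W W' : W `<=` W' -> cimg c W `<=` cimg c W'.
Proof. by move=> WW _ [x [cx Wx] <-]; exists x => //; split => //; exact: WW. Qed.

Lemma open_cimg c W : open W -> open (cimg c W).
Proof.
move=> oW; rewrite openE => _ [x [cx Wx] <-].
have n1 : nbhs (cmap c x) (cmap c @` cdom c).
  by apply: open_nbhs_nbhs; split; [exact: cimg_open|exists x].
have n2 : nbhs (cmap c x) (cinv c @^-1` W).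
  by apply: (cinv_continuous cx); rewrite cmapK //; apply: open_nbhs_nbhs.
apply: filterS2 n1 n2 => z [y cy <-] /=; rewrite cmapK // => Wy.
by exists y.
Qed.

Lemma in_chartK {A : Type} c (f : T -> A) x : cdom c x -> in_chart c f (cmap c x) = f x.
Proof. by move=> cx; rewrite /in_chart cmapK. Qed.

Lemma chart_nbhs c x (A : set 'rV[C]_n) : cdom c x -> nbhs (cmap c x) A -> nbhs x (cmap c @^-1` A).
Proof. by move=> cx; exact: (cmap_continuous cx). Qed.

Lemma row_perm_continuous (s : 'S_n) : continuous (fun z : 'rV[C]_n => (\row_k z 0 (s k)) : 'rV[C]_n).
Proof.
move=> z; apply/(@cvg_rVP R _ n (nbhs z)) => k; rewrite mxE.
under eq_fun do rewrite mxE.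
exact: continuous_coord.
Qed.

Lemma row_permK (s : 'S_n) (z : 'rV[C]_n) :
  \row_k ((\row_k z 0 (s k)) : 'rV[C]_n) 0 ((s^-1)%g k) = z.
Proof. by apply/rowP => k; rewrite !mxE permKV. Qed.

Lemma row_permKV (s : 'S_n) (z : 'rV[C]_n) :
  \row_k ((\row_k z 0 ((s^-1)%g k)) : 'rV[C]_n) 0 (s k) = z.
Proof. by apply/rowP => k; rewrite !mxE permK. Qed.

Section Subchart.
Variables (c : chart R n T) (W : set T) (oW : open W) (s : 'S_n).

Let dom := cdom c `&` W.
Let map x : 'rV[C]_n := \row_k cmap c x 0 (s k).
Let inv (z : 'rV[C]_n) : T := cinv c (\row_k z 0 ((s^-1)%g k)).

Let dom_open : open dom.
Proof. by apply: openI => //; exact: cdom_open. Qed.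

Let mapE x : \row_k map x 0 ((s^-1)%g k) = cmap c x.
Proof. exact: row_permK. Qed.

Let img_open : open (map @` dom).
Proof.
have -> : map @` dom = (fun z : 'rV[C]_n => \row_k z 0 ((s^-1)%g k)) @^-1` cimg c W.
  apply/seteqP; split => [_ [x [cx Wx] <-]|z [x [cx Wx] E]] /=.
    by rewrite mapE; exact: cimgP.
  by exists x => //; rewrite /map E row_permKV.
apply: open_comp; last exact: open_cimg.
by move=> z _; exact: row_perm_continuous.
Qed.

Let map_K x : dom x -> inv (map x) = x.
Proof. by move=> [cx _]; rewrite /inv mapE cmapK. Qed.

Let map_cont x : dom x -> {for x, continuous map}.
Proof.
move=> [cx _]; rewrite /continuous_at.
apply: (@cvg_comp _ _ _ (cmap c) (fun z : 'rV[C]_n => \row_k z 0 (s k)) (nbhs x) (nbhs (cmap c x))).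
  exact: cmap_continuous.
exact: row_perm_continuous.
Qed.

Let inv_cont x : dom x -> {for map x, continuous inv}.
Proof.
move=> [cx _]; rewrite /continuous_at.
apply: (@cvg_comp _ _ _ (fun z : 'rV[C]_n => \row_k z 0 ((s^-1)%g k)) (cinv c)
  (nbhs (map x)) (nbhs (cmap c x))).
  by rewrite -mapE; exact: row_perm_continuous.
rewrite /inv mapE; exact: cinv_continuous.
Qed.

(** Restriction shrinks a chart to where it is adapted to a given set; the permutation serves
    [regular_point], where the vanishing coordinates must come first. *)
Definition subchart : chart R n T := Chart dom_open img_open map_K map_cont inv_cont.

End Subchart.

End Charts.

Section Manifold.
Context {R : realType} {n : nat} (X : complex_manifold R n).
Local Notation C := R[i].
Implicit Types (c d : chart R n X) (W : set X) (x : X) (f g : X -> C).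

Definition trans c d (z : 'rV[C]_n) : 'rV[C]_n := cmap d (cinv c z).

Lemma trans_holo c d k : atlas c -> atlas d ->
  holomorphic_on (cimg c (cdom d)) (fun z => trans c d z 0 k).
Proof. by move=> ac ad; exact: (atlas_compatible ac ad k). Qed.

Lemma trans_in c d W z : cimg c (cdom d `&` W) z -> cimg d W (trans c d z).
Proof. by move=> [x [cx [dx Wx]] <-]; rewrite /trans cmapK //; exact: cimgP. Qed.

Lemma in_chart_trans c d f z : cimg c (cdom d) z ->
  in_chart d f (trans c d z) = in_chart c f z.
Proof. by move=> [x [cx dx] <-]; rewrite /trans /in_chart !cmapK. Qed.

Lemma smooth_change c d W f : atlas c -> atlas d -> open W ->
  smooth_on (cimg d W) (in_chart d f) -> smooth_on (cimg c (cdom d `&` W)) (in_chart c f).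
Proof.
move=> ac ad oW sf.
have o1 : open (cimg c (cdom d `&` W)).
  by apply: open_cimg; apply: openI => //; exact: cdom_open.
have o2 : open (cimg d W) by exact: open_cimg.
have dW : cdom d `&` W `<=` cdom d by move=> y [].
apply: (smooth_eq o1 (f := fun z => in_chart d f (trans c d z))).
  by move=> z /(cimg_sub dW)/in_chart_trans ->.
apply: (smooth_comp o1 o2) => // [z|l]; first exact: trans_in.
exact: smooth_sub (cimg_sub dW) (holo_smooth (trans_holo l ac ad)).
Qed.

Lemma holo_change c d W f : atlas c -> atlas d -> open W ->
  holomorphic_on (cimg d W) (in_chart d f) -> holomorphic_on (cimg c (cdom d `&` W)) (in_chart c f).
Proof.
move=> ac ad oW hf.
have o1 : open (cimg c (cdom d `&` W)).
  by apply: open_cimg; apply: openI => //; exact: cdom_open.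
have o2 : open (cimg d W) by exact: open_cimg.
have dW : cdom d `&` W `<=` cdom d by move=> y [].
apply: (holo_eq o1 (f := fun z => in_chart d f (trans c d z))).
  by move=> z /(cimg_sub dW)/in_chart_trans ->.
apply: (holo_comp o1 o2) => // [z|l]; first exact: trans_in.
exact: holo_sub (cimg_sub dW) (trans_holo l ac ad).
Qed.

Lemma smooth_fun_local W f :
  (forall x, W x -> exists d V, [/\ atlas d, cdom d x, open V, V x &
     smooth_on (cimg d V) (in_chart d f)]) -> smooth_fun W f.
Proof.
move=> H c ac; apply: smooth_loc => _ [x [cx Wx] <-].
have [d [V [ad dx oV Vx sf]]] := H x Wx.
exists (cimg c (cdom d `&` V)); first exact: cimgP.
exact: smooth_change.
Qed.

Lemma holo_fun_local W f :
  (forall x, W x -> exists d V, [/\ atlas d, cdom d x, open V, V x &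
     holomorphic_on (cimg d V) (in_chart d f)]) -> holo_fun W f.
Proof.
move=> H c ac; apply: holo_loc => _ [x [cx Wx] <-].
have [d [V [ad dx oV Vx sf]]] := H x Wx.
exists (cimg c (cdom d `&` V)); first exact: cimgP.
exact: holo_change.
Qed.

Lemma smooth_fun_cover W f :
  (forall x, W x -> exists2 V, V x & smooth_fun V f) -> smooth_fun W f.
Proof.
move=> H c ac; apply: smooth_loc => _ [x [cx Wx] <-].
have [V Vx sf] := H x Wx; exists (cimg c V); [exact: cimgP|exact: sf].
Qed.

Lemma holo_fun_cover W f :
  (forall x, W x -> exists2 V, V x & holo_fun V f) -> holo_fun W f.
Proof.
move=> H c ac; apply: holo_loc => _ [x [cx Wx] <-].
have [V Vx sf] := H x Wx; exists (cimg c V); [exact: cimgP|exact: sf].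
Qed.

Lemma smooth_fun_eq W f g : open W -> (forall x, W x -> f x = g x) ->
  smooth_fun W f -> smooth_fun W g.
Proof.
move=> oW fg sf c ac; apply: smooth_eq (sf c ac); first exact: open_cimg.
by move=> _ [x [cx Wx] <-]; rewrite !in_chartK // fg.
Qed.

Lemma holo_fun_eq W f g : open W -> (forall x, W x -> f x = g x) ->
  holo_fun W f -> holo_fun W g.
Proof.
move=> oW fg sf c ac; apply: holo_eq (sf c ac); first exact: open_cimg.
by move=> _ [x [cx Wx] <-]; rewrite !in_chartK // fg.
Qed.

Lemma smooth_fun_sub W V f : W `<=` V -> smooth_fun V f -> smooth_fun W f.
Proof. by move=> WV sf c ac; exact: smooth_sub (cimg_sub WV) (sf c ac). Qed.

Lemma holo_fun_sub W V f : W `<=` V -> holo_fun V f -> holo_fun W f.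
Proof. by move=> WV sf c ac; exact: holo_sub (cimg_sub WV) (sf c ac). Qed.

Lemma holo_fun_smooth W f : holo_fun W f -> smooth_fun W f.
Proof. by move=> hf c ac; exact: holo_smooth (hf c ac). Qed.

Lemma holo_fun_coord c k : atlas c -> holo_fun (cdom c) (coord c k).
Proof. by move=> ac d ad; exact: atlas_compatible. Qed.

Lemma smooth_fun_cst W (z : C) : smooth_fun W (fun=> z).
Proof. by move=> c ac; exact: smooth_cst. Qed.

Lemma smooth_fun_add W f g : open W -> smooth_fun W f -> smooth_fun W g ->
  smooth_fun W (fun x => f x + g x).
Proof. by move=> oW sf sg c ac; exact: smooth_add (open_cimg oW) (sf c ac) (sg c ac). Qed.

Lemma smooth_fun_mul W f g : open W -> smooth_fun W f -> smooth_fun W g ->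
  smooth_fun W (fun x => f x * g x).
Proof. by move=> oW sf sg c ac; exact: smooth_mul (open_cimg oW) (sf c ac) (sg c ac). Qed.

Lemma smooth_fun_conj W f : open W -> smooth_fun W f -> smooth_fun W (fun x => (f x)^*%C).
Proof. by move=> oW sf c ac; exact: smooth_conj (open_cimg oW) (sf c ac). Qed.

Lemma cimg_neq0 c W f : (forall x, W x -> f x != 0) -> forall z, cimg c W z -> in_chart c f z != 0.
Proof. by move=> f0 _ [x [cx Wx] <-]; rewrite in_chartK // f0. Qed.

Lemma smooth_fun_inv W f : open W -> (forall x, W x -> f x != 0) -> smooth_fun W f ->
  smooth_fun W (fun x => (f x)^-1).
Proof.
move=> oW f0 sf c ac; apply: smooth_inv (sf c ac); first exact: open_cimg.
exact: cimg_neq0.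
Qed.

Lemma holo_fun_inv W f : open W -> (forall x, W x -> f x != 0) -> holo_fun W f ->
  holo_fun W (fun x => (f x)^-1).
Proof.
move=> oW f0 sf c ac; apply: holo_inv (sf c ac); first exact: open_cimg.
exact: cimg_neq0.
Qed.

Lemma holo_fun_cst W (z : C) : holo_fun W (fun=> z).
Proof. by move=> c ac; exact: holo_cst. Qed.

Lemma holo_fun_mul W f g : open W -> holo_fun W f -> holo_fun W g ->
  holo_fun W (fun x => f x * g x).
Proof. by move=> oW sf sg c ac; exact: holo_mul (open_cimg oW) (sf c ac) (sg c ac). Qed.

Lemma holo_fun_prod (I : Type) (r : seq I) (P : pred I) (F : I -> X -> C) W : open W ->
  (forall i, P i -> holo_fun W (F i)) -> holo_fun W (fun x => \prod_(i <- r | P i) F i x).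
Proof.
move=> oW hF c ac.
exact: (holo_prod r (open_cimg oW) (fun i Pi => hF i Pi c ac)).
Qed.

Lemma smooth_fun_sum (I : Type) (r : seq I) (P : pred I) (F : I -> X -> C) W : open W ->
  (forall i, P i -> smooth_fun W (F i)) -> smooth_fun W (fun x => \sum_(i <- r | P i) F i x).
Proof.
move=> oW hF c ac.
exact: (smooth_sum r (open_cimg oW) (fun i Pi => hF i Pi c ac)).
Qed.

Lemma smooth_fun_prod (I : Type) (r : seq I) (P : pred I) (F : I -> X -> C) W : open W ->
  (forall i, P i -> smooth_fun W (F i)) -> smooth_fun W (fun x => \prod_(i <- r | P i) F i x).
Proof.
move=> oW hF c ac.
exact: (smooth_prod r (open_cimg oW) (fun i Pi => hF i Pi c ac)).
Qed.

Lemma smooth_fun_cont W f x : open W -> smooth_fun W f -> W x -> f @ x --> f x.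
Proof.
move=> oW sf Wx; have [c ac cx] := atlas_cover x.
have /cont_atP fc := smooth_cont (sf c ac) (cimgP cx Wx).
have H : in_chart c f (cmap c y) @[y --> x] --> f x.
  rewrite -[f x in X in _ --> X](in_chartK f cx).
  exact: (@cvg_comp _ _ _ (cmap c) (in_chart c f) (nbhs x) (nbhs (cmap c x))) (cmap_continuous cx) fc.
apply: cvg_trans H; apply: near_eq_cvg.
have : nbhs x (cdom c) by apply: open_nbhs_nbhs; split => //; exact: cdom_open.
by apply: filterS => y cy; rewrite in_chartK.
Qed.

Lemma d_z_transition c d W f x k : atlas c -> atlas d -> cdom c x -> cdom d x -> open W -> W x ->
  smooth_fun W f ->
  d_z k (in_chart c f) (cmap c x) =
    \sum_l transition_jacobian c d x k l * d_z l (in_chart d f) (cmap d x) /\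
  d_zbar k (in_chart c f) (cmap c x) =
    \sum_l (transition_jacobian c d x k l)^*%C * d_zbar l (in_chart d f) (cmap d x).
Proof.
move=> ac ad cx dx oW Wx sf.
set U := cimg c (cdom d `&` W).
have oU : open U by apply: open_cimg; apply: openI => //; exact: cdom_open.
have Ux : U (cmap c x) by exact: cimgP.
have dW : cdom d `&` W `<=` cdom d by move=> y [].
have hF l : holomorphic_on U (fun z => trans c d z 0 l).
  exact: holo_sub (cimg_sub dW) (trans_holo l ac ad).
have [E1 E2] := d_z_comp k (open_cimg oW) Ux (fun z => @trans_in c d W z) hF (sf d ad).
have sc : smooth_on U (fun z => in_chart d f (trans c d z)).
  apply: (smooth_comp oU (open_cimg oW) (fun z => @trans_in c d W z)) (sf d ad).
  by move=> l; exact: holo_smooth (hF l).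
have neq : \forall z \near cmap c x, in_chart d f (trans c d z) = in_chart c f z.
  have := open_nbhs_nbhs (conj oU Ux); apply: filterS => z /(cimg_sub dW).
  exact: in_chart_trans.
have [F1 F2] := d_z_eq k neq sc Ux.
have Tx : trans c d (cmap c x) = cmap d x by rewrite /trans cmapK.
by rewrite F1 F2 E1 E2 Tx; split; apply: eq_bigr => l _; rewrite mxE.
Qed.

(** The transformation rule of [d_z], applied to the coordinate functions of [c] themselves. *)
Lemma jacobian_mul c d x : atlas c -> atlas d -> cdom c x -> cdom d x ->
  transition_jacobian c d x *m transition_jacobian d c x = 1%:M.
Proof.
move=> ac ad cx dx; apply/matrixP => k m; rewrite !mxE.
have [E _] := d_z_transition k ac ad cx dx (cdom_open c) cx (holo_fun_smooth (holo_fun_coord m ac)).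
under eq_bigr do rewrite [transition_jacobian d c x _ _]mxE.
rewrite -E; set U := cimg c (cdom c).
have oU : open U by exact: open_cimg (cdom_open c).
have Ux : U (cmap c x) by exact: cimgP.
have neq : \forall z \near cmap c x, (z : 'rV[C]_n) 0 m = in_chart c (coord c m) z.
  have := open_nbhs_nbhs (conj oU Ux); apply: filterS => z [y [cy _] <-].
  by rewrite in_chartK.
have [-> _] := d_z_eq k neq (smooth_coord m oU) Ux.
by have [-> _] := d_z_coord (cmap c x) k m; rewrite eq_sym.
Qed.

Lemma ext_pull_dz (M : 'M[C]_n) l : ext_pull M (ext_dz l) = \sum_k ext_scale (M k l) (ext_dz k).
Proof. by rewrite ext_pullE_gen /ext_pull_gen (unsplitK (inl l)). Qed.

Lemma ext_pull_dzbar (M : 'M[C]_n) l :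
  ext_pull M (ext_dzbar l) = \sum_k ext_scale ((M k l)^*%C) (ext_dzbar k).
Proof. by rewrite ext_pullE_gen /ext_pull_gen (unsplitK (inr l)). Qed.

Lemma del_transition c d W f x : atlas c -> atlas d -> cdom c x -> cdom d x -> open W -> W x ->
  smooth_fun W f ->
  del f c x = ext_pull (transition_jacobian c d x) (del f d x) /\
  delbar f c x = ext_pull (transition_jacobian c d x) (delbar f d x).
Proof.
move=> ac ad cx dx oW Wx sf; rewrite /del /delbar !ext_pull_sum; split.
  under [RHS]eq_bigr do rewrite ext_pull_scale ext_pull_dz ext_scale_sum.
  rewrite exchange_big /=; apply: eq_bigr => k _.
  have [-> _] := d_z_transition k ac ad cx dx oW Wx sf.
  apply/ffunP => S; rewrite ext_scaleE ext_sumE mulr_suml; apply: eq_bigr => l _.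
  by rewrite ext_scaleA ext_scaleE; congr (_ * _); exact: mulrC.
under [RHS]eq_bigr do rewrite ext_pull_scale ext_pull_dzbar ext_scale_sum.
rewrite exchange_big /=; apply: eq_bigr => k _.
have [_ ->] := d_z_transition k ac ad cx dx oW Wx sf.
apply/ffunP => S; rewrite ext_scaleE ext_sumE mulr_suml; apply: eq_bigr => l _.
by rewrite ext_scaleA ext_scaleE; congr (_ * _); exact: mulrC.
Qed.

(** By maximality of the atlas, holomorphic transitions with every chart in both directions suffice;
    one direction is a restriction, the other a composition with a permutation of coordinates. *)
Lemma subchart_atlas c W (oW : open W) (s : 'S_n) : atlas c -> atlas (subchart c oW s).
Proof.
move=> ac; apply: atlas_maximal => d ad; split => k; last first.
  have sub : cdom (subchart c oW s) `<=` cdom c by move=> x [].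
  have -> : coord (subchart c oW s) k = coord c (s k).
    by apply/funext => x; rewrite /coord /= mxE.
  exact: holo_sub (cimg_sub sub) (atlas_compatible ad ac (s k)).
have o1 : open (cimg (subchart c oW s) (cdom d)) by exact: open_cimg (cdom_open d).
have o2 : open (cimg c (cdom d)) by exact: open_cimg (cdom_open d).
have pE x : \row_k cmap (subchart c oW s) x 0 ((s^-1)%g k) = cmap c x by exact: row_permK.
apply: (holo_comp (F := fun z => \row_k z 0 ((s^-1)%g k)) o1 o2 _ _ (atlas_compatible ac ad k)).
  by move=> _ [x [[cx Wx] dx] <-]; rewrite pE; exact: cimgP.
move=> l; under eq_fun do rewrite mxE.
exact: holo_coord.
Qed.

End Manifold.

(** * Smooth forms on a manifold *)

Section SmoothForms.
Context {R : realType} {n : nat} (X : complex_manifold R n).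
Local Notation C := R[i].
Implicit Types (c d : chart R n X) (W V : set X) (x : X) (f g : X -> C) (w : dform X).

Lemma smooth_form_sub W V p q w : W `<=` V -> smooth_form V p q w -> smooth_form W p q w.
Proof.
move=> WV [w1 w2 w3]; split.
- by move=> c d x ac ad /WV; exact: w1.
- by move=> c x ac /WV; exact: w2.
- by move=> c S ac; exact: smooth_sub (cimg_sub WV) (w3 c S ac).
Qed.

Lemma smooth_form_cover W p q w :
  (forall x, W x -> exists2 V, V x & smooth_form V p q w) -> smooth_form W p q w.
Proof.
move=> H; split.
- by move=> c d x ac ad /H[V Vx [w1 _ _]]; exact: w1.
- by move=> c x ac /H[V Vx [_ w2 _]]; exact: w2.
- move=> c S ac; apply: smooth_loc => _ [x [cx Wx] <-]; have [V Vx [_ _ w3]] := H x Wx.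
  by exists (cimg c V); [exact: cimgP|exact: w3].
Qed.

Lemma smooth_form_eq W p q w w' : open W -> (forall c x, W x -> w c x = w' c x) ->
  smooth_form W p q w -> smooth_form W p q w'.
Proof.
move=> oW E [w1 w2 w3]; split.
- by move=> c d x ac ad Wx; rewrite -!E //; exact: w1.
- by move=> c x ac Wx; rewrite -E //; exact: w2.
- move=> c S ac; apply: smooth_eq (w3 c S ac); first exact: open_cimg.
  by move=> _ [x [cx Wx] <-]; rewrite !in_chartK // E.
Qed.

Lemma smooth_form_add W p q w w' : open W -> smooth_form W p q w -> smooth_form W p q w' ->
  smooth_form W p q (fun c x => w c x + w' c x).
Proof.
move=> oW [a1 a2 a3] [b1 b2 b3]; split.
- move=> c d x ac ad Wx cx dx; rewrite (a1 c d) // (b1 c d) //.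
  have := ext_pull_sum (transition_jacobian c d x) [:: w d x; w' d x] xpredT id.
  by rewrite !big_cons !big_nil !addr0.
- by move=> c x ac Wx cx; apply: bidegree_add; [exact: a2|exact: b2].
- move=> c S ac.
  have -> : in_chart c (fun x => (w c x + w' c x) S) =
      (fun z => in_chart c (fun x => w c x S) z + in_chart c (fun x => w' c x S) z).
    by apply/funext => z; rewrite /in_chart ffunE.
  by apply: smooth_add; [exact: open_cimg|exact: a3|exact: b3].
Qed.

Lemma smooth_form0 W p q : smooth_form W p q (fun _ _ => 0 : ext R n).
Proof.
split.
- move=> c d x _ _ _ _ _; have := ext_pull_sum (transition_jacobian c d x) [::] xpredT (fun _ : nat => 0).
  by rewrite !big_nil.
- by move=> c x _ _ _; exact: bidegree0.
- move=> c S ac; have -> : in_chart c (fun _ : X => (0 : ext R n) S) = fun=> 0.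
    by apply/funext => z; rewrite /in_chart ffunE.
  exact: smooth_cst.
Qed.

Lemma smooth_form_sum (I : Type) (r : seq I) (P : pred I) (F : I -> dform X) W p q : open W ->
  (forall i, P i -> smooth_form W p q (F i)) ->
  smooth_form W p q (fun c x => \sum_(i <- r | P i) F i c x).
Proof.
move=> oW hF; elim: r => [|i r IH].
  apply: (smooth_form_eq oW _ (smooth_form0 W p q)) => c x _.
  by rewrite big_nil.
case Pi : (P i).
  apply: (smooth_form_eq oW _ (smooth_form_add oW (hF i Pi) IH)) => c x _.
  by rewrite big_cons Pi.
by apply: (smooth_form_eq oW _ IH) => c x _; rewrite big_cons Pi.
Qed.

Lemma smooth_form_scale W p q a w : open W -> smooth_fun W a -> smooth_form W p q w ->
  smooth_form W p q (fun c x => ext_scale (a x) (w c x)).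
Proof.
move=> oW sa [w1 w2 w3]; split.
- by move=> c d x ac ad Wx cx dx; rewrite ext_pull_scale -w1.
- by move=> c x ac Wx cx; apply: bidegree_scale; exact: w2.
- move=> c S ac.
  have -> : in_chart c (fun x => ext_scale (a x) (w c x) S) =
      (fun z => in_chart c a z * in_chart c (fun x => w c x S) z).
    by apply/funext => z; rewrite /in_chart ext_scaleE.
  by apply: smooth_mul; [exact: open_cimg|exact: sa|exact: w3].
Qed.

Lemma smooth_form_wedge W p q p' q' w w' : open W -> smooth_form W p q w ->
  smooth_form W p' q' w' -> smooth_form W (p + p') (q + q') (wedge w w').
Proof.
move=> oW [a1 a2 a3] [b1 b2 b3]; split.
- by move=> c d x ac ad Wx cx dx; rewrite /wedge ext_pull_wedge -a1 // -b1.
- by move=> c x ac Wx cx; apply: bidegree_wedge; [exact: a2|exact: b2].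
- move=> c S ac.
  have -> : in_chart c (fun x => wedge w w' c x S) =
      (fun z => \sum_(A : {set 'I_(n + n)} | A \subset S) shuffle_sign A (S :\: A)%SET *
         in_chart c (fun x => w c x A) z * in_chart c (fun x => w' c x (S :\: A)%SET) z).
    by apply/funext => z; rewrite /in_chart /wedge ffunE.
  apply: smooth_sum; first exact: open_cimg.
  move=> A _; apply: smooth_mul; [exact: open_cimg| |exact: b3].
  by apply: smooth_mul; [exact: open_cimg|exact: smooth_cst|exact: a3].
Qed.

Lemma smooth_form_one W : smooth_form W 0 0 (@dform_one R n X).
Proof.
split.
- by move=> c d x _ _ _ _ _; rewrite /dform_one ext_pull_one.
- by move=> c x _ _ _; exact: bidegree_one.
- move=> c S ac.
  have -> : in_chart c (fun x => @dform_one R n X c x S) = fun=> (S == finset.set0)%:R.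
    by apply/funext => z; rewrite /in_chart /dform_one ffunE.
  exact: smooth_cst.
Qed.

Lemma smooth_form_del W f : open W -> smooth_fun W f ->
  smooth_form W 1 0 (del f) /\ smooth_form W 0 1 (delbar f).
Proof.
move=> oW sf; split; split.
- by move=> c d x ac ad Wx cx dx; have [] := del_transition ac ad cx dx oW Wx sf.
- by move=> c x _ _ _; exact: bidegree_dz.
- move=> c S ac; have oi := @open_cimg R n X c W oW.
  apply: (@smooth_eq _ _ _ (fun z => \sum_k d_z k (in_chart c f) z * ext_dz k S) _ oi).
    move=> _ [x [cx Wx] <-]; rewrite in_chartK // ext_sumE.
    by apply: eq_bigr => k _; rewrite ext_scaleE.
  apply: smooth_sum => // k _; apply: smooth_mul => //; last exact: smooth_cst.
  by apply: smooth_d_z => //; exact: sf.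
- by move=> c d x ac ad Wx cx dx; have [] := del_transition ac ad cx dx oW Wx sf.
- by move=> c x _ _ _; exact: bidegree_dzbar.
- move=> c S ac; have oi := @open_cimg R n X c W oW.
  apply: (@smooth_eq _ _ _ (fun z => \sum_k d_zbar k (in_chart c f) z * ext_dzbar k S) _ oi).
    move=> _ [x [cx Wx] <-]; rewrite in_chartK // ext_sumE.
    by apply: eq_bigr => k _; rewrite ext_scaleE.
  apply: smooth_sum => // k _; apply: smooth_mul => //; last exact: smooth_cst.
  by apply: smooth_d_zbar => //; exact: sf.
Qed.

Lemma dform_prodE (T : finType) (P : pred T) (F : T -> dform X) c x :
  (\big[@wedge R n X/@dform_one R n X]_(j | P j) F j) c x =
  \big[@ext_wedge R n/ext_one]_(j | P j) F j c x.
Proof. by rewrite (big_morph (fun w : dform X => w c x) (id1 := ext_one) (op1 := @ext_wedge R n)). Qed.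

Lemma smooth_form_prod (T : finType) (J : {set T}) (F : T -> dform X) W : open W ->
  (forall j, j \in J -> smooth_form W 1 1 (F j)) ->
  smooth_form W #|J| #|J| (\big[@wedge R n X/@dform_one R n X]_(j in J) F j).
Proof.
move=> oW hF; rewrite -sum1_card.
elim: (index_enum T) => [|j r IH]; first by rewrite !big_nil; exact: smooth_form_one.
rewrite !big_cons; case: ifP => jJ //.
by apply: smooth_form_wedge => //; exact: hF.
Qed.

End SmoothForms.

(** * Smooth partitions of unity *)

Section PartitionOfUnity.
Context {R : realType} {n : nat} (X : complex_manifold R n).
Local Notation C := R[i].
Implicit Types (c d : chart R n X) (U W V : set X) (x : X).

(** Since [X] is Hausdorff, the compact set [S] is closed, so the bump of a chart, extended by 0, is
    smooth on all of [X]. *)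
Lemma bump_at W x : open W -> W x -> exists (b : X -> R) (S : set X),
  [/\ smooth_fun setT (fun y => (b y)%:C), closed S /\ S `<=` W,
      forall y, 0 <= b y <= 1, forall y, ~ S y -> b y = 0 & \forall y \near x, b y = 1].
Proof.
move=> oW Wx; have [c ac cx] := atlas_cover x.
set z0 := cmap c x.
have /nbhs_polydisc[r r0 rP] : nbhs z0 (cimg c W).
  by apply: open_nbhs_nbhs; split; [exact: open_cimg|exact: cimgP].
(* Half the radius, so that the closed polydisc [K] still lies in the image of [W]. *)
have r20 : 0 < r / 2 by rewrite divr_gt0.
have [chi [s [schi s0 chi01 chi1 chiS]]] := bump_exists z0 r20.
pose K := [set z : 'rV[C]_n | forall k, `|z 0 k - z0 0 k| <= (r / 2)%:C].
have KW z : K z -> cimg c W z.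
  move=> Kz; apply: rP => k; apply: le_lt_trans (Kz k) _.
  by rewrite ltcR ltr_pdivrMr // mulr_natr mulr2n ltrDl.
pose S := cinv c @` K.
pose b y := if pselect (cdom c y) then chi (cmap c y) else 0.
have bS y : ~ S y -> b y = 0.
  move=> nS; rewrite /b; case: pselect => // cy; apply/eqP/negPn/negP => b0; apply: nS.
  by exists (cmap c y); [exact: chiS|exact: cmapK].
have cS : closed S.
  apply: compact_closed; first exact: manifold_hausdorff.
  apply: continuous_compact; last exact: compact_polydisc.
  apply: continuous_in_subspaceT => z; rewrite inE => /KW[y [cy _] <-].
  exact: cinv_continuous.
exists b, S; split.
- apply: smooth_fun_cover => y _; have [cy|ncy] := pselect (cdom c y).
    exists (cdom c) => //; apply: smooth_fun_local => y' cy'; exists c, (cdom c); split => //.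
      exact: cdom_open.
    apply: (@smooth_eq _ _ _ (fun z => (chi z)%:C)); first exact: open_cimg (cdom_open c).
      by move=> _ [u [cu _] <-]; rewrite in_chartK // /b; case: pselect.
    exact: smooth_sub schi.
  exists (~` S); first by move=> [z /KW[u [cu _] <-] E]; apply: ncy; rewrite -E cmapK.
  apply: (@smooth_fun_eq _ _ _ _ (fun=> 0)); [exact: closed_openC| |exact: smooth_fun_cst].
  by move=> u /bS ->.
- by split=> // _ [z /KW[u [cu Wu] <-] <-]; rewrite cmapK.
- move=> y; rewrite /b; case: (pselect (cdom c y)) => cy; first exact: chi01.
  by rewrite lexx ler01.
- exact: bS.
- have n1 : nbhs x (cmap c @^-1` polydisc z0 s).
    apply: chart_nbhs => //; apply: open_nbhs_nbhs; split; first exact: open_polydisc.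
    exact: polydisc_center.
  have n2 : nbhs x (cdom c) by apply: open_nbhs_nbhs; split => //; exact: cdom_open.
  apply: filterS2 n1 n2 => y ys cy; rewrite /b; case: (pselect (cdom c y)) => // cy'.
  exact: chi1.
Qed.

(** The part of [U] in [W], where both factors are smooth, and the complement of [S], where the
    product is 0, are open and cover [U]. *)
Lemma smooth_fun_ext U W S (a f : X -> C) : open U -> open W -> closed S -> S `<=` W ->
  (forall y, ~ S y -> a y = 0) -> smooth_fun setT a -> smooth_fun (U `&` W) f ->
  smooth_fun U (fun y => a y * f y).
Proof.
move=> oU oW cS SW a0 sa sf; apply: smooth_fun_cover => y Uy.
have [Sy|nSy] := pselect (S y).
  exists (U `&` W); first by split => //; exact: SW.
  by apply: smooth_fun_mul => //; [exact: openI|exact: smooth_fun_sub sa].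
exists (~` S) => //.
apply: (@smooth_fun_eq _ _ _ _ (fun=> 0)); [exact: closed_openC| |exact: smooth_fun_cst].
by move=> u /a0 ->; rewrite mul0r.
Qed.

Lemma smooth_form_ext W S p q (a : X -> C) (w : dform X) : open W -> closed S -> S `<=` W ->
  (forall y, ~ S y -> a y = 0) -> smooth_fun setT a -> smooth_form W p q w ->
  smooth_form setT p q (fun c y => ext_scale (a y) (w c y)).
Proof.
move=> oW cS SW a0 sa sw; apply: smooth_form_cover => y _.
have [Sy|nSy] := pselect (S y).
  exists W; first exact: SW.
  by apply: smooth_form_scale => //; exact: smooth_fun_sub sa.
exists (~` S) => //.
have cE c u : (~` S) u -> (0 : ext R n) = ext_scale (a u) (w c u).
  by move=> /a0 ->; rewrite ext_scale0.
apply: (smooth_form_eq (w := fun _ _ => 0)); [exact: closed_openC|exact: cE|exact: smooth_form0].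
Qed.

(** By second countability there are countably many bumps [b_k], the sets where they
    are locally equal to 1 covering [X]; [b_k * \prod_(i < k) (1 - b_i)] vanishes near
    [x] as soon as [b_i = 1] near [x] for some [i < k]. *)
Lemma partition_of_unity (W_ : X -> set X) (x0 : X) :
  (forall x, open (W_ x)) -> (forall x, W_ x x) ->
  exists (p : nat -> X) (psi : nat -> X -> R) (S : nat -> set X) (M : X -> nat),
    [/\ forall k, smooth_fun setT (fun y => (psi k y)%:C) /\ forall y, 0 <= psi k y,
        forall k, closed (S k) /\ S k `<=` W_ (p k),
        forall k y, ~ S k y -> psi k y = 0,
        forall x, \sum_(k < M x) psi k x = 1 &
        forall x, exists V : set X, [/\ open V, V x &
          forall y (G : zmodType) (F : nat -> G), V y -> (forall k, psi k y = 0 -> F k = 0) ->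
            \sum_(k < M y) F k = \sum_(k < M x) F k]].
Proof.
move=> oW Wx.
have /choice[b /choice[S0 bP]] : forall x, exists (b : X -> R) (S : set X),
    [/\ smooth_fun setT (fun y => (b y)%:C), closed S /\ S `<=` W_ x,
      forall y, 0 <= b y <= 1, forall y, ~ S y -> b y = 0 & \forall y \near x, b y = 1].
  by move=> x; exact: bump_at.
have [B /countable_injP[f finj] [Bo Bb]] := @manifold_second_countable R n X.
(* [f] numbers the base of the topology. [p k] is a point whose bump is 1 on the base set of number
   [k] if such a point exists, and [x0] otherwise; an extra bump does no harm to the telescoping
   product. *)
pose good k x := exists U, [/\ B U, U x, f U = k & U `<=` [set y | b x y = 1]].
pose p k := xget x0 (good k).
have pP x : exists U k, [/\ open U, U x & U `<=` [set y | b (p k) y = 1]].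
  have [_ _ _ _ bx] := bP x.
  have [U [BU Ux] Ub] := Bb x _ bx.
  have [U' [BU' _ fU' U'b]] : good (f U) (p (f U)) by apply: (@xgetPex _ x0); exists x, U.
  exists U, (f U); split => //; first exact: Bo.
  have EU : U' = U := finj _ _ (mem_set BU') (mem_set BU) fU'.
  by rewrite -[X in X `<=` _]EU.
pose psi k y := b (p k) y * \prod_(i < k) (1 - b (p i) y).
have sb k : smooth_fun setT (fun y => (b (p k) y)%:C) by have [] := bP (p k).
have b01 k y : 0 <= b (p k) y <= 1 by have [_ _ + _ _] := bP (p k); exact.
have /choice[M /choice[V VP]] : forall x, exists (M : nat) (V : set X), [/\ open V, V x &
    forall y, V y -> (forall m, (M <= m)%N -> psi m y = 0) /\ \sum_(m < M) psi m y = 1].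
  move=> x; have [U [k [oU Ux Uk]]] := pP x; exists k.+1, U; split => // y /Uk /= bk.
  have z m : (k < m)%N -> \prod_(i < m) (1 - b (p i) y) = 0.
    by move=> km; rewrite (bigD1 (Ordinal km)) //= bk subrr mul0r.
  split; first by move=> m km; rewrite /psi z // mulr0.
  have tele m : \sum_(i < m) psi i y = 1 - \prod_(i < m) (1 - b (p i) y).
    elim: m => [|m IH]; first by rewrite !big_ord0 subrr.
    by rewrite !big_ord_recr /= IH /psi; move: (\prod_(i < m) _) => P; ring.
  by rewrite tele z // subr0.
(* The numbers of terms [M y] and [M x] may differ, but all terms beyond either of them vanish at
   [y]. *)
have stable (G : zmodType) N N' (F : nat -> G) : (forall m, (N <= m)%N -> F m = 0) ->
    (forall m, (N' <= m)%N -> F m = 0) -> \sum_(k < N) F k = \sum_(k < N') F k.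
  wlog NN' : N N' / (N <= N')%N => [H h h'|h _].
    by have [/H|/ltnW/H] := leqP N N'; [exact|move=> H1; apply/esym/H1].
  rewrite -(subnKC NN') big_split_ord /= [X in _ = _ + X]big1 ?addr0 // => k _.
  by rewrite h // leq_addr.
exists p, psi, (fun k => S0 (p k)), M; split.
- move=> k; split; last first.
    move=> y; have /andP[bk _] := b01 k y; apply: mulr_ge0 => //.
    by apply: prodr_ge0 => i _; rewrite subr_ge0; have /andP[] := b01 i y.
  have -> : (fun y => (psi k y)%:C) =
      (fun y => (b (p k) y)%:C * \prod_(i < k) (1 + (-1) * (b (p i) y)%:C)).
    apply/funext => y; rewrite rmorphM rmorph_prod; congr (_ * _).
    by apply: eq_bigr => i _; rewrite rmorphB rmorph1 mulN1r.
  apply: smooth_fun_mul; [exact: openT|exact: sb|].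
  apply: smooth_fun_prod; first exact: openT.
  move=> i _; apply: smooth_fun_add; [exact: openT|exact: smooth_fun_cst|].
  by apply: smooth_fun_mul; [exact: openT|exact: smooth_fun_cst|exact: sb].
- by move=> k; have [] := bP (p k).
- by move=> k y nS; rewrite /psi; have [_ _ _ -> //] := bP (p k); rewrite mul0r.
- by move=> x; have [_ xx /(_ x xx)[]] := VP x.
- move=> x; have [oV Vx Vs] := VP x; exists (V x); split => // y G F xy F0.
  have [_ yy /(_ y yy)[z1 _]] := VP y; have [z2 _] := Vs y xy.
  by apply: stable => k kM; apply: F0; [exact: z1|exact: z2].
Qed.

End PartitionOfUnity.

(** * Branches of a normal crossings divisor *)

Section Connected.
Context {R : realType} {n : nat}.
Local Notation C := R[i].
Local Notation V := 'rV[C]_n.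
Implicit Types (a u v w : V) (r : R).

Lemma real_complex_neq0 (t : R) : (t%:C != 0 :> C) = (t != 0).
Proof. by rewrite eq_complex /= eqxx andbT. Qed.

Definition segment u v : set V := (fun t : R => u + t%:C *: (v - u)) @` `[0, 1]%classic.

Lemma segment_endpoints u v : segment u v u /\ segment u v v.
Proof.
split; [exists 0|exists 1].
- by rewrite /= in_itv /= lexx ler01.
- by rewrite scale0r addr0.
- by rewrite /= in_itv /= lexx ler01.
- by rewrite scale1r addrC subrK.
Qed.

Lemma connected_seg u v : connected (segment u v).
Proof.
apply: connected_continuous_connected; first exact: segment_connected.
by apply: continuous_subspaceT; exact: line_continuous.
Qed.

Lemma connected_by_segments (A : set V) :
  (forall u v, A u -> A v -> exists w, segment u w `<=` A /\ segment w v `<=` A) -> connected A.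
Proof.
move=> H; have [->|/set0P[u Au]] := eqVneq A set0; first exact: connected0.
have AE : A = \bigcup_(B in [set B | [/\ B u, B `<=` A & connected B]]) B.
  apply/seteqP; split => [v Av|v [B [_ BA _] /BA //]].
  have [w [uw wv]] := H u v Au Av; exists (segment u w `|` segment w v).
    split; first by left; have [] := segment_endpoints u w.
      by rewrite subUset.
    apply: connectedU; [|exact: connected_seg|exact: connected_seg].
    by exists w; have [_ ?] := segment_endpoints u w; have [? _] := segment_endpoints w v.
  by right; have [] := segment_endpoints w v.
by rewrite AE; apply: bigcup_connected; [exists u => B []|move=> B []].
Qed.

Lemma norm_convex (x y : C) r (t : R) : 0 <= t <= 1 -> `|x| < r%:C -> `|y| < r%:C ->
  `|x + t%:C * (y - x)| < r%:C.
Proof.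
move=> /andP[t0 t1] xr yr.
have -> : x + t%:C * (y - x) = (1 - t)%:C * x + t%:C * y.
  by rewrite rmorphB rmorph1; ring.
apply: le_lt_trans (ler_normD _ _) _.
rewrite !normrM !norm_real_complex (ger0_norm t0) (@ger0_norm R (1 - t)) ?subr_ge0 //.
have [t00|tn0] := eqVneq t 0; first by rewrite t00 subr0 (_ : 1%:C = 1 :> C) // mul1r (_ : 0%:C = 0 :> C) // mul0r addr0.
have tp : 0 < t by rewrite lt_neqAle eq_sym tn0.
have -> : r%:C = (1 - t)%:C * r%:C + t%:C * r%:C.
  by rewrite rmorphB rmorph1; ring.
apply: ler_ltD.
  by apply: ler_wpM2l (ltW xr); rewrite lecR subr_ge0.
by rewrite ltr_pM2l // ltcR.
Qed.

(** If the segment met 0 at the parameter t, then y = - ((1 - t) / t) x. *)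
Lemma convex_neq0 (x y : C) (t : R) : 0 <= t <= 1 -> x != 0 -> y != 0 ->
  (forall l : R, 0 < l -> y <> - (l%:C * x)) -> x + t%:C * (y - x) != 0.
Proof.
move=> /andP[t0 t1] x0 y0 H; apply/eqP => E.
have tn0 : t != 0.
  by apply: contraNN x0 => /eqP t00; rewrite -E t00 rmorph0 mul0r addr0.
have tn1 : t != 1.
  by apply: contraNN y0 => /eqP t11; rewrite -E t11 rmorph1 mul1r addrC subrK.
have tC : t%:C != 0 :> C by rewrite real_complex_neq0.
apply: (H ((1 - t) / t)).
  rewrite divr_gt0 //; first by rewrite subr_gt0 lt_neqAle tn1.
  by rewrite lt_neqAle eq_sym tn0.
apply: (mulfI tC); rewrite rmorphM fmorphV rmorphB rmorph1.
apply/eqP; rewrite -subr_eq0 -E; apply/eqP.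
by field.
Qed.

(** Two segments suffice: when [v 0 k / u 0 k] is a negative number, the segment
    from [u 0 k] to [v 0 k] passes through 0 and one goes through ['i * u 0 k]. *)
Lemma connected_punctured a r i (P : pred 'I_n) :
  (forall k, P k -> a 0 k != 0 -> r%:C <= `|a 0 k|) ->
  connected [set z | [/\ polydisc a r z, z 0 i = 0 & forall k, P k -> z 0 k != 0]].
Proof.
move=> ra; apply: connected_by_segments => u v [pu ui u0] [pv vi v0].
have a0 z k : P k -> a 0 k != 0 -> polydisc a r z -> z 0 k != 0.
  move=> Pk ak pz; apply/eqP => zk; have := lt_le_trans (pz k) (ra k Pk ak).
  by rewrite zk sub0r normrN ltxx.
pose neg k := `[< exists2 l : R, 0 < l & v 0 k = - (l%:C * u 0 k) >].
(* Multiplication by 'i preserves the modulus, so [w] stays in the polydisc where its centre has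
   coordinate 0. Where [a 0 k != 0], the coordinate cannot vanish in the polydisc and needs no
   detour. *)
pose w : V := \row_k (if neg k && (a 0 k == 0) then 'i%C * u 0 k else u 0 k).
have iN (l : R) (x : C) : x != 0 -> 'i%C * x <> - (l%:C * x).
  move=> x0 /eqP; rewrite -subr_eq0 opprK -mulrDl mulf_eq0 (negPf x0) orbF.
  by rewrite eq_complex /= add0r addr0 oner_eq0 andbF.
have n1 : `|'i%C| = 1 :> C by rewrite normc_def /= expr0n expr1n add0r sqrtr1.
have pw : polydisc a r w.
  move=> k; rewrite mxE; case: ifP => [/andP[_ /eqP ak]|_]; last exact: pu.
  by rewrite ak subr0 normrM n1 mul1r; have := pu k; rewrite ak subr0.
have seg (z z' : V) : polydisc a r z -> polydisc a r z' -> z 0 i = 0 -> z' 0 i = 0 ->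
    (forall k, P k -> a 0 k = 0 -> z 0 k != 0 /\ z' 0 k != 0 /\
       forall l : R, 0 < l -> z' 0 k <> - (l%:C * z 0 k)) ->
    segment z z' `<=` [set z | [/\ polydisc a r z, z 0 i = 0 & forall k, P k -> z 0 k != 0]].
  move=> pz pz' zi z'i H _ [t t01 <-]; rewrite /= in_itv /= in t01.
  have pt : polydisc a r (z + t%:C *: (z' - z)).
    move=> k; rewrite !mxE.
    have -> : z 0 k + t%:C * (z' 0 k - z 0 k) - a 0 k =
      (z 0 k - a 0 k) + t%:C * ((z' 0 k - a 0 k) - (z 0 k - a 0 k)) by ring.
    by apply: norm_convex.
  split => //; first by rewrite !mxE zi z'i subrr mulr0 addr0.
  move=> k Pk; have [ak|ak] := eqVneq (a 0 k) 0; last exact: a0 Pk ak pt.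
  by rewrite !mxE; have [z0 [z'0 Hl]] := H k Pk ak; apply: convex_neq0.
have wi : w 0 i = 0 by rewrite mxE ui mulr0; case: ifP.
exists w; split; apply: seg => // k Pk ak.
- split; first exact: u0.
  rewrite mxE ak eqxx andbT; have uk := u0 k Pk.
  case: ifP => _.
    split; last by move=> l _; exact: iN.
    by rewrite mulf_neq0 // -normr_eq0 n1 oner_eq0.
  split => // l l0 /eqP; rewrite -subr_eq0 opprK -{1}[u 0 k]mul1r -mulrDl mulf_eq0 (negPf uk) orbF.
  by rewrite -(rmorph1 (real_complex R)) -rmorphD -[_ == _]negbK real_complex_neq0 gt_eqF // addr_gt0.
- rewrite mxE ak eqxx andbT; have uk := u0 k Pk; case: ifPn => [/asboolP[l0 l00 vE]|/asboolPn nk].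
    split; first by rewrite mulf_neq0 // -normr_eq0 n1 oner_eq0.
    split; first exact: v0.
    move=> l l1; rewrite vE => E.
    apply: (iN (- (l0 / l)) (u 0 k) uk).
    have lC : l%:C != 0 :> C by rewrite real_complex_neq0 gt_eqF.
    apply: (mulfI lC); apply: oppr_inj.
    have -> : l%:C * ('i%C * u 0 k) = l0%:C * u 0 k.
      by apply: oppr_inj; rewrite E; ring.
    by rewrite rmorphN rmorphM fmorphV; field.
  split => //; split; first exact: v0.
  by move=> l l1 E; apply: nk; exists l.
Qed.

End Connected.

(** * Crossings of coordinate hyperplanes *)

Section NCBranches.
Context {R : realType} {n : nat} (X : complex_manifold R n).
Local Notation C := R[i].
Implicit Types (c d : chart R n X) (W U : set X) (x y p : X).

(** Every [k] differs from [i] or from [j], so the directions of the k-th coordinate lie in one of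
    the two hyperplanes, along which [f] is 0. *)
Lemma d_z_crossing (f : 'rV[C]_n -> C) (z : 'rV[C]_n) (i j k : 'I_n) :
  i != j -> z 0 i = 0 -> z 0 j = 0 ->
  nbhs z [set y : 'rV[C]_n | y 0 i = 0 \/ y 0 j = 0 -> f y = 0] -> d_z k f z = 0.
Proof.
move=> ij zi zj fz.
have key (v : 'rV[C]_n) : (v 0 i = 0 \/ v 0 j = 0) -> rderive v f z = 0.
  move=> vij; have := line_near v fz => H.
  have : rd v f z 0.
    apply/rdP; apply: (@cderiv_eq _ (fun=> 0)); last exact: cderiv_cst.
    by apply: filterS H => t /= ->//; rewrite !mxE zi zj !add0r; case: vij => ->; rewrite mulr0; [left|right].
  by move=> /rd_rderive[].
have kij : (k != i) \/ (k != j).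
  by have [->|] := eqVneq k i; [right|left].
have e l : k != l -> (delta_mx 0 k : 'rV[C]_n) 0 l = 0.
  by move=> kl; rewrite mxE eqxx /= eq_sym (negPf kl).
rewrite /d_z !key ?mulr0 ?subrr ?mulr0 //.
- by rewrite /dir_y !mxE; case: kij => /e; rewrite mxE => ->; rewrite mulr0; [left|right].
- by rewrite /dir_x; case: kij => /e ->; [left|right].
Qed.

Lemma cinv_nbhs c x W : cdom c x -> nbhs x W -> nbhs (cmap c x) (cinv c @^-1` W).
Proof. by move=> cx Wx; apply: (cinv_continuous cx); rewrite cmapK. Qed.

(** Otherwise a column of an invertible Jacobian would be 0. This distinguishes regular points from
    crossings, and later prevents a component with smooth closure from having two branches at a
    point. *)
Lemma chart_crossing c d x (i j l : 'I_n) : atlas c -> atlas d -> cdom c x -> cdom d x ->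
  i != j -> coord c i x = 0 -> coord c j x = 0 ->
  ~ nbhs x [set y | coord c i y = 0 \/ coord c j y = 0 -> coord d l y = 0].
Proof.
move=> ac ad cx dx ij xi xj H.
have col0 k : d_z k (in_chart c (coord d l)) (cmap c x) = 0.
  apply: (@d_z_crossing _ _ i j) => //.
  have H1 := cinv_nbhs cx H.
  have H2 : nbhs (cmap c x) (cimg c setT).
    by apply: open_nbhs_nbhs; split; [exact: open_cimg openT|exact: cimgP].
  apply: filterS2 H1 H2 => z H1 [y [cy _] zy]; move: H1; rewrite -zy /= cmapK // /in_chart cmapK //.
have := jacobian_mul ac ad cx dx => /mulmx1C /(congr1 (fun M : 'M[C]_n => M l l)).
rewrite !mxE eqxx big1 => [/eqP|k _]; first by rewrite eq_sym oner_eq0.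
by rewrite [X in _ * X]mxE col0 mulr0.
Qed.

(** Moves a point off several coordinate hyperplanes at once; complements of branches are shown to
    be dense in this way. *)
Lemma chart_perturb c x (P : pred 'I_n) W : atlas c -> cdom c x -> nbhs x W ->
  exists y t, [/\ W y, cdom c y, t != 0 :> C &
    forall k, coord c k y = coord c k x + (if P k then t else 0)].
Proof.
move=> ac cx Wx.
pose v : 'rV[C]_n := \row_k (P k)%:R.
have n1 := cinv_nbhs cx Wx.
have n2 : nbhs (cmap c x) (cimg c setT).
  by apply: open_nbhs_nbhs; split; [exact: open_cimg openT|exact: cimgP].
have n3 : nbhs (cmap c x) (cinv c @^-1` W `&` cimg c setT) by exact: filterI.
have /nbhs_ballP[e /= e0 he] := line_near v n3.
have e20 : 0 < e / 2 by rewrite divr_gt0.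
have [/= h1 [y [cy _] yE]] : (cinv c @^-1` W `&` cimg c setT) (cmap c x + (e / 2)%:C *: v).
  apply: he; rewrite /ball /= sub0r normrN gtr0_norm // ltr_pdivrMr // mulr_natr mulr2n ltrDl //.
exists y, (e / 2)%:C; split => //.
- by move: h1; rewrite -yE cmapK.
- by rewrite real_complex_neq0 gt_eqF.
- by move=> k; rewrite /coord yE !mxE; case: (P k); rewrite ?mulr1 ?mulr0.
Qed.

Lemma prod_eq0P kappa (F : 'I_n -> C) :
  \prod_(k < n | (k < kappa)%N) F k = 0 <-> exists2 k : 'I_n, (k < kappa)%N & F k = 0.
Proof.
split => [/eqP/prodf_eq0[k kk /eqP]|[k kk Fk]]; first by exists k.
by apply/eqP/prodf_eq0; exists k => //; apply/eqP.
Qed.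

Lemma coord_cont c k x : cdom c x -> coord c k @ x --> coord c k x.
Proof.
move=> cx; apply: (@cvg_comp _ _ _ (cmap c) (fun z => z 0 k) (nbhs x) (nbhs (cmap c x))).
  exact: cmap_continuous.
exact: continuous_coord.
Qed.

Lemma coord_neq0_near c k x : cdom c x -> coord c k x != 0 ->
  nbhs x [set y | coord c k y != 0].
Proof.
move=> cx xk; apply: (@coord_cont c k x cx [set z | z != 0]).
have := @cvg_id _ (nbhs (coord c k x)) => /cvgr_neq0; exact.
Qed.

End NCBranches.

(** * Regular locus and irreducible components *)

Section Branches.
Context {R : realType} {n : nat} (X : complex_manifold R n).
Local Notation C := R[i].
Implicit Types (c d : chart R n X) (W U : set X) (x y p : X).
Variables (D : set X) (Dnc : normal_crossings D).

Definition reg : set X := [set x | exists c i, [/\ atlas c, cdom c x, coord c i x = 0 &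
  forall y, cdom c y -> (D y <-> coord c i y = 0)]].

Lemma nc_zero c kappa x : nc_chart D c kappa -> cdom c x ->
  (D x <-> exists2 k : 'I_n, (k < kappa)%N & coord c k x = 0).
Proof. by move=> [_ _ H] cx; rewrite (H x cx) prod_eq0P. Qed.

Lemma reg_sub : reg `<=` D.
Proof. by move=> x [c [i [_ cx ci H]]]; apply/H. Qed.

(** With two vanishing coordinates, a chart in which D is one hyperplane would contradict
    [chart_crossing]. Conversely, removing the other branches from the domain of [c] leaves such a
    chart. *)
Lemma reg_nc c kappa x : nc_chart D c kappa -> cdom c x ->
  (reg x <-> exists2 i : 'I_n, (i < kappa)%N /\ coord c i x = 0 &
     forall k : 'I_n, (k < kappa)%N -> k != i -> coord c k x != 0).
Proof.
move=> Dc cx; have [ac _ _] := Dc; split => [rx|[i [ik xi] xk]].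
  have [i ik xi] := (nc_zero Dc cx).1 (reg_sub rx).
  exists i => // k kk ki; apply/eqP => xk.
  have [d [l [ad dx dl H]]] := rx.
  apply: (@chart_crossing _ _ _ c d x i k l) => //; first by rewrite eq_sym.
  have n1 : nbhs x (cdom c) by apply: open_nbhs_nbhs; split => //; exact: cdom_open.
  have n2 : nbhs x (cdom d) by apply: open_nbhs_nbhs; split => //; exact: cdom_open.
  apply: filterS2 n1 n2 => y cy dy yik; apply/(H y dy)/(nc_zero Dc cy).
  by case: yik; [exists i|exists k].
pose W := [set y | cdom c y /\ forall k : 'I_n, (k < kappa)%N -> k != i -> coord c k y != 0].
have oW : open W.
  rewrite openE => y [cy yk].
  have n1 : nbhs y (cdom c) by apply: open_nbhs_nbhs; split => //; exact: cdom_open.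
  have n2 : \forall z \near y, forall k : 'I_n, (k < kappa)%N -> k != i -> coord c k z != 0.
    apply: filter_forall => k; have [kk|kk] := boolP ((k < kappa)%N && (k != i)); last first.
      by apply: nearW => z k1 k2; rewrite k1 k2 in kk.
    have /andP[k1 k2] := kk.
    by apply: filterS (coord_neq0_near cy (yk k k1 k2)).
  by apply: filterS2 n1 n2.
exists (subchart c oW 1%g), i.
have cE y : coord (subchart c oW 1%g) i y = coord c i y by rewrite /coord mxE perm1.
split; first exact: subchart_atlas.
- by split.
- by rewrite cE.
- move=> y [_ [cy yk]]; rewrite cE (nc_zero Dc cy); split => [[k kk ky]|yi]; last by exists i.
  have [<- //|ki] := eqVneq k i.
  by have := yk k kk ki; rewrite ky eqxx.
Qed.

(** The last clause keeps away the branches that miss [p]: in the polydisc a coordinate [k < kappa]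
    vanishes only if it vanishes at [p] ([box_neq0]). *)
Definition box c kappa p r : Prop := [/\ nc_chart D c kappa, cdom c p, 0 < r,
  polydisc (cmap c p) r `<=` cimg c setT &
  forall k : 'I_n, (k < kappa)%N -> coord c k p != 0 -> r%:C <= `|coord c k p|].

Definition box_dom c p (r : R) : set X := [set x | cdom c x /\ polydisc (cmap c p) r (cmap c x)].

Lemma open_box_dom c p r : open (box_dom c p r).
Proof.
rewrite openE => x [cx px].
have n1 : nbhs x (cdom c) by apply: open_nbhs_nbhs; split => //; exact: cdom_open.
have n2 : nbhs x (cmap c @^-1` polydisc (cmap c p) r).
  by apply: chart_nbhs => //; apply: open_nbhs_nbhs; split => //; exact: open_polydisc.
by apply: filterS2 n1 n2 => y.
Qed.

Lemma box_dom_center c kappa p r : box c kappa p r -> box_dom c p r p.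
Proof. by move=> [_ cp r0 _ _]; split => //; exact: polydisc_center. Qed.

Lemma box_domS c p r s : r <= s -> box_dom c p r `<=` box_dom c p s.
Proof. by move=> rs x [cx px]; split => //; apply: polydiscS px. Qed.

Lemma box_exists c kappa p W : nc_chart D c kappa -> cdom c p -> nbhs p W ->
  exists2 r, box c kappa p r & box_dom c p r `<=` W.
Proof.
move=> Dc cp Wp.
have n1 := cinv_nbhs cp Wp.
have n2 : nbhs (cmap c p) (cimg c setT).
  by apply: open_nbhs_nbhs; split; [exact: open_cimg openT|exact: cimgP].
have [r0 r00 r0P] := (nbhs_polydisc _ _).1 (filterI (F := nbhs (cmap c p)) n1 n2).
(* The least of [r0] and the nonzero |z_k(p)|; real parts appear because norms on [R[i]] take values
   in [R[i]]. *)
pose r := \big[Num.min/r0]_(k : 'I_n | coord c k p != 0) complex.Re `|coord c k p|.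
have rp : 0 < r.
  rewrite /r; elim/big_ind: _ => // [a b a0 b0|k ck]; first by rewrite lt_min a0.
  by have := ck; rewrite -normr_gt0 normc_def ltcR.
have rr : r <= r0 by exact: bigmin_le_id.
exists r.
  split => //; first by move=> z /(polydiscS rr)/r0P[].
  move=> k _ ck; rewrite normc_def lecR.
  have h : complex.Re `|coord c k p| = Num.sqrt (complex.Re (coord c k p) ^+ 2 + complex.Im (coord c k p) ^+ 2).
    by rewrite normc_def.
  by rewrite -h; exact: bigmin_le_cond.
move=> x [cx px]; have /r0P[h _] : polydisc (cmap c p) r0 (cmap c x) by apply: polydiscS px.
by move: h; rewrite /= cmapK.
Qed.

Lemma box_neq0 c kappa p r x (k : 'I_n) : box c kappa p r -> box_dom c p r x -> (k < kappa)%N ->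
  coord c k x = 0 -> coord c k p = 0.
Proof.
move=> [_ _ _ _ rk] [cx px] kk xk; apply/eqP/negPn/negP => pk.
have := lt_le_trans (px k) (rk k kk pk).
by rewrite -/(coord c k x) xk sub0r normrN ltxx.
Qed.

(** For [i < kappa], the regular points of branch [i] in the box: a polydisc in a hyperplane minus
    other hyperplanes, which is connected. *)
Definition piece c (kappa : nat) p r i : set X :=
  [set x | [/\ box_dom c p r x, coord c i x = 0 &
    forall k : 'I_n, (k < kappa)%N -> k != i -> coord c k x != 0]].

Lemma piece_reg c kappa p r (i : 'I_n) : box c kappa p r -> (i < kappa)%N ->
  piece c kappa p r i `<=` reg.
Proof.
move=> [Dc cp _ _ _] ik x [[cx _] xi xk].
by apply/(reg_nc Dc cx); exists i.
Qed.

Lemma reg_piece c kappa p r x : box c kappa p r -> box_dom c p r x -> reg x ->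
  exists i : 'I_n, [/\ (i < kappa)%N, coord c i p = 0 & piece c kappa p r i x].
Proof.
move=> bc bx /(reg_nc _ bx.1) H; have [Dc cp _ _ _] := bc.
have [i [ik xi] xk] := H _ Dc; exists i; split => //.
exact: box_neq0 bc bx ik xi.
Qed.

Lemma piece_connected c kappa p r i : box c kappa p r -> connected (piece c kappa p r i).
Proof.
move=> [Dc cp r0 rc rk].
set A := [set z : 'rV[C]_n | [/\ polydisc (cmap c p) r z, z 0 i = 0 &
  forall k : 'I_n, (k < kappa)%N && (k != i) -> z 0 k != 0]].
have cA : connected A.
  by apply: connected_punctured => k /andP[kk _]; exact: rk.
have -> : piece c kappa p r i = cinv c @` A.
  apply/seteqP; split => [x [[cx px] xi xk]|_ [z [pz zi zk] <-]].
    exists (cmap c x); last exact: cmapK.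
    by split => // k /andP[kk ki]; exact: xk.
  have [y [cy _] yz] := rc z pz; rewrite -yz cmapK // /piece /=.
  split; [by split => //; rewrite yz|by rewrite /coord yz|move=> k kk ki].
  by rewrite /coord yz; apply: zk; rewrite kk.
apply: connected_continuous_connected cA _.
apply: continuous_in_subspaceT => z; rewrite inE => -[/rc[y [cy _] <-] _ _].
exact: cinv_continuous.
Qed.

(** Keeping z_i = 0 and moving the other vanishing coordinates off 0 leads into the piece, which is
    thus dense in its branch. *)
Lemma piece_near c kappa p r x (i : 'I_n) W : box c kappa p r -> box_dom c p r x -> nbhs x W ->
  coord c i x = 0 -> (W `&` piece c kappa p r i) !=set0.
Proof.
move=> bc bx Wx xi; have [[ac _ _] _ _ _ _] := bc.
have n2 : nbhs x (box_dom c p r) by apply: open_nbhs_nbhs; split => //; exact: open_box_dom.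
have [y [t [[Wy by_] cy t0 yE]]] := @chart_perturb _ _ _ c x
   (fun k => (k != i) && (coord c k x == 0)) _ ac bx.1 (filterI (F := nbhs x) Wx n2).
exists y; split => //; split => //; first by rewrite yE eqxx /= addr0.
move=> k kk ki; rewrite yE ki /=; have [->|xk] := eqVneq (coord c k x) 0; first by rewrite add0r.
by rewrite addr0.
Qed.

(** Such sets are the unions of connected components of [reg]. A component, its complement in [reg]
    and [reg] itself are all of this kind, so one description of closures serves them all. *)
Definition saturated U : Prop := U `<=` reg /\
  forall B, connected B -> B `<=` reg -> (B `&` U) !=set0 -> B `<=` U.

Lemma saturated_reg : saturated reg.
Proof. by split. Qed.

Lemma saturated_component x : saturated (connected_component reg x).
Proof.
split; first exact: connected_component_sub.
move=> B cB Br [y [By Cy]] z Bz; apply: connected_component_trans Cy _.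
exact: (connected_component_max By Br cB).
Qed.

Lemma saturatedD U : saturated U -> saturated (reg `\` U).
Proof.
move=> [Ur Us]; split; first by move=> x [].
move=> B cB Br [y [By [_ nUy]]] z Bz; split; first exact: Br.
by move=> Uz; apply/nUy/(Us B cB Br) => //; exists z.
Qed.

(** A connected piece is contained in [U] or disjoint from it, and pieces are dense in their
    branches; in the box the closure of [U] is a union of whole branches. *)
Lemma closure_saturated U c kappa p r x : saturated U -> box c kappa p r -> box_dom c p r x ->
  (closure U x <-> exists i : 'I_n, [/\ (i < kappa)%N, coord c i p = 0, coord c i x = 0 &
     piece c kappa p r i `<=` U]).
Proof.
move=> [Ur Us] bc bx; split => [clU|[i [ik pi xi iU]] B Bx]; last first.
  by have [y [By iy]] := piece_near bc bx Bx xi; exists y; split => //; exact: iU.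
have n1 : nbhs x (box_dom c p r) by apply: open_nbhs_nbhs; split => //; exact: open_box_dom.
have n2 : \forall z \near x, forall k : 'I_n, coord c k x != 0 -> coord c k z != 0.
  apply: filter_forall => k; have [xk|xk] := eqVneq (coord c k x) 0; first exact: nearW.
  by apply: filterS (coord_neq0_near bx.1 xk).
have [y [Uy [by_ yk]]] := clU _ (filterI (F := nbhs x) n1 n2).
have [i [ik pi iy]] := reg_piece bc by_ (Ur _ Uy).
exists i; split => //.
  apply/eqP/negPn/negP => /(yk i); case: iy => _ -> _; by rewrite eqxx.
apply: Us; [exact: piece_connected|exact: piece_reg|].
by exists y.
Qed.

Lemma box_at p W : nbhs p W -> exists c kappa r, [/\ box c kappa p r & box_dom c p r `<=` W].
Proof.
move=> Wp; have [c [kappa [cp Dc]]] := Dnc p.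
by have [r bc bW] := box_exists Dc cp Wp; exists c, kappa, r.
Qed.

(** A local equation is the product of the coordinates of the branches that belong to [U]; the empty
    product is 1 and defines the empty set. *)
Lemma analytic_closure U : saturated U -> analytic (closure U).
Proof.
move=> sU p; have [c [kappa [r [bc _]]]] := box_at (@filterT _ (nbhs p) _).
have [[ac _ _] cp _ _ _] := bc.
exists (box_dom c p r); split; [exact: open_box_dom|exact: box_dom_center bc|].
pose P (i : 'I_n) := `[< [/\ (i < kappa)%N, coord c i p = 0 & piece c kappa p r i `<=` U] >].
exists 1%N, (fun _ x => \prod_(i | P i) coord c i x); split => [_|x bx].
  apply: holo_fun_prod; first exact: open_box_dom.
  by move=> i _; apply: holo_fun_sub (holo_fun_coord i ac) => x [].
rewrite (closure_saturated sU bc bx); split => [[i [ik pi xi iU]] _|/(_ ord0)/eqP/prodf_eq0[i /asboolP[ik pi iU] /eqP xi]].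
  by apply/eqP/prodf_eq0; exists i; [apply/asboolP|apply/eqP].
by exists i.
Qed.

Lemma analytic_closed A : analytic A -> closed (A : set X).
Proof.
move=> aA p clA; have [W [oW Wp [m [f [hf fA]]]]] := aA p.
apply/fA => // i; apply/eqP/negPn/negP => fp.
have n1 : nbhs p W by apply: open_nbhs_nbhs.
have n2 : nbhs p [set y | f i y != 0].
  have := smooth_fun_cont oW (holo_fun_smooth (hf i)) Wp.
  by move/cvgr_neq0/(_ fp).
have [y [Ay [Wy fy]]] := clA _ (filterI (F := nbhs p) n1 n2).
by move: fy; rewrite /= ((fA y Wy).1 Ay i) eqxx.
Qed.

Lemma analyticI A B : analytic A -> analytic B -> analytic (A `&` B : set X).
Proof.
move=> aA aB p; have [W [oW Wp [m [f [hf fA]]]]] := aA p.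
have [W' [oW' Wp' [m' [f' [hf' fB]]]]] := aB p.
exists (W `&` W'); split; [exact: openI|by []|].
exists (m + m')%N, (fun i => match fintype.split i with inl j => f j | inr j => f' j end); split.
  move=> i; case: (fintype.split i) => j; first by apply: holo_fun_sub (hf j) => x [].
  by apply: holo_fun_sub (hf' j) => x [].
move=> x [Wx Wx']; split=> [[/fA-/(_ Wx) Ax /fB-/(_ Wx') Bx] i|H].
  by case: (fintype.split i).
split; [apply/fA => // j; have := H (lshift m' j)|apply/fB => // j; have := H (rshift m j)].
  by rewrite (unsplitK (inl j : 'I_m + 'I_m')%type).
by rewrite (unsplitK (inr j : 'I_m + 'I_m')%type).
Qed.

Lemma reg_near p W : reg p -> nbhs p W ->
  exists c i r, [/\ atlas c /\ cdom c p, box_dom c p r `<=` W, nbhs p (box_dom c p r),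
    polydisc (cmap c p) r `<=` cimg c setT &
    forall y, box_dom c p r y -> reg y <-> coord c i y = 0].
Proof.
move=> rp Wp; have [c [kappa [r [bc bW]]]] := box_at Wp.
have [Dc cp r0 rc _] := bc; have [ac _ _] := Dc.
have [i [ik pi [bp _ pk]]] := reg_piece bc (box_dom_center bc) rp.
exists c, i, r; split => //; first by apply: open_nbhs_nbhs; split => //; exact: open_box_dom.
move=> y by_; split => [ry|yi].
  have [j [jk pj [_ yj _]]] := reg_piece bc by_ ry.
  have [<- //|ji] := eqVneq j i.
  by have := pk j jk ji; rewrite pj eqxx.
apply/(reg_nc Dc by_.1); exists i => // k kk ki; apply/eqP => yk.
by have := pk k kk ki; rewrite (box_neq0 bc by_ kk yk) eqxx.
Qed.

(** Near [p], [reg] is a polydisc in a coordinate hyperplane, where the identity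
    theorem applies. *)
Lemma analytic_reg_closed A p : analytic A -> reg p ->
  closure (interior [set y | reg y -> A y] `&` reg) p -> interior [set y | reg y -> A y] p.
Proof.
move=> aA rp clp; have [W [oW Wp [m [f [hf fA]]]]] := aA p.
have [c [i [r [[ac cp] bW bn rc regE]]]] := reg_near rp (open_nbhs_nbhs (conj oW Wp)).
have hol l : holomorphic_on (polydisc (cmap c p) r) (in_chart c (f l)).
  apply: holo_sub (hf l c ac) => z pz; have [y [cy _] yz] := rc z pz.
  by exists y => //; split => //; apply: bW; split => //; rewrite yz.
have r0 : 0 < r.
  by have [_ /(_ i)] := nbhs_singleton bn; rewrite subrr normr0 ltcR.
have n4 : nbhs p (box_dom c p (r / 4)).
  apply: open_nbhs_nbhs; split; first exact: open_box_dom.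
  by split => //; apply: polydisc_center; rewrite divr_gt0.
have [q [[qi rq] bq]] := clp _ n4.
have b4 y : box_dom c p (r / 4) y -> box_dom c p r y.
  by apply: box_domS; rewrite ler_pdivrMr // ler_peMr ?(ltW r0) // ler1n.
apply: filterS n4 => y by_ ry; apply/fA; first exact/bW/b4.
move=> l; rewrite -(in_chartK (f l) by_.1).
apply: (@hyperplane_identity _ _ i _ (cmap c p) (cmap c q) _ r) => //.
- exact: bq.2.
- exact: by_.2.
- by apply/(regE q (b4 _ bq)).
- by apply/(regE y (b4 _ by_)).
- have n5 : nbhs q (box_dom c p r) by apply: open_nbhs_nbhs; split; [exact: open_box_dom|exact: b4].
  have n56 : nbhs q ([set y | reg y -> A y] `&` box_dom c p r) by exact: filterI.
  have n6 := cinv_nbhs bq.1 n56.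
  have n7 : nbhs (cmap c q) (cimg c setT).
    by apply: open_nbhs_nbhs; split; [exact: open_cimg openT|apply: cimgP => //; exact: bq.1].
  apply: (@filterS2 _ (nbhs (cmap c q)) _ _ _ _ _ n6 n7) => z [zi bz] [u [cu _] uz]; move: zi bz; rewrite -uz cmapK // => ui bu ui0.
  by rewrite in_chartK //; apply: ((fA u (bW _ bu)).1 _ l); apply: ui; apply/regE.
Qed.

(** Only one branch passes through a regular point, so in a small box [reg] is a single connected
    piece. *)
Lemma component_near x p : connected_component reg x p ->
  nbhs p [set y | reg y -> connected_component reg x y].
Proof.
move=> xp; have [c [kappa [r [bc _]]]] := box_at (@filterT _ (nbhs p) _).
have [Dc cp _ _ _] := bc; have rp := connected_component_sub xp.
have [i [ik pi ip]] := reg_piece bc (box_dom_center bc) rp.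
have [_ _ pk] := ip.
have n1 : nbhs p (box_dom c p r).
  by apply: open_nbhs_nbhs; split; [exact: open_box_dom|exact: box_dom_center bc].
apply: filterS n1 => y by_ ry.
have [j [jk pj jy]] := reg_piece bc by_ ry.
have ij : j = i.
  by apply/eqP/negPn/negP => ji; have := pk j jk ji; rewrite pj eqxx.
rewrite ij in jy; apply: (connected_component_trans xp).
by exists (piece c kappa p r i) => //; split => //; [exact: piece_reg|exact: piece_connected bc].
Qed.

(** If [A] contains a relatively open part of the component, then the points near which [reg] lies
    in [A] form an open and closed part of it, so [A] contains it all. Otherwise every point of the
    component is a limit of points of it outside [A], which lie in the closed set [B]. *)
Lemma irreducible_closure x : reg x -> irreducible_analytic (closure (connected_component reg x)).
Proof.
move=> rx; set K := connected_component reg x.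
have sK := saturated_component x.
split; first exact: analytic_closure.
  by exists x; apply: subset_closure; exact: connected_component_refl.
move=> A B aA aB E.
pose I := interior [set y | reg y -> A y].
have [[u [Ku Iu]]|nI] := pselect ((K `&` I) !=set0).
  left; apply/seteqP; split; first by rewrite E => y; left.
  suff KA : K `<=` A by rewrite (closure_id A).1; [exact: closureS|exact: analytic_closed].
  have KI : K `&` I = K.
    apply: (component_connected (A := reg) (x := x)); first by exists u.
      by exists I => //; exact: open_interior.
    exists (closure (K `&` I)); first exact: closed_closure.
    apply/seteqP; split => [y [Ky Iy]|y [Ky cy]].
      by split => //; apply: subset_closure.
    split => //; apply: analytic_reg_closed => //; first exact: sK.1 _ Ky.
    by apply: closureS cy => z [Kz Iz]; split => //; exact: sK.1 _ Kz.
  move=> y Ky; have [_ /interior_subset] : (K `&` I) y by rewrite KI.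
  by apply; exact: sK.1 _ Ky.
right; apply/seteqP; split; first by rewrite E => y; right.
suff KB : K `<=` B by rewrite (closure_id B).1; [exact: closureS|exact: analytic_closed].
move=> y Ky; rewrite (closure_id B).1; last exact: analytic_closed.
move=> W Wy; apply: contra_notP nI => WB; exists y; split => //.
apply: filterS2 Wy (component_near Ky) => z Wz Kz rz.
have : (A `|` B) z by rewrite -E; apply: subset_closure; exact: Kz.
by case=> // Bz; case: WB; exists z.
Qed.

Lemma closure_setD x y : connected_component reg x y ->
  ~ closure (reg `\` connected_component reg x) y.
Proof.
move=> xy cl; have [z [[rz nz] H]] := cl _ (component_near xy).
exact/nz/H.
Qed.

Lemma closure_component_inj x y : reg x -> reg y ->
  closure (connected_component reg x) = closure (connected_component reg y) ->
  connected_component reg x = connected_component reg y.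
Proof.
move=> rx ry E; apply: same_connected_component; apply: contrapT => nxy.
have : closure (connected_component reg y) x.
  by rewrite -E; apply: subset_closure; exact: connected_component_refl.
move=> clx; apply: (@closure_setD x x); first exact: connected_component_refl.
apply: closureS clx => z yz; split; first exact: connected_component_sub yz.
by move=> xz; apply: nxy; apply: connected_component_trans xz _; exact: connected_component_sym.
Qed.

(** D is the closure of [reg]. For maximality, an irreducible [Y] containing the closure of [K] is
    covered by the closures of [K] and of the rest of [reg], both analytic, and it does not lie in
    the second, which misses [x]. *)
Lemma component_irreducible x : reg x ->
  irreducible_component D (closure (connected_component reg x)).
Proof.
move=> rx; set K := connected_component reg x.
have sK := saturated_component x.
have DE y : D y <-> closure reg y.
  have [c [kappa [r [bc _]]]] := box_at (@filterT _ (nbhs y) _).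
  have by_ := box_dom_center bc; have [Dc cy _ _ _] := bc.
  rewrite (closure_saturated saturated_reg bc by_) (nc_zero Dc cy).
  split => [[k kk ky]|[k [kk _ ky _]]]; exists k => //.
  by split => //; exact: piece_reg.
split; first exact: irreducible_closure.
  by move=> y yK; apply/DE; apply: closureS yK; exact: connected_component_sub.
move=> Y [aY _ Yirr] YD KY; apply/seteqP; split => //.
have E : Y = (Y `&` closure K) `|` (Y `&` closure (reg `\` K)).
  rewrite -setIUr -closureU; apply/seteqP; split => [y Yy|y []//]; split => //.
  by rewrite setDUK; [apply/DE/YD|exact: connected_component_sub].
have aK := analytic_closure sK; have aKc := analytic_closure (saturatedD sK).
have [E1|E1] := Yirr _ _ (analyticI aY aK) (analyticI aY aKc) E.
  by rewrite -E1 => y [].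
have Kx : K x by exact: connected_component_refl.
have : Y x by apply: KY; exact: subset_closure.
by rewrite -E1 => -[_ /(@closure_setD x x)]; case.
Qed.

Hypothesis Dfin : finite_set [set Z | irreducible_component D Z].
Hypothesis Dsm : forall Z, irreducible_component D Z -> smooth_analytic Z.

(** Near [p] the closure of the component is a submanifold of some codimension [k]. If k > 0, a
    coordinate function vanishes on both branches, contrary to [chart_crossing]. If k = 0, the
    closure contains a neighbourhood of [p], yet it lies in the branches. *)
Lemma piece_component_inj c kappa p r x (i j : 'I_n) : box c kappa p r -> reg x ->
  (i < kappa)%N -> (j < kappa)%N -> coord c i p = 0 -> coord c j p = 0 ->
  piece c kappa p r i `<=` connected_component reg x ->
  piece c kappa p r j `<=` connected_component reg x -> i = j.
Proof.
move=> bc rx ik jk pi pj iK jK; apply/eqP/negPn/negP => ij.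
have Kirr := component_irreducible rx; have [_ Ksm] := Dsm Kirr.
have [Dc cp _ _ _] := bc; have [ac _ _] := Dc.
have sK := saturated_component x.
have bp := box_dom_center bc.
have Kp : closure (connected_component reg x) p.
  by apply/(closure_saturated sK bc bp); exists i.
have [k [_ _ [d [ad dp dK]]]] := Ksm p Kp.
have n1 : nbhs p (box_dom c p r) by apply: open_nbhs_nbhs; split => //; exact: open_box_dom.
have n2 : nbhs p (cdom d) by apply: open_nbhs_nbhs; split => //; exact: cdom_open.
have i0 : (0 < n)%N by case: (n) (i) => // -[].
have [k0|k0] := posnP k.
  (* All coordinates that vanish at [p] are moved off 0, so [y] is on no branch through [p]. *)
  have [y [t [[by_ dy] cy t0 yE]]] := @chart_perturb _ _ _ c p
     (fun l => coord c l p == 0) _ ac cp (filterI (F := nbhs p) n1 n2).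
  have /(closure_saturated sK bc by_)[l [lk lp yl _]] : closure (connected_component reg x) y.
    by apply/(dK y dy) => l; rewrite k0.
  by move: yl; rewrite yE lp eqxx add0r => /eqP; rewrite (negPf t0).
apply: (@chart_crossing _ _ _ c d p i j (Ordinal i0)) => //.
apply: filterS2 n1 n2 => y by_ dy yij.
apply: (dK y dy).1 => //; apply/(closure_saturated sK bc by_).
by case: yij => yi; [exists i|exists j].
Qed.

(** The closures are finitely many because they are among the irreducible components. [br j] is the
    branch of the j-th one at [p], [None] if there is none; it is unique by [piece_component_inj].
    Two closures with a common branch come from the same component of [reg], and every branch
    through [p] has a nonempty piece, hence occurs. *)
Lemma divisor_branches : exists (q : nat) (Dj : 'I_q -> set X),
  forall c kappa p, nc_chart D c kappa -> cdom c p ->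
  exists (W : set X) (br : 'I_q -> option 'I_n), [/\ open W, W p /\ W `<=` cdom c,
    forall j x, W x -> (Dj j x <-> exists2 i, br j = Some i & coord c i x = 0),
    forall j j' i, br j = Some i -> br j' = Some i -> j = j' &
    forall i, (exists j, br j = Some i) <-> (i < kappa)%N /\ coord c i p = 0].
Proof.
pose Zs := [set Z | exists2 x, reg x & Z = closure (connected_component reg x)].
have Zfin : finite_set Zs.
  by apply: sub_finite_set Dfin => _ [x rx ->]; exact: component_irreducible.
have /finite_setP[q qE] := Zfin.
have /card_set_bijP[f [f1 f2 f3]] : (`I_q #= Zs)%card by rewrite card_eq_sym.
have /choice[x0 x0P] : forall j : 'I_q, exists x, reg x /\ f j = closure (connected_component reg x).
  by move=> j; have [x rx E] := f1 j (ltn_ord j); exists x.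
exists q, (fun j => f j) => c kappa p Dc cp.
have [r bc _] := box_exists Dc cp (@filterT _ (nbhs p) _).
have bp := box_dom_center bc.
pose P j (i : 'I_n) := `[< [/\ (i < kappa)%N, coord c i p = 0 &
  piece c kappa p r i `<=` connected_component reg (x0 j)] >].
pose br j := [pick i | P j i].
have brP j i : br j = Some i <-> P j i.
  rewrite /br; case: pickP => [i' Pi'|nP]; split => //.
  - by move=> [<-].
  - move=> /asboolP[i1 i2 i3]; move/asboolP: Pi' => [i1' i2' i3'].
    by congr Some; apply: (piece_component_inj bc (x0P j).1).
  - by rewrite nP.
exists (box_dom c p r), br; split.
- exact: open_box_dom.
- by split => // x [].
- move=> j x bx; have [rj ->] := x0P j.
  rewrite (closure_saturated (saturated_component (x0 j)) bc bx).
  split => [[i [i1 i2 xi i3]]|[i /brP/asboolP[i1 i2 i3] xi]]; exists i => //.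
  by apply/brP/asboolP.
- move=> j j' i /brP/asboolP[i1 i2 i3] /brP/asboolP[_ _ i3'].
  have [y [_ iy]] := piece_near bc bp (@filterT _ (nbhs p) _) i2.
  have E : f j = f j'.
    rewrite (x0P j).2 (x0P j').2; congr closure; apply: same_connected_component.
    apply: connected_component_trans (i3 _ iy) _.
    exact/connected_component_sym/i3'.
  by apply: val_inj; exact: f2 (mem_set (ltn_ord j)) (mem_set (ltn_ord j')) E.
- move=> i; split => [[j /brP/asboolP[]//]|[i1 i2]].
  have [y [_ iy]] := piece_near bc bp (@filterT _ (nbhs p) _) i2.
  have ry := piece_reg bc i1 iy.
  have [j jq fj] : (f @` `I_q) (closure (connected_component reg y)).
    by apply: f3; exists y.
  exists (Ordinal jq); apply/brP/asboolP; split => //.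
  have [rj Ej] := x0P (Ordinal jq).
  rewrite (closure_component_inj rj ry); last by rewrite -Ej.
  apply: (connected_component_max iy); [exact: piece_reg|exact: piece_connected bc].
Qed.

End Branches.

(** * Line bundle of a smooth hypersurface *)

Section LocalEquations.
Context {R : realType} {n : nat} (X : complex_manifold R n).
Local Notation C := R[i].
Implicit Types (c d : chart R n X) (o : option 'I_n) (U W : set X) (x y p : X).

(** [None] stands for the equation 1 of a hypersurface that misses the chart, so both cases are
    treated alike. *)
Definition eq_coord c o x : C := if o is Some i then coord c i x else 1.

Lemma holo_eq_coord c o : atlas c -> holo_fun (cdom c) (eq_coord c o).
Proof. by case: o => [i|] ac; [exact: holo_fun_coord|exact: holo_fun_cst]. Qed.

(** The quotient is determined where the equation is not 0, which is a dense set; continuity does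
    the rest. *)
Lemma quotient_unique c o W (g g' : X -> C) : atlas c -> open W -> W `<=` cdom c ->
  smooth_fun W g -> smooth_fun W g' ->
  (forall x, W x -> g x * eq_coord c o x = g' x * eq_coord c o x) -> forall x, W x -> g x = g' x.
Proof.
move=> ac oW Wc sg sg' E x Wx; have [fx|fx] := eqVneq (eq_coord c o x) 0; last exact: (mulIf fx (E x Wx)).
case: o E fx => [i|] E /=; last by move/eqP; rewrite oner_eq0.
move=> xi; apply/eqP; rewrite -subr_eq0; apply/negPn/negP => gg.
have sd : smooth_fun W (fun y => g y + (-1) * g' y).
  by apply: smooth_fun_add => //; apply: smooth_fun_mul => //; exact: smooth_fun_cst.
have /(@cvgr_neq0 _ _ _ _ _ _ _) := smooth_fun_cont oW sd Wx.
rewrite mulN1r => /(_ gg) n1.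
have n2 : nbhs x W by apply: open_nbhs_nbhs.
have n3 : nbhs x ([set y | g y + (-1) * g' y != 0] `&` W) by exact: filterI.
have [y [t [[ny Wy] cy t0 yE]]] := @chart_perturb _ _ _ c x (pred1 i) _ ac (Wc x Wx) n3.
have yi : coord c i y != 0 by rewrite yE /= eqxx xi add0r.
by move: ny; rewrite /= (mulIf yi (E y Wy)) mulN1r subrr eqxx.
Qed.

Lemma quotient_local c o W (f : X -> C) p : atlas c -> open W -> W `<=` cdom c -> W p ->
  holo_fun W f -> (forall x, W x -> eq_coord c o x = 0 -> f x = 0) ->
  exists (V : set X) (G : X -> C), [/\ open V, V p, V `<=` W, holo_fun V G &
    forall x, V x -> f x = G x * eq_coord c o x].
Proof.
move=> ac oW Wc Wp hf f0.
(* Where the equation is not 0 it can be inverted; at a zero, [holo_division] applies in a polydisc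
   around [p]. *)
have [fp|fp] := eqVneq (eq_coord c o p) 0; last first.
  pose V := W `&` [set y | eq_coord c o y != 0].
  have oV : open V.
    rewrite openE => y [Wy fy].
    have n1 : nbhs y W by apply: open_nbhs_nbhs.
    have n2 : nbhs y [set y | eq_coord c o y != 0].
      have := smooth_fun_cont (cdom_open c) (holo_fun_smooth (holo_eq_coord o ac)) (Wc y Wy).
      by move/cvgr_neq0/(_ fy).
    by apply: filterS2 n1 n2.
  exists V, (fun x => f x * (eq_coord c o x)^-1); split => //.
  - by move=> x [].
  - apply: holo_fun_mul => //; first by apply: holo_fun_sub hf => x [].
    apply: holo_fun_inv => //; first by move=> x [].
    by apply: holo_fun_sub (holo_eq_coord o ac) => x [/Wc].
  - by move=> x [_ fx]; rewrite mulfVK.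
case: o f0 fp => [i|] f0 /=; last by move/eqP; rewrite oner_eq0.
move=> pi0; have cp := Wc p Wp.
have n1 := cinv_nbhs cp (open_nbhs_nbhs (conj oW Wp)).
have n2 : nbhs (cmap c p) (cimg c setT).
  by apply: open_nbhs_nbhs; split; [exact: open_cimg openT|exact: cimgP].
have n3 : nbhs (cmap c p) (cinv c @^-1` W `&` cimg c setT) by exact: filterI.
have [r r0 rP] := (nbhs_polydisc _ _).1 n3.
have bW : box_dom c p r `<=` W by move=> x [cx /rP[]]; rewrite /= cmapK.
have pW z : polydisc (cmap c p) r z -> cimg c W z.
  by move=> /rP[Wz [y [cy _] yz]]; exists y => //; split => //; move: Wz; rewrite -yz /= cmapK.
have hf' : holomorphic_on (polydisc (cmap c p) r) (in_chart c f) by exact: holo_sub (hf c ac).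
have f0' z : polydisc (cmap c p) r z -> z 0 i = 0 -> in_chart c f z = 0.
  by move=> /pW[y [cy Wy] <-] yi; rewrite in_chartK //; exact: f0.
have [G hG GE] := holo_division pi0 hf' f0'.
exists (box_dom c p r), (fun x => G (cmap c x)); split => //.
- exact: open_box_dom.
- by split => //; exact: polydisc_center.
- apply: holo_fun_local => x bx; exists c, (box_dom c p r); split => //.
  + exact: bx.1.
  + exact: open_box_dom.
  apply: (@holo_eq _ _ _ G); first by apply: open_cimg; exact: open_box_dom.
    by move=> _ [y [cy _] <-]; rewrite in_chartK.
  by apply: holo_sub hG => _ [y [_ [_ py]] <-].
- by move=> x [cx px]; rewrite -(in_chartK f cx) GE // mulrC.
Qed.

Lemma quotient_exists c o W (f : X -> C) : atlas c -> open W -> W `<=` cdom c ->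
  holo_fun W f -> (forall x, W x -> eq_coord c o x = 0 -> f x = 0) ->
  exists2 g, holo_fun W g & forall x, W x -> f x = g x * eq_coord c o x.
Proof.
move=> ac oW Wc hf f0.
have /choice[VG VGP] : forall p, exists VG : set X * (X -> C), W p ->
    [/\ open VG.1, VG.1 p, VG.1 `<=` W, holo_fun VG.1 VG.2 &
        forall x, VG.1 x -> f x = VG.2 x * eq_coord c o x].
  move=> p; have [Wp|nWp] := pselect (W p); last by exists (set0, fun=> 0).
  have [V [G H]] := quotient_local ac oW Wc Wp hf f0.
  by exists (V, G).
have same p y : W p -> (VG p).1 y -> (VG p).2 y = (VG y).2 y.
  move=> Wp py; have [op1 _ W1 h1 E1] := VGP p Wp.
  have Wy := W1 y py; have [op2 y2 W2 h2 E2] := VGP y Wy.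
  apply: (@quotient_unique c o ((VG p).1 `&` (VG y).1)) => //.
  - exact: openI.
  - by move=> z [/W1/Wc].
  - by apply: holo_fun_smooth; apply: holo_fun_sub h1 => z [].
  - by apply: holo_fun_smooth; apply: holo_fun_sub h2 => z [].
  - by move=> z [z1 z2]; rewrite -E1 // E2.
(* The value at [y] comes from the quotient chosen at [y]; by [same] it agrees with the one chosen
   at any [p] whose neighbourhood contains [y]. *)
exists (fun y => (VG y).2 y).
  apply: holo_fun_cover => p Wp; have [op1 p1 W1 h1 E1] := VGP p Wp.
  exists (VG p).1 => //; apply: holo_fun_eq h1 => // y py; exact: same.
by move=> x Wx; have [_ x1 _ _ E1] := VGP x Wx; exact: E1.
Qed.

(** [norm2] selects some trivialization; the transformation rules of metric and section make the
    choice immaterial. *)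
Lemma norm2E (L : line_bundle X) (h : hermitian_metric L) (s : holo_section L) a x :
  lb_dom a x -> norm2 h s x = met h a x * sqnorm (sec s a x).
Proof.
move=> ax; rewrite /norm2.
have [b bx ->] : [set r | exists2 a, lb_dom a x & r = met h a x * sqnorm (sec s a x)]
    (xget 0 [set r | exists2 a, lb_dom a x & r = met h a x * sqnorm (sec s a x)]).
  by apply: (@xgetPex _ 0); exists (met h a x * sqnorm (sec s a x)), a.
by rewrite (met_trans h ax bx) (sec_trans s ax bx) sqnormM mulrA.
Qed.

End LocalEquations.

(** * The line bundle of a hypersurface, its canonical section and a metric *)

Section DivisorBundle.
Context {R : realType} {n : nat} (X : complex_manifold R n).
Local Notation C := R[i].
Variables (E : set X).

Definition local_equation (co : chart R n X * option 'I_n) : Prop :=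
  atlas co.1 /\ forall x, cdom co.1 x -> (E x <-> eq_coord co.1 co.2 x = 0).

(** The trivializing cover consists of all charts in which [E] is a coordinate hyperplane or empty.
    With all of them present, a local argument can use the equation adapted to its own chart, see
    [loc_index_at]. *)
Definition loc_index : Type := {co | local_equation co}.

Definition loc_dom (a : loc_index) : set X := cdom (sval a).1.
Definition loc_fun (a : loc_index) : X -> C := eq_coord (sval a).1 (sval a).2.

Lemma open_loc_dom a : open (loc_dom a).
Proof. exact: cdom_open. Qed.

Lemma holo_loc_fun a : holo_fun (loc_dom a) (loc_fun a).
Proof. by apply: holo_eq_coord; case: (svalP a). Qed.

Lemma loc_fun_eq0 a x : loc_dom a x -> (E x <-> loc_fun a x = 0).
Proof. by case: (svalP a) => _; exact. Qed.

Lemma loc_trans_exists a b : exists2 g : X -> C, holo_fun (loc_dom a `&` loc_dom b) g &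
  forall x, loc_dom a x -> loc_dom b x -> loc_fun a x = g x * loc_fun b x.
Proof.
have [ab _] := svalP b.
have [||||g hg gE] := @quotient_exists _ _ _ (sval b).1 (sval b).2 (loc_dom a `&` loc_dom b) (loc_fun a) ab.
- by apply: openI; exact: open_loc_dom.
- by move=> x [].
- by apply: holo_fun_sub (@holo_loc_fun a) => x [].
- by move=> x [ax bx] x0; apply/(loc_fun_eq0 ax)/(loc_fun_eq0 bx).
- by exists g => // x ax bx; exact: gE.
Qed.

Definition loc_trans a b : X -> C := sval (cid2 (loc_trans_exists a b)).

Lemma holo_loc_trans a b : holo_fun (loc_dom a `&` loc_dom b) (loc_trans a b).
Proof. by rewrite /loc_trans; case: cid2. Qed.

Lemma loc_transE a b x : loc_dom a x -> loc_dom b x ->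
  loc_fun a x = loc_trans a b x * loc_fun b x.
Proof. by rewrite /loc_trans; case: cid2 => g /= _; exact. Qed.

(** Both sides are quotients of [loc_fun a] by [loc_fun c]; uniqueness gives the equality also on
    [E], where these equations vanish. *)
Lemma loc_cocycle a b c x : loc_dom a x -> loc_dom b x -> loc_dom c x ->
  loc_trans a b x * loc_trans b c x = loc_trans a c x.
Proof.
move=> ax bx cx; have [ac _] := svalP c.
have o3 : open (loc_dom a `&` loc_dom b `&` loc_dom c).
  by apply: openI; [apply: openI|]; exact: open_loc_dom.
apply: (@quotient_unique _ _ _ (sval c).1 (sval c).2 (loc_dom a `&` loc_dom b `&` loc_dom c)
  (fun x => loc_trans a b x * loc_trans b c x)) => //.
- apply: smooth_fun_mul => //; apply: holo_fun_smooth.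
    by apply: holo_fun_sub (holo_loc_trans a b) => y [[]].
  by apply: holo_fun_sub (holo_loc_trans b c) => y [[]].
- by apply: holo_fun_smooth; apply: holo_fun_sub (holo_loc_trans a c) => y [[]].
- by move=> y [[ay by_] cy]; rewrite -mulrA -!loc_transE // -/(loc_fun c y) -!loc_transE.
Qed.

Lemma loc_trans_id a x : loc_dom a x -> loc_trans a a x = 1.
Proof.
move=> ax; have [aa _] := svalP a.
apply: (@quotient_unique _ _ _ (sval a).1 (sval a).2 (loc_dom a) _ (fun=> 1)) => //.
- exact: open_loc_dom.
- by apply: holo_fun_smooth; have := @holo_loc_trans a a; rewrite setIid.
- exact: smooth_fun_cst.
- by move=> y ay; rewrite mul1r -/(loc_fun a y) -loc_transE.
Qed.

Lemma loc_trans_neq0 a b x : loc_dom a x -> loc_dom b x -> loc_trans a b x != 0.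
Proof.
move=> ax bx; have := loc_cocycle ax bx ax; rewrite loc_trans_id // => H.
by apply: contra_eq_neq H => ->; rewrite mul0r eq_sym oner_eq0.
Qed.

Hypothesis Eloc : forall p, exists a : loc_index, loc_dom a p.

Definition divisor_bundle : line_bundle X :=
  LineBundle open_loc_dom Eloc holo_loc_trans loc_trans_neq0 loc_cocycle.

Definition divisor_section : holo_section divisor_bundle :=
  @HoloSection R n X divisor_bundle loc_fun holo_loc_fun loc_transE.

Lemma zero_divisor_section : zero_set divisor_section = E.
Proof.
apply/seteqP; split => [x [a ax /(loc_fun_eq0 ax)//]|x Ex].
by have [a ax] := Eloc x; exists a => //; apply/(loc_fun_eq0 ax).
Qed.

(** Averages the metrics for which the frame over [al (p k)] has norm 1. At each point some [psi k]
    is not 0, and neither is the transition function, so the sum is positive. *)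
Lemma divisor_metric (x0 : X) : exists h : hermitian_metric divisor_bundle, True.
Proof.
have /choice[al alP] := Eloc.
have [p [psi [S [M [psiP SP psiS psi1 fin]]]]] := @partition_of_unity R n X
  (fun x => loc_dom (al x)) x0 (fun x => open_loc_dom (al x)) alP.
pose F k a x : R := psi k x * sqnorm (loc_trans (al (p k)) a x).
pose mt a x : R := \sum_(k < M x) F k a x.
have smt a : smooth_fun (loc_dom a) (fun x => (mt a x)%:C).
  have sF k : smooth_fun (loc_dom a) (fun x => (psi k x)%:C *
      (loc_trans (al (p k)) a x * (loc_trans (al (p k)) a x)^*%C)).
    have [cS SW] := SP k.
    apply: (smooth_fun_ext (open_loc_dom a) (open_loc_dom (al (p k))) cS SW) => //.
        by move=> y /psiS ->.
      by have [] := psiP k.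
    have o2 : open (loc_dom a `&` loc_dom (al (p k))) by apply: openI; exact: open_loc_dom.
    have sg := holo_fun_smooth (@holo_loc_trans (al (p k)) a); rewrite setIC in sg.
    by apply: smooth_fun_mul => //; exact: smooth_fun_conj.
  apply: smooth_fun_cover => x ax; have [V [oV Vx fV]] := fin x.
  exists (V `&` loc_dom a) => //.
  have o2 : open (V `&` loc_dom a) by apply: openI => //; exact: open_loc_dom.
  apply: (@smooth_fun_eq _ _ _ _ (fun y => \sum_(k < M x) (psi k y)%:C *
      (loc_trans (al (p k)) a y * (loc_trans (al (p k)) a y)^*%C)) _ o2).
    move=> y [Vy _]; rewrite /mt (fV y _ (fun k => F k a y) Vy) => [|k pk]; last first.
      by rewrite /F pk mul0r.
    rewrite rmorph_sum; apply: eq_bigr => k _.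
    by rewrite /F rmorphM /= sqnormE.
  apply: smooth_fun_sum => // k _.
  by apply: smooth_fun_sub (sF k) => y [].
have mt0 a x : loc_dom a x -> 0 < mt a x.
  move=> ax; have F0 k : 0 <= F k a x.
    by rewrite mulr_ge0 ?sqnorm_ge0 //; have [_] := psiP k.
  rewrite lt_neqAle eq_sym sumr_ge0 // andbT; apply/eqP => /eqP.
  rewrite psumr_eq0 // => /allP F00.
  have : \sum_(m < M x) psi m x = 0.
    apply: big1 => k _; apply/eqP/negPn/negP => pk.
    have Sk : S k x by apply: contrapT => /psiS pk0; rewrite pk0 eqxx in pk.
    have := F00 k (mem_index_enum _); rewrite /= mulf_eq0 (negPf pk) /= sqnorm_eq0.
    by apply/negP/loc_trans_neq0 => //; exact: (SP k).2.
  by rewrite psi1 => /eqP; rewrite oner_eq0.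
have mtt a b x : loc_dom a x -> loc_dom b x -> mt b x = mt a x * sqnorm (loc_trans a b x).
  move=> ax bx; rewrite mulr_suml; apply: eq_bigr => k _; rewrite /F -mulrA -sqnormM.
  have [Sk|/psiS ->] := pselect (S k x); last by rewrite !mul0r.
  by rewrite loc_cocycle //; exact: (SP k).2.
by exists (@HermitianMetric R n X divisor_bundle mt smt mt0 mtt).
Qed.

End DivisorBundle.

(** * Decomposition of tame forms *)

Section Logarithm.
Context {R : realType} {n : nat}.
Local Notation C := R[i].
Local Notation V := 'rV[R[i]]_n.
Implicit Types (U : set V) (f phi N : V -> R) (g : V -> C) (x : V).

Lemma ln_calculus U f : open U -> (forall x, U x -> 0 < f x) -> smooth_on U (fun x => (f x)%:C) ->
  smooth_on U (fun x => (ln (f x))%:C) /\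
  forall x k, U x -> d_z k (fun x => (ln (f x))%:C) x = (f x)%:C^-1 * d_z k (fun x => (f x)%:C) x /\
    d_zbar k (fun x => (ln (f x))%:C) x = (f x)%:C^-1 * d_zbar k (fun x => (f x)%:C) x.
Proof.
move=> oU f0 sf.
have si : smooth_on U (fun x => (f x)%:C^-1).
  apply: smooth_inv => // x Ux; rewrite real_complex_neq0 gt_eqF //; exact: f0.
have dl v x j : v = dir_x j \/ v = dir_y j -> U x ->
    rd v (fun x => (ln (f x))%:C) x ((f x)%:C^-1 * rderive v (fun x => (f x)%:C) x).
  move=> vj Ux; have /rdP fd := smooth_rd sf Ux vj; apply/rdP; move: (fd).
  have -> : rderive v (fun x => (f x)%:C) x = (complex.Re (rderive v (fun x => (f x)%:C) x))%:C.
    have [_ [_ di]] := fd; have [_ di0] := is_derive_cst (0 : R) (0 : R) (1 : R).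
    have E : complex.Im (rderive v (fun x => (f x)%:C) x) = 0 by rewrite -di; exact: di0.
    by rewrite [LHS]complexE E mulr0 addr0.
  rewrite -fmorphV -rmorphM => ff.
  apply: (cderiv_real_comp (phi := @ln R)); last exact: ff.
  by rewrite /= scale0r addr0; apply: is_derive1_ln; exact: f0.
split.
  move=> k; have lc x : U x -> cont_at (fun x => (ln (f x))%:C) x.
    move=> Ux; have [dP _] := is_derive1_ln (f0 x Ux).
    exact: (cont_real_comp (f := f) (psi := @ln R) (fun=> erefl)) dP (Ck_cont (sf 0%N) Ux).
  case: k => [|k]; first by apply/Ck0P; exact: lc.
  apply: (@CkS _ _ _ _ _ (fun v x => (f x)%:C^-1 * rderive v (fun x => (f x)%:C) x)); [exact: oU|exact: lc|].
  move=> j v vj; split; first by move=> x Ux; exact: dl vj Ux.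
  apply: Ck_mul; [exact: oU|exact: si|exact: smooth_rderive sf vj k].
move=> x k Ux.
have [-> ->] := d_zE (dl _ x k (or_introl erefl) Ux) (dl _ x k (or_intror erefl) Ux).
by rewrite /d_z /d_zbar; move: (rderive _ _ _) (rderive _ _ _) => a b; split; ring.
Qed.

(** Here log N = log phi + log |g|^2, and as the conjugate of [g] is antiholomorphic, [d_z k]
    differentiates only the factor [g] of |g|^2; [d_zbar k] only the conjugate factor. *)
Lemma d_z_log U N phi g x k : open U -> U x -> (forall x, U x -> 0 < phi x) ->
  smooth_on U (fun x => (phi x)%:C) -> holomorphic_on U g -> (forall x, U x -> g x != 0) ->
  (forall x, U x -> N x = phi x * sqnorm (g x)) ->
  d_z k (fun x => (ln (N x))%:C) x =
    d_z k (fun x => (ln (phi x))%:C) x + (g x)^-1 * d_z k g x /\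
  d_zbar k (fun x => (ln (N x))%:C) x =
    d_zbar k (fun x => (ln (phi x))%:C) x + (g x)^*%C^-1 * d_zbar k (fun x => (g x)^*%C) x.
Proof.
move=> oU Ux phi0 sphi hg g0 NE.
have sg := holo_smooth hg.
have sq0 y : U y -> 0 < sqnorm (g y).
  by move=> Uy; rewrite lt_neqAle sqnorm_ge0 andbT eq_sym sqnorm_eq0; exact: g0.
have sgg : smooth_on U (fun y => g y * (g y)^*%C) by apply: smooth_mul => //; exact: smooth_conj.
have sq : smooth_on U (fun y => (sqnorm (g y))%:C).
  by apply: smooth_eq sgg => // y _; rewrite sqnormE.
have [s1 _] := ln_calculus oU phi0 sphi.
have [s2 d2] := ln_calculus oU sq0 sq.
have E y : U y -> (ln (phi y))%:C + (ln (sqnorm (g y)))%:C = (ln (N y))%:C.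
  by move=> Uy; rewrite NE // lnM ?posrE ?sq0 ?phi0 // rmorphD.
have nE : \forall y \near x, (ln (phi y))%:C + (ln (sqnorm (g y)))%:C = (ln (N y))%:C.
  by apply: filterS (open_nbhs_nbhs (conj oU Ux)) => y; exact: E.
have [-> ->] := d_z_eq k nE (smooth_add oU s1 s2) Ux.
have [-> ->] := d_zD k s1 s2 Ux.
have [-> ->] := d2 x k Ux.
have nq : \forall y \near x, g y * (g y)^*%C = (sqnorm (g y))%:C by apply: (@nearW _ (nbhs x)) => y; rewrite sqnormE.
have [-> ->] := d_z_eq k nq sgg Ux.
have [-> ->] := d_zM k sg (smooth_conj oU sg) Ux.
have [-> ->] := d_z_conj k sg Ux.
have [_ /(_ x k Ux) ->] := hg.
have gx := g0 x Ux; have gx' : (g x)^*%C != 0 by rewrite conjC_eq0.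
have c0 : (0 : C)^*%C = 0 by rewrite /conjc /= oppr0.
rewrite c0 mulr0 addr0 mul0r add0r sqnormE invfM; split; congr (_ + _).
  by rewrite [d_z k g x * _]mulrC mulrA mulfVK.
by rewrite mulrACA mulVf // mul1r.
Qed.

End Logarithm.

Section LogForms.
Context {R : realType} {n : nat} (X : complex_manifold R n).
Local Notation C := R[i].
Implicit Types (c d : chart R n X) (W V : set X) (x : X) (phi N : X -> R) (f g : X -> C).

(** For [|s|^2 = phi |g|^2] these are [g del log |s|^2] and its conjugate: they are smooth
    across the zeros of [g]. *)
Definition dlog phi g : dform X := fun c x =>
  ext_scale (g x) (del (fun y => (ln (phi y))%:C) c x) + del g c x.
Definition dlogbar phi g : dform X := fun c x =>
  ext_scale (g x)^*%C (delbar (fun y => (ln (phi y))%:C) c x) + delbar (fun y => (g y)^*%C) c x.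

Lemma smooth_fun_ln W phi : open W -> (forall x, W x -> 0 < phi x) ->
  smooth_fun W (fun x => (phi x)%:C) -> smooth_fun W (fun x => (ln (phi x))%:C).
Proof.
move=> oW phi0 sphi c ac.
have phi0' z : cimg c W z -> 0 < phi (cinv c z).
  by move=> [y [cy Wy] <-]; rewrite cmapK //; exact: phi0.
by have [] := @ln_calculus _ _ (cimg c W) (fun z => phi (cinv c z)) (open_cimg oW) phi0' (sphi c ac).
Qed.

Lemma smooth_dlog W phi g : open W -> (forall x, W x -> 0 < phi x) ->
  smooth_fun W (fun x => (phi x)%:C) -> holo_fun W g ->
  smooth_form W 1 0 (dlog phi g) /\ smooth_form W 0 1 (dlogbar phi g).
Proof.
move=> oW phi0 sphi hg; have sg := holo_fun_smooth hg.
have sl := smooth_fun_ln oW phi0 sphi.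
have sgc := smooth_fun_conj oW sg.
have [l1 l2] := smooth_form_del oW sl; have [g1 _] := smooth_form_del oW sg.
have [_ g2] := smooth_form_del oW sgc.
by split; apply: smooth_form_add => //; exact: smooth_form_scale.
Qed.

Lemma del_log W N phi g c x : atlas c -> cdom c x -> open W -> W x ->
  (forall x, W x -> 0 < phi x) -> smooth_fun W (fun x => (phi x)%:C) -> holo_fun W g ->
  (forall x, W x -> g x != 0) -> (forall x, W x -> N x = phi x * sqnorm (g x)) ->
  del (fun y => (ln (N y))%:C) c x = ext_scale (g x)^-1 (dlog phi g c x) /\
  delbar (fun y => (ln (N y))%:C) c x = ext_scale (g x)^*%C^-1 (dlogbar phi g c x).
Proof.
move=> ac cx oW Wx phi0 sphi hg g0 NE.
have gx := g0 x Wx; have gx' : (g x)^*%C != 0 by rewrite conjC_eq0.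
have H k := @d_z_log _ _ (cimg c W) (fun z => N (cinv c z)) (fun z => phi (cinv c z))
  (in_chart c g) (cmap c x) k (open_cimg oW) (cimgP cx Wx).
have {}H k : d_z k (in_chart c (fun y => (ln (N y))%:C)) (cmap c x) =
    d_z k (in_chart c (fun y => (ln (phi y))%:C)) (cmap c x) + (g x)^-1 * d_z k (in_chart c g) (cmap c x) /\
    d_zbar k (in_chart c (fun y => (ln (N y))%:C)) (cmap c x) =
    d_zbar k (in_chart c (fun y => (ln (phi y))%:C)) (cmap c x) +
      (g x)^*%C^-1 * d_zbar k (in_chart c (fun y => (g y)^*%C)) (cmap c x).
  have := H k; rewrite (in_chartK g cx); apply.
  - by move=> _ [y [cy Wy] <-]; rewrite cmapK //; exact: phi0.
  - exact: sphi.
  - exact: hg.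
  - exact: cimg_neq0.
  - by move=> _ [y [cy Wy] <-]; rewrite /in_chart cmapK //; exact: NE.
split; apply/ffunP => S.
  rewrite ext_scaleE /dlog ffunE ext_scaleE /del !ext_sumE mulrDr mulrA mulVf // mul1r.
  rewrite mulr_sumr -big_split /=; apply: eq_bigr => k _; rewrite !ext_scaleE.
  by have [-> _] := H k; rewrite mulrDl mulrA.
rewrite ext_scaleE /dlogbar ffunE ext_scaleE /delbar !ext_sumE mulrDr mulrA mulVf // mul1r.
rewrite mulr_sumr -big_split /=; apply: eq_bigr => k _; rewrite !ext_scaleE.
by have [_ ->] := H k; rewrite mulrDl mulrA.
Qed.

Lemma open_smooth_neq0 W f : open W -> smooth_fun W f -> open (W `&` [set y | f y != 0]).
Proof.
move=> oW sf; rewrite openE => y [Wy fy].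
have n1 : nbhs y W by apply: open_nbhs_nbhs.
have n2 : nbhs y [set y | f y != 0].
  by have := smooth_fun_cont oW sf Wy; move/cvgr_neq0/(_ fy).
by apply: filterS2 n1 n2.
Qed.

End LogForms.

(** * Codimension of intersections *)

Section Codimension.
Context {R : realType} {n : nat} (X : complex_manifold R n).
Local Notation C := R[i].
Implicit Types (c d : chart R n X) (A W : set X) (x p : X).

(** Obtained by listing [I] before its complement; [regular_point] wants the vanishing coordinates
    first. *)
Lemma perm_to_front (I : {set 'I_n}) : exists s : 'S_n, forall i : 'I_n, (i < #|I|)%N = (s i \in I).
Proof.
pose l := enum I ++ enum (~: I)%SET.
have sl : size l = n by rewrite size_cat -!cardE cardsC card_ord.
have ul : uniq l.
  rewrite cat_uniq !enum_uniq andbT; apply/hasPn => i; rewrite !mem_enum inE.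
  by move=> /negPf ->.
have finj : injective (fun i : 'I_n => nth i l i).
  move=> i j; rewrite (set_nth_default j) ?sl // => /eqP.
  by rewrite nth_uniq ?sl // => /eqP/val_inj.
exists (perm finj) => i; rewrite permE nth_cat -cardE.
case: ltnP => iI; first by rewrite -mem_enum mem_nth // -cardE.
have : nth i (enum (~: I)%SET) (i - #|I|) \in enum (~: I)%SET.
  by rewrite mem_nth // -cardE -(ltn_add2r #|I|) subnK // [X in (_ < X)%N]addnC cardsC card_ord.
by rewrite mem_enum inE => /negPf ->.
Qed.

(** The functions [coord c a] with [a < k] vanish on [A], which contains the coordinate
    directions [b >= j] of [d]; hence a zero block in an invertible Jacobian. *)
Lemma regular_codim_le A j k x : regular_point A j x -> regular_point A k x -> (k <= j)%N.
Proof.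
move=> [Ax jn [d [ad dx dA]]] [_ kn [c [ac cx cA]]].
pose M := transition_jacobian d c x.
have M0 (a b : 'I_n) : (j <= a)%N -> (b < k)%N -> M a b = 0.
  move=> ja bk; rewrite mxE.
  have n1 : nbhs (cmap d x) (cimg d (cdom c)).
    by apply: open_nbhs_nbhs; split; [exact: open_cimg (cdom_open c)|exact: cimgP].
  have key (v : 'rV[C]_n) : (forall i : 'I_n, (i < j)%N -> v 0 i = 0) ->
      rderive v (in_chart d (coord c b)) (cmap d x) = 0.
    move=> v0; have H := line_near v n1.
    have : rd v (in_chart d (coord c b)) (cmap d x) 0.
      apply/rdP; apply: (@cderiv_eq _ (fun=> 0)); last exact: cderiv_cst.
      apply: filterS H => t -[y [dy cy] yE]; rewrite -yE in_chartK //.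
      apply/esym; apply: (cA y cy).1 => //; apply/(dA y dy) => i ij.
      by rewrite /coord yE !mxE v0 // mulr0 addr0; exact: (dA x dx).1.
    by move=> /rd_rderive[].
  rewrite /d_z !key ?mulr0 ?subrr ?mulr0 //.
    move=> i ij; rewrite /dir_y !mxE eqxx /=; case: eqP => [E|_]; last by rewrite mulr0.
    by move: ij; rewrite E ltnNge ja.
  move=> i ij; rewrite /dir_x !mxE eqxx /=; case: eqP => // E.
  by move: ij; rewrite E ltnNge ja.
have Mu : M \in unitmx by have [] := mulmx1_unit (jacobian_mul ad ac dx cx).
have Mf : row_full M by rewrite row_full_unit.
(* By the zero block, the rows of M *m pid_mx k from j on are 0, so multiplication by [pid_mx j]
   changes nothing and the rank k is at most j. *)
have E : (pid_mx j : 'M[C]_n) *m (M *m (pid_mx k : 'M[C]_n)) = M *m pid_mx k.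
  apply/matrixP => a b; rewrite [LHS]mxE (bigD1 a) //= big1 ?addr0 => [|e ea]; last first.
    by rewrite mxE eq_sym (inj_eq val_inj) (negPf ea) mul0r.
  rewrite mxE eqxx /=; case: ltnP => ja; first by rewrite mul1r.
  rewrite mul0r mxE big1 // => e _; rewrite [X in _ * X]mxE.
  case: ltnP => ek; last by rewrite andbF mulr0.
  by rewrite M0 // mul0r.
have := mxrankM_maxl (pid_mx j : 'M[C]_n) (M *m (pid_mx k : 'M[C]_n)).
by rewrite E (eqmxMfull _ Mf) !rank_pid_mx.
Qed.

(** In the given charts the intersection is cut out by |J| distinct coordinates, so all its points
    are regular of codimension |J|; [regular_codim_le] then excludes a smaller codimension at the
    same point. Indices outside [K] stand for sets that miss the chart. *)
Lemma pure_codim_coordinates q (Z : 'I_q -> set X) (J : {set 'I_q}) :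
  (forall p, exists c (K : {set 'I_q}) (f : 'I_q -> 'I_n), [/\ atlas c, cdom c p,
     {in K &, injective f} &
     forall j x, cdom c x -> (Z j x <-> j \in K /\ coord c (f j) x = 0)]) ->
  pure_codim [set x | forall j, j \in J -> Z j x] #|J|.
Proof.
move=> H; set A := [set x | _].
have reg_A p : A p -> regular_point A #|J| p.
  move=> Ap; have [c [K [f [ac cp finj cZ]]]] := H p.
  have JK j : j \in J -> j \in K by move=> /Ap/(cZ j p cp)[].
  have fJ : {in J &, injective f} by move=> a b /JK aK /JK bK; exact: finj.
  pose I := (f @: J)%SET.
  have cI : #|I| = #|J| by exact: card_in_imset.
  have [s sI] := perm_to_front I.
  split => //; first by rewrite -cI -[X in (_ <= X)%N](card_ord n) max_card.
  exists (subchart c openT s); split; first exact: subchart_atlas.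
    by split.
  move=> x [cx _].
  have cE i : coord (subchart c openT s) i x = coord c (s i) x by rewrite /coord mxE.
  split => [Ax i|Ax j jJ].
    by rewrite -cI sI cE => /imsetP[j /Ax/(cZ j x cx)[_ xj] ->].
  apply/(cZ j x cx); split; first exact: JK.
  have := Ax (s^-1 (f j))%g; rewrite cE permKV; apply.
  by rewrite -cI sI permKV imset_f.
split; last first.
  move=> p Ap; split; first by move=> W _ Wp; exists p => //; exact: reg_A.
  exists setT; split; [exact: openT|by []|move=> x j _ rx].
  have Ax : A x by case: rx.
  exact: regular_codim_le rx (reg_A x Ax).
move=> p; have [c [K [f [ac cp finj cZ]]]] := H p.
exists (cdom c); split; [exact: cdom_open|by []|].
(* One equation per index: 0 for j outside [J], a coordinate for j in [J] and [K], and 1 for j in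
   [J] outside [K], when the intersection misses the chart. *)
exists q, (fun j x => if j \in J then (if j \in K then coord c (f j) x else 1) else 0); split.
  move=> j; case: (j \in J); last exact: holo_fun_cst.
  by case: (j \in K); [exact: holo_fun_coord|exact: holo_fun_cst].
move=> x cx; split => [Ax j|Ax j jJ].
  by case: ifP => // /Ax/(cZ j x cx)[-> ->].
have := Ax j; rewrite jJ; case: ifP => [jK xj|_ /eqP]; last by rewrite oner_eq0.
by apply/(cZ j x cx).
Qed.

End Codimension.

(** * Local form of the decomposition *)

Section LocalDecomposition.
Context {R : realType} {n : nat} (X : complex_manifold R n).
Local Notation C := R[i].
Implicit Types (c d : chart R n X) (W V D : set X) (x p : X).

Lemma ext_prod_scale (T : finType) (J : {set T}) (z : T -> C) (F : T -> ext R n) :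
  \big[@ext_wedge R n/ext_one]_(j in J) ext_scale (z j) (F j) =
  ext_scale (\prod_(j in J) z j) (\big[@ext_wedge R n/ext_one]_(j in J) F j).
Proof.
elim: (index_enum T) => [|j r IH]; first by rewrite !big_nil ext_scale1.
rewrite !big_cons; case: ifP => // _.
by rewrite IH ext_wedge_scalel ext_wedge_scaler ext_scaleA.
Qed.

Lemma del_coord c k x : atlas c -> cdom c x ->
  del (coord c k) c x = ext_dz k /\ delbar (fun y => (coord c k y)^*%C) c x = ext_dzbar k.
Proof.
move=> ac cx; have o1 := @open_cimg R n X c setT openT.
have s1 : smooth_on (cimg c setT) (fun z => z 0 k) by exact: smooth_coord.
have n1 : nbhs (cmap c x) (cimg c setT) by apply: open_nbhs_nbhs; split => //; exact: cimgP.
have E1 : nbhs (cmap c x) [set z : 'rV[C]_n | z 0 k = in_chart c (coord c k) z].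
  by apply: filterS n1 => _ [y [cy _] <-] /=; rewrite in_chartK.
have E2 : nbhs (cmap c x) [set z : 'rV[C]_n | (z 0 k)^*%C = in_chart c (fun y => (coord c k y)^*%C) z].
  by apply: filterS n1 => _ [y [cy _] <-] /=; rewrite in_chartK.
have D1 l := d_z_eq l E1 s1 (nbhs_singleton n1).
have D2 l := d_z_eq l E2 (smooth_conj o1 s1) (nbhs_singleton n1).
have D3 l := @d_z_conj _ _ _ _ (cmap c x) l s1 (nbhs_singleton n1).
have c0 : (0 : C)^*%C = 0 by rewrite /conjc /= oppr0.
have c1 : (1 : C)^*%C = 1 by rewrite /conjc /= oppr0.
split.
  rewrite /del (bigD1 k) //= big1 ?addr0 => [|l lk].
    by have [-> _] := D1 k; have [-> _] := d_z_coord (cmap c x) k k; rewrite eqxx ext_scale1.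
  have [-> _] := D1 l; have [-> _] := d_z_coord (cmap c x) l k.
  by rewrite eq_sym (negPf lk) ext_scale0.
rewrite /delbar (bigD1 k) //= big1 ?addr0 => [|l lk].
  have [_ ->] := D2 k; have [_ ->] := D3 k; have [-> _] := d_z_coord (cmap c x) k k.
  by rewrite eqxx c1 ext_scale1.
have [_ ->] := D2 l; have [_ ->] := D3 l; have [-> _] := d_z_coord (cmap c x) l k.
by rewrite eq_sym (negPf lk) c0 ext_scale0.
Qed.

Lemma smooth_coefficient W (u v : nat) (w : dform X) c S : atlas c -> open W -> W `<=` cdom c ->
  smooth_form W u v w -> smooth_fun W (fun x => w c x S).
Proof.
move=> ac oW Wc [_ _ sw]; apply: smooth_fun_local => x Wx; exists c, W.
by split => //; [exact: Wc|exact: sw].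
Qed.

(** With [M] the product of the [dz_k /\ dzbar_k] over the coordinates [k] which cut out
    no [s_j], the form [M /\ (z_j del log|s_j|^2) /\ ...] is smooth and does not vanish at
    [p], so that the smooth numerator of [omega] is a multiple of it. *)
Lemma local_decomposition D (omega : dform X) q (N phi : 'I_q -> X -> R) p c kappa
    (e : dform X) W (J : {set 'I_q}) (f : 'I_q -> 'I_n) :
  (forall c d x, atlas c -> atlas d -> cdom c x -> cdom d x -> ~ D x ->
     omega c x = ext_pull (transition_jacobian c d x) (omega d x)) ->
  nc_chart D c kappa -> smooth_form (cdom c) n n e ->
  (forall x, cdom c x -> ~ D x -> omega c x = ext_scale
     ((sqnorm (\prod_(k < n | (k < kappa)%N) coord c k x))^-1%:C) (e c x)) ->
  open W -> W p -> W `<=` cdom c -> {in J &, injective f} ->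
  (forall i, (exists2 j, j \in J & f j = i) <-> (i < kappa)%N /\ coord c i p = 0) ->
  (forall j, smooth_fun W (fun x => (phi j x)%:C)) -> (forall j x, W x -> 0 < phi j x) ->
  (forall j x, j \in J -> W x -> N j x = phi j x * sqnorm (coord c (f j) x)) ->
  exists V w, [/\ open V, V p, smooth_form V (n - #|J|) (n - #|J|) w, (#|J| <= n)%N &
    forall d x, atlas d -> cdom d x -> V x -> ~ D x -> omega d x =
      wedge w (\big[@wedge R n X/@dform_one R n X]_(j in J)
        wedge (del (fun y => (ln (N j y))%:C)) (delbar (fun y => (ln (N j y))%:C))) d x].
Proof.
move=> om_inv Dc se om_tame oW Wp Wc finj fJ sphi phi0 NE; have [ac _ _] := Dc.
pose I := (f @: J)%SET.
have IP k : k \in I <-> exists2 j, j \in J & f j = k.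
  by split => [/imsetP[j jJ ->]|[j jJ <-]]; [exists j|exact: imset_f].
have cI : #|I| = #|J| by exact: card_in_imset.
have Jn : (#|J| <= n)%N by rewrite -cI -[X in (_ <= X)%N](card_ord n) max_card.
have cIc : #|(~: I)%SET| = (n - #|J|)%N by rewrite -cI -[X in (X - _)%N](card_ord n) -(cardsC I) addKn.
have hcoord k : holo_fun W (coord c k) by apply: holo_fun_sub (holo_fun_coord k ac).
have scoord k := holo_fun_smooth (hcoord k).
pose g j := coord c (f j).
pose F j := wedge (dlog (phi j) (g j)) (dlogbar (phi j) (g j)).
have sF j : smooth_form W 1 1 (F j).
  have [s1 s2] := smooth_dlog oW (phi0 j) (sphi j) (hcoord (f j)).
  exact: smooth_form_wedge oW s1 s2.
pose M := \big[@wedge R n X/@dform_one R n X]_(k in (~: I)%SET)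
  wedge (del (coord c k)) (delbar (fun y => (coord c k y)^*%C)).
have sM : smooth_form W (n - #|J|) (n - #|J|) M.
  rewrite -cIc; apply: smooth_form_prod => // k _.
  have [s1 _] := smooth_form_del oW (scoord k).
  have [_ s2] := smooth_form_del oW (smooth_fun_conj oW (scoord k)).
  exact: smooth_form_wedge oW s1 s2.
pose T := wedge M (\big[@wedge R n X/@dform_one R n X]_(j in J) F j).
have sT : smooth_form W n n T.
  have sFJ : smooth_form W #|J| #|J| (\big[@wedge R n X/@dform_one R n X]_(j in J) F j).
    by apply: smooth_form_prod.
  by have := smooth_form_wedge oW sM sFJ; rewrite subnK.
pose m x := T c x finset.setT.
have sm : smooth_fun W m by exact: smooth_coefficient sT.
pose et x := e c x finset.setT.
have set_ : smooth_fun W et.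
  exact: (smooth_coefficient _ ac oW Wc (smooth_form_sub Wc se)).
(* These factors of the denominator are not 0 at [p] and belong to no section through [p]; they go
   into the coefficient. *)
pose rest x := \prod_(i < n | (i < kappa)%N && (i \notin I)) coord c i x.
have srest : smooth_fun W rest by apply: smooth_fun_prod.
pose b x := m x * (rest x * (rest x)^*%C).
have sb : smooth_fun W b.
  apply: smooth_fun_mul => //; apply: smooth_fun_mul => //; exact: smooth_fun_conj.
have oV := open_smooth_neq0 oW sb.
set V := W `&` [set y | b y != 0] in oV.
(* At [p] the local equations g_j vanish, so the terms in log phi_j drop out and only the coordinate
   differentials remain. *)
have mp : m p != 0.
  change (ext_wedge (M c p) ((\big[@wedge R n X/@dform_one R n X]_(j in J) F j) c p)
    finset.setT != 0).
  rewrite /M !dform_prodE.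
  have E1 : \big[@ext_wedge R n/ext_one]_(j in (~: I)%SET)
      wedge (del (coord c j)) (delbar (fun y => (coord c j y)^*%C)) c p =
      \big[@ext_wedge R n/ext_one]_(k in (~: I)%SET) ext_wedge (ext_dz k) (ext_dzbar k).
    by apply: eq_bigr => k _; have [d1 d2] := del_coord k ac (Wc p Wp); rewrite /wedge d1 d2.
  have E2 : \big[@ext_wedge R n/ext_one]_(j in J) F j c p =
      \big[@ext_wedge R n/ext_one]_(j in J) ext_wedge (ext_dz (f j)) (ext_dzbar (f j)).
    apply: eq_bigr => j jJ; have [d1 d2] := del_coord (f j) ac (Wc p Wp).
    have [_ gp] : (f j < kappa)%N /\ coord c (f j) p = 0 by apply/fJ; exists j.
    have c0 : (0 : C)^*%C = 0 by rewrite /conjc /= oppr0.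
    by rewrite /F /wedge /dlog /dlogbar /g gp c0 !ext_scale0 !add0r d1 d2.
  rewrite E1 E2; exact: spans_full.
have rp : rest p != 0.
  apply/prodf_neq0 => i /andP[ik]; apply: contraNneq => ip.
  by apply/IP/fJ.
have conj0 (z : C) : z != 0 -> z^*%C != 0 by rewrite conjC_eq0.
have Vp : V p by split => //; rewrite /= mulf_neq0 // mulf_neq0 // conj0.
have VW : V `<=` W by move=> x [].
(* Off D, replacing the logarithmic forms by the F_j costs the factor 1 / |P|^2. Comparison of top
   coefficients, et / |P rest|^2 = a m / |P|^2, gives a = et / (m |rest|^2). *)
pose a x := et x * (b x)^-1.
have sa : smooth_fun V a.
  apply: smooth_fun_mul => //; first exact: smooth_fun_sub set_.
  by apply: smooth_fun_inv => //; [move=> x []|exact: smooth_fun_sub sb].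
pose w : dform X := fun d x => ext_scale (a x) (M d x).
have sw : smooth_form V (n - #|J|) (n - #|J|) w.
  by apply: smooth_form_scale => //; exact: smooth_form_sub sM.
pose eta j := wedge (del (fun y => (ln (N j y))%:C)) (delbar (fun y => (ln (N j y))%:C)).
pose P x := \prod_(j in J) g j x.
have sP : smooth_fun V P.
  by apply: smooth_fun_prod => // j _; exact: smooth_fun_sub (scoord (f j)).
have oU := open_smooth_neq0 oV sP.
(* On [U] no g_j vanishes and the logarithms are smooth; every point of [V] outside D is in [U]. *)
set U := V `&` [set y | P y != 0] in oU.
have UW : U `<=` W by move=> x [/VW].
have gU j x : j \in J -> U x -> g j x != 0 by move=> jJ [_ /prodf_neq0/(_ j jJ)].
have sN j : j \in J -> smooth_fun U (fun x => (N j x)%:C).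
  move=> jJ; apply: (@smooth_fun_eq _ _ _ _ (fun x => (phi j x)%:C * (g j x * (g j x)^*%C))) => //.
    by move=> x Ux; rewrite (NE j x jJ (UW x Ux)) -sqnormE rmorphM.
  have sgU : smooth_fun U (g j) by exact: smooth_fun_sub (scoord (f j)).
  apply: smooth_fun_mul => //; first exact: smooth_fun_sub (sphi j).
  by apply: smooth_fun_mul => //; exact: smooth_fun_conj.
have N0 j x : j \in J -> U x -> 0 < N j x.
  move=> jJ Ux; rewrite (NE j) //; last exact: UW.
  rewrite mulr_gt0 //; first exact/phi0/UW.
  by rewrite lt_neqAle sqnorm_ge0 andbT eq_sym sqnorm_eq0; exact: gU.
have seta j : j \in J -> smooth_form U 1 1 (eta j).
  move=> jJ; have sl := smooth_fun_ln oU (fun x => N0 j x jJ) (sN j jJ).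
  have [s1 s2] := smooth_form_del oU sl.
  exact: smooth_form_wedge oU s1 s2.
have sall : smooth_form U (n - #|J| + #|J|) (n - #|J| + #|J|)
    (wedge w (\big[@wedge R n X/@dform_one R n X]_(j in J) eta j)).
  apply: smooth_form_wedge => //; first by apply: smooth_form_sub sw => x [].
  exact: smooth_form_prod.
have inU x : V x -> ~ D x -> U x.
  move=> Vx nD; split => //; apply/prodf_neq0 => j jJ; apply/eqP => gx; apply: nD.
  apply/(nc_zero Dc (Wc x (VW x Vx))); exists (f j) => //.
  by have [] : (f j < kappa)%N /\ coord c (f j) p = 0 by apply/fJ; exists j.
have main x : V x -> ~ D x -> omega c x =
    wedge w (\big[@wedge R n X/@dform_one R n X]_(j in J) eta j) c x.
  move=> Vx nD; have Ux := inU x Vx nD; have Wx := VW x Vx; have cx := Wc x Wx.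
  have Px : P x != 0 by case: Ux.
  have bx : b x != 0 by case: Vx.
  have /andP[mx rrx] : (m x != 0) && (rest x * (rest x)^*%C != 0) by rewrite -negb_or -mulf_eq0.
  have /andP[rx rcx] : (rest x != 0) && ((rest x)^*%C != 0) by rewrite -negb_or -mulf_eq0.
  have E1 : \big[@ext_wedge R n/ext_one]_(j in J) eta j c x =
      ext_scale (\prod_(j in J) ((g j x)^-1 * (g j x)^*%C^-1))
        (\big[@ext_wedge R n/ext_one]_(j in J) F j c x).
    rewrite -ext_prod_scale; apply: eq_bigr => j jJ.
    have phiU y : U y -> 0 < phi j y by move=> /UW; exact: phi0.
    have NU y : U y -> N j y = phi j y * sqnorm (g j y) by move=> /UW; exact: NE.
    have gjU y : U y -> g j y != 0 by exact: gU.
    have [d1 d2] := del_log ac cx oU Ux phiU (smooth_fun_sub UW (sphi j))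
      (holo_fun_sub UW (hcoord (f j))) gjU NU.
    by rewrite /eta /wedge d1 d2 ext_wedge_scalel ext_wedge_scaler ext_scaleA.
  have E2 : ext_wedge (M c x) (\big[@ext_wedge R n/ext_one]_(j in J) F j c x) =
      ext_scale (m x) (ext_basis finset.setT).
    have [_ bT _] := sT; rewrite -dform_prodE.
    exact: bidegree_top (bT c x ac Wx cx).
  have E3 : e c x = ext_scale (et x) (ext_basis finset.setT).
    by have [_ be _] := se; exact: bidegree_top (be c x ac cx cx).
  have E4 : \prod_(k < n | (k < kappa)%N) coord c k x = P x * rest x.
    rewrite (bigID (mem I)) /=; congr (_ * _).
    rewrite -[RHS](big_imset (fun i => coord c i x) finj); apply: eq_bigl => i.
    apply/andP/idP => [[]//|iI]; split => //.
    by have [] : (i < kappa)%N /\ coord c i p = 0 by apply/fJ/IP.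
  change (omega c x = ext_wedge (w c x)
    ((\big[@wedge R n X/@dform_one R n X]_(j in J) eta j) c x)).
  rewrite om_tame // E3 E4 dform_prodE E1 /w ext_wedge_scalel ext_wedge_scaler E2 !ext_scaleA.
  congr ext_scale.
  have -> : \prod_(j in J) ((g j x)^-1 * (g j x)^*%C^-1) = (P x)^-1 * (P x)^*%C^-1.
    by rewrite big_split /= !prodfV rmorph_prod.
  have Pcx := conj0 _ Px.
  have -> : ((sqnorm (P x * rest x))^-1)%:C = (P x * rest x * (P x * rest x)^*%C)^-1.
    by rewrite -sqnormE fmorphV.
  rewrite rmorphM /= /a /b.
  move: (P x) (P x)^*%C (rest x) (rest x)^*%C (m x) (et x) Px Pcx rx rcx mx => P1 P2 r1 r2 m1 e1.
  by move=> h1 h2 h3 h4 h5; field; rewrite h1 h2 h3 h4 h5.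
exists V, w; split => // d x ad dx Vx nD.
(* The equality is known in the chart [c]; both sides transform alike under the Jacobian. *)
have cx := Wc x (VW x Vx); have [tr _ _] := sall.
by rewrite (om_inv d c) // main // -tr //; exact: inU.
Qed.

End LocalDecomposition.

(** * Gluing and conclusion *)

Section Assembly.
Context {R : realType} {n : nat} (X : complex_manifold R n).
Local Notation C := R[i].
Implicit Types (c d : chart R n X) (W V D : set X) (x p : X).

(** Trades the partial function [br] for an index set and a total function. The latter needs a
    default in 'I_n, whence the separate case n = 0, in which there are no coordinates and q = 0
    works. *)
Lemma hypersurface_branches D : normal_crossings D ->
  finite_set [set Z | irreducible_component D Z] ->
  (forall Z, irreducible_component D Z -> smooth_analytic Z) ->
  exists (q : nat) (Dj : 'I_q -> set X),
  forall c kappa p, nc_chart D c kappa -> cdom c p ->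
  exists (W : set X) (J : {set 'I_q}) (f : 'I_q -> 'I_n), [/\ open W, W p /\ W `<=` cdom c,
    forall j x, W x -> (Dj j x <-> j \in J /\ coord c (f j) x = 0),
    {in J &, injective f} &
    forall i, (exists2 j, j \in J & f j = i) <-> (i < kappa)%N /\ coord c i p = 0].
Proof.
move=> Dnc Dfin Dsm; have [[i0 _]|ni] := pselect (exists i : 'I_n, True); last first.
  exists 0%N, (fun=> set0) => c kappa p Dc cp; exists (cdom c), finset.set0, (fun j : 'I_0 => False_rect _ (notF (ltn_ord j))).
  split; [exact: cdom_open|by split| | |].
  - by move=> j; have := ltn_ord j; rewrite ltn0.
  - by move=> j; have := ltn_ord j; rewrite ltn0.
  - by move=> i; case: ni; exists i.
have [q [Dj H]] := divisor_branches Dnc Dfin Dsm; exists q, Dj => c kappa p Dc cp.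
have [W [br [oW WP brE br_inj brI]]] := H c kappa p Dc cp.
exists W, [set j | br j != None]%SET, (fun j => odflt i0 (br j)); split => //.
- move=> j x Wx; rewrite brE // inE; case: (br j) => [i|] /=; last by split => [[]|[]].
  by split => [[_ [<-]]|[_ xi]]; [|exists i].
- move=> j j'; rewrite !inE; case E : (br j) => [i|] //; case E' : (br j') => [i'|] //= _ _ ii.
  by apply: br_inj E _; rewrite E' ii.
- move=> i; rewrite -brI; split => [[j]|[j E]].
    by rewrite inE; case E : (br j) => [i'|] //= _ <-; exists j.
  by exists j; rewrite ?inE E.
Qed.

Lemma loc_index_at (E : set X) c W o : atlas c -> open W -> W `<=` cdom c ->
  (forall x, W x -> (E x <-> eq_coord c o x = 0)) ->
  exists2 a : loc_index E, (forall x, W x -> loc_dom a x) /\ loc_dom a `<=` W &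
    forall x, loc_fun a x = eq_coord c o x.
Proof.
move=> ac oW Wc WE.
have cE x : eq_coord (subchart c oW 1%g) o x = eq_coord c o x.
  by case: o {WE} => //= i; rewrite /coord mxE perm1.
have L : local_equation E (subchart c oW 1%g, o).
  by split => /=; [exact: subchart_atlas|move=> x [_ Wx]; rewrite cE; exact: WE].
exists (exist _ _ L); last exact: cE.
by split => [x Wx|x []]; [split => //; exact: Wc|].
Qed.

(** The index set of the local formula varies with the point, so each term of the partition of unity
    is credited to its own set and counts as 0 for the others. *)
Lemma glue_decompositions D (omega : dform X) q (b : {set 'I_q} -> dform X) (x0 : X) :
  (forall p, exists (V : set X) (J : {set 'I_q}) (w : dform X),
    [/\ open V, V p, smooth_form V (n - #|J|) (n - #|J|) w, (#|J| <= n)%N &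
     forall c x, atlas c -> cdom c x -> V x -> ~ D x -> omega c x = wedge w (b J) c x]) ->
  exists w : {set 'I_q} -> dform X,
    (forall J : {set 'I_q}, smooth_form setT (n - #|J|) (n - #|J|) (w J)) /\
    forall c x, atlas c -> cdom c x -> ~ D x ->
      omega c x = \sum_(J : {set 'I_q} | (#|J| <= minn n q)%N) wedge (w J) (b J) c x.
Proof.
move=> H; have /choice[V_ /choice[J_ /choice[w_ loc]]] := H.
have oV p : open (V_ p) by have [] := loc p.
have Vp p : V_ p p by have [] := loc p.
have [P [psi [S [M [psiP SP psiS psi1 fin]]]]] := partition_of_unity x0 oV Vp.
pose t k : dform X := fun c x => ext_scale (psi k x)%:C (w_ (P k) c x).
pose w (J : {set 'I_q}) : dform X := fun c x =>
  \sum_(k < M x) (if J_ (P k) == J then t k c x else 0).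
exists w; split => [J|c x ac cx nD].
  apply: smooth_form_cover => x _; have [V [oVx Vx fV]] := fin x; exists V => //.
  apply: (smooth_form_eq (w := fun c y => \sum_(k < M x | J_ (P k) == J) t k c y)) => //.
    move=> c y Vy; rewrite big_mkcond /w.
    rewrite (fV y _ (fun k => if J_ (P k) == J then t k c y else 0) Vy) // => k pk.
    by rewrite /t pk ext_scale0; case: ifP.
  apply: smooth_form_sum => // k /eqP <-; have [_ _ sw _ _] := loc (P k).
  have [cS SV] := SP k; have [sp _] := psiP k.
  apply: smooth_form_sub (@subsetT _ V) _; apply: (smooth_form_ext (oV (P k)) cS SV) => //.
  by move=> y /psiS ->.
have Jq (J : {set 'I_q}) : (#|J| <= q)%N by rewrite -[X in (_ <= X)%N](card_ord q) max_card.
have wE (J : {set 'I_q}) : wedge (w J) (b J) c x =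
    \sum_(k < M x) (if J_ (P k) == J then ext_wedge (t k c x) (b (J_ (P k)) c x) else 0).
  rewrite /wedge /w ext_wedge_suml; apply: eq_bigr => k _.
  by case: eqP => [->|_]; rewrite ?ext_wedge0l.
under eq_bigr do rewrite wE.
rewrite exchange_big /=.
have kE k : \sum_(J : {set 'I_q} | (#|J| <= minn n q)%N)
    (if J_ (P k) == J then ext_wedge (t k c x) (b (J_ (P k)) c x) else 0) =
    ext_scale (psi k x)%:C (omega c x).
  have [_ _ _ Jn dec] := loc (P k).
  (* Only the set attached to [P k] contributes; it has at most n and at most q elements, so it is
     one of the summands. *)
  rewrite (bigD1 (J_ (P k))) /= ?leq_min ?Jn ?Jq // eqxx big1 ?addr0; last first.
    by move=> J /andP[_]; rewrite eq_sym => /negPf ->.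
  rewrite /t ext_wedge_scalel; have [Sk|/psiS ->] := pselect (S k x); last by rewrite !ext_scale0.
  by rewrite (dec c x) //; exact: (SP k).2.
under eq_bigr do rewrite kE.
apply/ffunP => A; rewrite ext_sumE; under eq_bigr do rewrite ext_scaleE.
by rewrite -mulr_suml -rmorph_sum psi1 mul1r.
Qed.

End Assembly.

Theorem proposition5p2 (R : realType) (n : nat) (X : complex_manifold R n)
    (L0 : line_bundle X) (h0 : hermitian_metric L0) (s0 : holo_section L0)
    (D_nc : normal_crossings (zero_set s0))
    (D_finite : finite_set [set Z | irreducible_component (zero_set s0) Z])
    (D_smooth : forall Z, irreducible_component (zero_set s0) Z ->
       smooth_analytic Z)
    (omega : dform X)
    (omega_qm : quasi_meromorphic h0 s0 n n omega)
    (omega_tame : tame (zero_set s0) omega) :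
  exists (q : nat) (L : 'I_q -> line_bundle X)
         (h : forall j, hermitian_metric (L j))
         (s : forall j, holo_section (L j)),
    (forall J : {set 'I_q}, (0 < #|J|)%N -> (#|J| <= minn n q)%N ->
       pure_codim [set x : X | forall j, j \in J -> zero_set (s j) x] #|J|) /\
    exists w : {set 'I_q} -> dform X,
      (forall J : {set 'I_q}, (#|J| <= minn n q)%N ->
         smooth_form setT (n - #|J|)%N (n - #|J|)%N (w J)) /\
      forall c x, atlas c -> cdom c x -> ~ zero_set s0 x ->
        (forall j, ~ zero_set (s j) x) ->
        omega c x =
        \sum_(J : {set 'I_q} | (#|J| <= minn n q)%N)
           wedge (w J)
             (\big[@wedge R n X/@dform_one R n X]_(j in J)
                wedge (del (log_norm2 (h j) (s j)))
                      (delbar (log_norm2 (h j) (s j)))) c x.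
Proof.
(* The partition of unity needs a point as default value; on an empty [X], q = 0 and zero forms
   do. *)
have [[x0 _]|nX] := pselect (exists x : X, True); last first.
  have no j : 'I_0 -> j by case.
  exists 0%N, (fun j => no _ j), (fun j => no _ j), (fun j => no _ j); split.
    move=> J J0; suff : (#|J| <= 0)%N by rewrite leqNgt J0.
    by rewrite -[X in (_ <= X)%N](card_ord 0) max_card.
  exists (fun _ _ _ => 0); split; first by move=> J _; exact: smooth_form0.
  by move=> c x; case: nX; exists x.
have [q [Dj branch]] := hypersurface_branches D_nc D_finite D_smooth.
(* For j outside [J] the hypersurface misses [W], and its equation there is 1. *)
have loc c kappa W (J : {set 'I_q}) (f : 'I_q -> 'I_n) j : nc_chart (zero_set s0) c kappa ->
    open W -> W `<=` cdom c ->
    (forall j x, W x -> (Dj j x <-> j \in J /\ coord c (f j) x = 0)) ->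
    exists2 a : loc_index (Dj j), (forall x, W x -> loc_dom a x) /\ loc_dom a `<=` W &
      forall x, loc_fun a x = if j \in J then coord c (f j) x else 1.
  move=> [ac _ _] oW Wc WD.
  have [|a a1 a2] := @loc_index_at R n X (Dj j) c W (if j \in J then Some (f j) else None) ac oW Wc.
    move=> x Wx; rewrite WD //; case: (j \in J) => /=; first by split => [[]|].
    by split => [[]|/eqP] //; rewrite oner_eq0.
  by exists a => // x; rewrite a2; case: (j \in J).
have Eloc j p : exists a : loc_index (Dj j), loc_dom a p.
  have [c [kappa [cp Dc]]] := D_nc p; have [W [J [f [oW [Wp Wc] WD _ _]]]] := branch c kappa p Dc cp.
  by have [a [aW _] _] := loc c kappa W J f j Dc oW Wc WD; exists a; exact: aW.
pose L j := divisor_bundle (Eloc j).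
pose h j : hermitian_metric (L j) := sval (cid (divisor_metric (Eloc j) x0)).
pose s j : holo_section (L j) := divisor_section (Eloc j).
have sZ j : zero_set (s j) = Dj j by exact: zero_divisor_section.
exists q, L, h, s; split.
  move=> J _ _; apply: pure_codim_coordinates => p.
  have [c [kappa [cp Dc]]] := D_nc p; have [W [K [f [oW [Wp Wc] WD finj _]]]] := branch c kappa p Dc cp.
  exists (subchart c oW 1%g), K, f; split => //; first by apply: subchart_atlas; case: Dc.
  by move=> j x [_ Wx]; rewrite sZ WD // /coord mxE perm1.
have [om_form _] := omega_qm; have [om_inv _ _] := om_form.
have [|w [sw wE]] := @glue_decompositions R n X (zero_set s0) omega q (fun J =>
  \big[@wedge R n X/@dform_one R n X]_(j in J)
    wedge (del (log_norm2 (h j) (s j))) (delbar (log_norm2 (h j) (s j)))) x0; last first.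
  by exists w; split => // c x ac cx nD _; exact: wE.
(* The branches are read in the chart provided by tameness, so the same coordinates occur in the
   denominator of omega and as local equations of the s_j. *)
move=> p; have [c [kappa [e [cp Dc se eE]]]] := omega_tame p.
have [W [J [f [oW [Wp Wc] WD finj fJ]]]] := branch c kappa p Dc cp.
have aE : forall j, exists a : loc_index (Dj j),
    [/\ forall x, W x -> loc_dom a x, loc_dom a `<=` W &
        forall x, loc_fun a x = if j \in J then coord c (f j) x else 1].
  by move=> j; have [a [a1 a2] a3] := loc c kappa W J f j Dc oW Wc WD; exists a.
have [a aP] : exists a : forall j, loc_index (Dj j), forall j,
    [/\ forall x, W x -> loc_dom (a j) x, loc_dom (a j) `<=` W &
        forall x, loc_fun (a j) x = if j \in J then coord c (f j) x else 1].
  by exists (fun j => sval (cid (aE j))) => j; exact: svalP (cid (aE j)).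
have aW j x : W x -> loc_dom (a j) x by have [+ _ _] := aP j; exact.
(* In the frame given by [a j], the squared norm of s_j is the smooth positive factor
   [met (h j) (a j)] times the squared modulus of the coordinate; that factor serves as phi_j. *)
have NE j x : j \in J -> W x ->
    norm2 (h j) (s j) x = met (h j) (a j) x * sqnorm (coord c (f j) x).
  move=> jJ Wx; rewrite (norm2E (h j) (s j) (aW j x Wx)); congr (_ * sqnorm _).
  by have [_ _ /(_ x)] := aP j; rewrite jJ.
have [V [w [oV Vp sw Jn wE]]] := @local_decomposition R n X (zero_set s0) omega q
  (fun j => norm2 (h j) (s j)) (fun j => met (h j) (a j)) p c kappa e W J f
  (fun c d x ac ad cx dx nD => om_inv c d x ac ad nD cx dx) Dc se eE oW Wp Wc finj fJ
  (fun j => smooth_fun_sub (fun x => aW j x) (met_smooth (h j) (a j)))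
  (fun j x Wx => met_gt0 (h j) (aW j x Wx))
  NE.
by exists V, J, w.
Qed.
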